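(* Let $T>0$, $r\ge0$, and let $(S_t)_{t\in[0,T]}$ be a continuous semimartingale with $\mathbb P(S_t>0\ \forall t\in[0,T])=1$ such that $(\mathrm e^{-rt}S_t)_{t\in[0,T]}$ is a martingale. Let $(\mathcal P_T^N)_{N\ge1}$, $\mathcal P_T^N=\{t_0,\dots,t_N\}$ with $0=t_0<t_1<\dots<t_N=T$ (depending on $N$), be a sequence of monitoring grids with mesh sizes $\Delta_N=\max_{0\le j\le N-1}(t_{j+1}-t_j)\to0$, and let $$G_T^N:=\exp\Bigl(\frac1{T_N}\sum_{j=0}^N\omega_j^N\log(S_{t_j})\Bigr),\qquad G_T^c:=\exp\Bigl(\frac1T\int_0^T\log(S_t)\,\mathrm dt\Bigr),$$ with $\omega_j^N=t_{j+1}-t_j$ for $j=0,\dots,N-1$, $\omega_N^N=t_N-t_{N-1}$, $T_N=\sum_{j=0}^N\omega_j^N=T+\omega_N^N$. Suppose that there exists $q>1$ such that $\mathbb E[S_T^{2q}]<\infty$. Set $X_t:=\log S_t$ and suppose that $X$ admits the semimartingale decomposition $X_t=X_0+A_t+M_t$, where $A$ is a continuous finite-variation process with $A_0=0$ and $M$ is a continuous local martingale with $M_0=0$, such that $$\bigl\||A|_T\bigr\|_{L^{2q}(\Omega)}+\bigl\|\langle M\rangle_T^{1/2}\bigr\|_{L^{2q}(\Omega)}<\infty.$$ Let $h:\mathbb R_+^2\to\mathbb R$ be measurable and satisfy $|h(x,y)-h(x',y)|\le L_h|x-x'|$ for all $x,x',y>0$ and some $L_h\in(0,\infty)$, and assume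 that $h(1,S_T)\in L^q(\Omega)$. Define $H_t^{h,N}:=\mathrm e^{-r(T-t)}\mathbb E[h(G_T^N,S_T)\mid\mathcal F_t]$ and $H_t^{h,c}:=\mathrm e^{-r(T-t)}\mathbb E[h(G_T^c,S_T)\mid\mathcal F_t]$. Then there exists a constant $\Lambda_{q,h}(T)>0$, independent of $N$, such that $$\mathbb E\Bigl[\sup_{t\in[0,T]}|H_t^{h,N}-H_t^{h,c}|^q\Bigr]\le\Lambda_{q,h}(T)\,\Delta_N^q.$$
   Context: The processes live on a filtered probability space $(\Omega,\mathcal F,(\mathcal F_t)_{t\in[0,T]},\mathbb P)$ satisfying the usual conditions, and càdlàg versions of conditional-expectation martingales are used. $|A|_T$ denotes the total variation of $A$ on $[0,T]$ and $\langle M\rangle$ the quadratic variation of $M$. *)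

(* Defs.v *)
From HB Require Import structures.
From mathcomp Require Export all_boot all_order all_algebra.
From mathcomp Require Export all_classical all_reals all_analysis.

Set Implicit Arguments.
Unset Strict Implicit.
Unset Printing Implicit Defensive.

Export Order.TTheory GRing.Theory Num.Theory.
Export numFieldNormedType.Exports.

Local Open Scope classical_set_scope.
Local Open Scope ring_scope.

(* A process on [0,T] is a function [X : R -> Omega -> R], time first, and a
   filtration is a function [F : R -> set (set Omega)]; only their values at
   times in [0,T] are ever constrained. Path properties are required almost
   surely; under the usual conditions every exceptional set involved is in F_0. *)

Section paths.
Context {R : realType}.
Implicit Types (T : R) (f : R -> R).

Definition continuous_path T f := {within `[0, T], continuous f}.

Definition cadlag_path T f :=
  (forall t : R, 0 <= t < T -> f x @[x --> t^'+] --> f t) /\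
  (forall t : R, 0 < t <= T -> exists l : R, f x @[x --> t^'-] --> l).

End paths.

Section processes.
Context {d : measure_display} {Omega : measurableType d} {R : realType}.
Variables (P : probability Omega R) (T : R) (F : R -> set (set Omega)).
Implicit Types (G : set (set Omega)) (X Y M A Q V : R -> Omega -> R).

Record is_filtration : Prop := {
  filtration_sigma : forall t : R, 0 <= t <= T -> sigma_algebra [set: Omega] (F t) ;
  filtration_measurable : forall t : R, 0 <= t <= T -> F t `<=` measurable ;
  filtration_le : forall s t : R, 0 <= s -> s <= t -> t <= T -> F s `<=` F t
}.

Record usual_conditions : Prop := {
  usual_complete : forall B, P.-negligible B -> F 0 B ;
  usual_right_continuous : forall t : R, 0 <= t < T ->
    F t = \bigcap_(s in [set s : R | t < s <= T]) F s
}.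

(* [f] is measurable with respect to the sub-sigma-algebra [G] *)
Definition measurable_wrt G (f : Omega -> R) :=
  preimage_set_system [set: Omega] f measurable `<=` G.

Definition adapted X := forall t : R, 0 <= t <= T -> measurable_wrt (F t) (X t).

(* [Y] is a version of the conditional expectation E[Z | G] *)
Record is_condexp G (Z Y : Omega -> R) : Prop := {
  condexp_integrable : P.-integrable [set: Omega] (EFin \o Y) ;
  condexp_measurable : measurable_wrt G Y ;
  condexp_integral : forall B, G B ->
    (\int[P]_(w in B) (Y w)%:E = \int[P]_(w in B) (Z w)%:E)%E
}.

Record is_martingale M : Prop := {
  martingale_adapted : adapted M ;
  martingale_integrable : forall t : R, 0 <= t <= T ->
    P.-integrable [set: Omega] (EFin \o M t) ;
  martingale_condexp : forall s t : R, 0 <= s -> s <= t -> t <= T ->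
    is_condexp (F s) (M t) (M s)
}.

Definition continuous_process X :=
  {ae P, forall w, continuous_path T (X ^~ w)}.

Definition cadlag_process X := {ae P, forall w, cadlag_path T (X ^~ w)}.

Definition null_at_0 X := {ae P, forall w, X 0 w = 0}.

Record is_stopping_time (tau : Omega -> R) : Prop := {
  stopping_ge0 : forall w, 0 <= tau w ;
  stopping_measurable : forall t : R, 0 <= t <= T -> F t [set w | tau w <= t]
}.

(* Time lives in the closed interval [0,T], so a localizing sequence has to
   reach T after finitely many steps, almost surely. *)
Record is_localizing (tau : nat -> Omega -> R) : Prop := {
  localizing_stopping : forall n, is_stopping_time (tau n) ;
  localizing_nondecreasing :
    {ae P, forall w, forall n, tau n w <= tau n.+1 w} ;
  localizing_reach : {ae P, forall w, \forall n \near \oo, T <= tau n w}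
}.

Definition stopped X (tau : Omega -> R) : R -> Omega -> R :=
  fun t w => X (Num.min t (tau w)) w.

Record is_local_martingale M : Prop := {
  local_martingale_adapted : adapted M ;
  local_martingale_cadlag : cadlag_process M ;
  local_martingale_localized : exists2 tau : nat -> Omega -> R,
    is_localizing tau &
    forall n, is_martingale (fun t w => stopped M (tau n) t w - M 0 w)
}.

Record is_finite_variation A : Prop := {
  finite_variation_adapted : adapted A ;
  finite_variation_cadlag : cadlag_process A ;
  finite_variation_bv : {ae P, forall w, bounded_variation 0 T (A ^~ w)}
}.

Record semimartingale_decomposition X A M : Prop := {
  decomposition_fv : is_finite_variation A ;
  decomposition_fv0 : null_at_0 A ;
  decomposition_lm : is_local_martingale M ;
  decomposition_lm0 : null_at_0 M ;
  decomposition_eq : {ae P, forall w, forall t : R, 0 <= t <= T ->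
    X t w = X 0 w + A t w + M t w}
}.

Definition is_semimartingale X :=
  adapted X /\ exists A M, semimartingale_decomposition X A M.

Definition is_continuous_semimartingale X :=
  is_semimartingale X /\ continuous_process X.

(* [Q] is a version of the quadratic variation <M> of the continuous local
   martingale [M] *)
Record is_quadratic_variation M Q : Prop := {
  quadratic_variation_adapted : adapted Q ;
  quadratic_variation_continuous : continuous_process Q ;
  quadratic_variation_null0 : null_at_0 Q ;
  quadratic_variation_nondecreasing : {ae P, forall w, forall s t : R,
    0 <= s -> s <= t -> t <= T -> Q s w <= Q t w} ;
  quadratic_variation_lm : is_local_martingale (fun t w => M t w ^+ 2 - Q t w)
}.

(* [V] is a cadlag version of the martingale E[Z | F_t], t in [0,T] *)
Record is_cadlag_condexp_martingale (Z : Omega -> R) V : Prop := {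
  condexp_martingale_cadlag : cadlag_process V ;
  condexp_martingale_version : forall t : R, 0 <= t <= T ->
    is_condexp (F t) Z (V t)
}.

End processes.

Section asian.
Context {R : realType}.
Implicit Types (T r : R) (N j : nat) (t : nat -> R).

(* The points of the grid are [t 0], ..., [t N]. *)
Record is_monitoring_grid T N t : Prop := {
  grid_first : t 0%N = 0 ;
  grid_last : t N = T ;
  grid_lt : forall j, (j < N)%N -> t j < t j.+1
}.

Definition mesh N t : R := \big[Num.max/0]_(j < N) (t j.+1 - t j).

Definition weight N t j : R :=
  if (j < N)%N then t j.+1 - t j else t N - t N.-1.

Definition total_weight N t : R := \sum_(j < N.+1) weight N t j.

Definition geometric_discrete N t (s : R -> R) : R :=
  expR ((total_weight N t)^-1 * \sum_(j < N.+1) weight N t j * ln (s (t j))).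

Definition geometric_continuous T (s : R -> R) : R :=
  expR (T^-1 * \int[lebesgue_measure]_(u in `[0, T]) ln (s u)).

Definition discounted {Omega : Type} r T (V : R -> Omega -> R) :
    R -> Omega -> R :=
  fun u w => expR (- (r * (T - u))) * V u w.

(* sup over t in [0,T] of |X_t - Y_t|, possibly infinite *)
Definition sup_dist {Omega : Type} T (X Y : R -> Omega -> R) (w : Omega) :
    \bar R :=
  ereal_sup [set `|X u w - Y u w|%:E | u in `[0, T]].

End asian.

(* Main.v *)
(** Write Z^N and Z^c for the two payoffs. Since V^N - V^c is a càdlàg version of
    E[Z^N - Z^c | F_t], Doob's inequality reduces the claim to the L^q norm of
    Z^N - Z^c, hence, by the Lipschitz property, to that of G^N - G^c. From
    |e^a - e^b| <= |a - b| (e^a + e^b) and Young's inequality it then suffices to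
    bound log G^N - log G^c in L^(2q) by a multiple of the mesh, and G^N and G^c
    in L^(2q) by a constant; the latter follows from Doob's inequality for the
    discounted price, a geometric average being at most the maximum.

    Summation by parts turns both averages of a path f into f(T) minus an
    integral against df, with integrands t_(j+1)/T_N on ]t_j, t_(j+1)] and s/T,
    which differ by at most 2 mesh/T. For f = log S = X_0 + A + M the gap is thus
    at most 2 mesh/T times |A|_T, plus a stochastic integral against M with an
    integrand bounded by 2 mesh/T. The latter is a pathwise limit of discrete
    transforms, so that no stochastic integration is needed: a second order
    expansion of |x|^p along a partition, E[(dM)^2 | F] = E[d<M> | F], Young's
    and Doob's inequalities bound its p-th moment by that of <M>^(1/2), for
    bounded M and <M> first, and in general by localization at hitting times and
    Fatou's lemma. *)

Require Import Defs.
From mathcomp Require Import measurable_realfun ring lra.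

Set Implicit Arguments.
Unset Strict Implicit.
Unset Printing Implicit Defensive.

Local Open Scope classical_set_scope.
Local Open Scope ring_scope.

(** Doob's inequality and the moment bound for transforms both end by absorbing a fraction of a
    moment into the other side, which is legitimate only once that moment is known to be finite:
    hence the truncated maximum in the former, and bounded [m] and [q] in the latter.

    The exponent in use is [p = 2 * q > 2]. The function [|x|^p] is then twice differentiable: its
    expansion has a quadratic term, to be exchanged for the bracket, and a remainder [|h|^p], whose
    sum vanishes along refining partitions. These partitions refine one monitoring grid with [N]
    fixed. Their coefficients stay below [2 / T * mesh N t] whatever the refinement, so the mesh
    comes out as a factor and the constant does not depend on [N].

    Path properties hold almost surely only. Completeness puts the exceptional sets into every
    [F t], so processes may be replaced by versions that are regular for every [w], and a function
    almost surely equal to a measurable one is measurable. The continuous average, a time integral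
    of [ln S], is handled in this way as a limit of Riemann sums. *)

Section expectation.
Context {d : measure_display} {Omega : measurableType d} {R : realType}.
Variable P : probability Omega R.
Implicit Types (f g u v : Omega -> R) (A B : set Omega).

Local Notation intg f := (P.-integrable [set: Omega] (EFin \o f)).
Local Notation EE f := (Rintegral P [set: Omega] f).

Lemma integrableD_EFin f g : intg f -> intg g -> intg (fun w => f w + g w).
Proof.
move=> fi gi; apply: eq_integrable (integrableD measurableT fi gi) => //.
Qed.

Lemma integrableB_EFin f g : intg f -> intg g -> intg (fun w => f w - g w).
Proof.
move=> fi gi; apply: eq_integrable (integrableB measurableT fi gi) => //.
Qed.

Lemma integrableZ_EFin k f : intg f -> intg (fun w => k * f w).
Proof.
move=> fi; apply: eq_integrable (integrableZl measurableT k fi) => //.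
Qed.

Lemma integrable_sum_EFin (I : Type) (s : seq I) (h : I -> Omega -> R) :
  (forall i, intg (h i)) -> intg (fun w => \sum_(i <- s) h i w).
Proof.
move=> hi; apply: (eq_integrable _ (fun w => (\sum_(i <- s) (h i w)%:E)%E)) => //.
  by move=> w _; rewrite /= sumEFin.
by apply: integrable_sum => // i _; exact: hi.
Qed.

Lemma integrable_measurable f : intg f -> measurable_fun [set: Omega] f.
Proof. by move=> /measurable_int/measurable_EFinP. Qed.

Lemma integrable_bounded K f : measurable_fun [set: Omega] f ->
  (forall w, `|f w| <= K) -> intg f.
Proof.
move=> mf fK; apply: measurable_bounded_integrable => //.
  by rewrite (le_lt_trans (probability_le1 _ _))// ltry.
exists K; split; first exact: num_real.
by move=> x Kx w _ /=; rewrite (le_trans (fK w))// ltW.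
Qed.

Lemma integrable_boundedM K f g : measurable_fun [set: Omega] f ->
  (forall w, `|f w| <= K) -> intg g -> intg (fun w => f w * g w).
Proof.
move=> mf fK gi; apply: (eq_integrable _ ((EFin \o f) \* (EFin \o g))%E) => //.
apply: integrableMr => //.
exists K; split; first exact: num_real.
by move=> x Kx w _ /=; rewrite (le_trans (fK w))// ltW.
Qed.

Lemma expectation_add f g : intg f -> intg g ->
  EE (fun w => f w + g w) = EE f + EE g.
Proof. exact: RintegralD. Qed.

Lemma expectation_sub f g : intg f -> intg g ->
  EE (fun w => f w - g w) = EE f - EE g.
Proof. exact: RintegralB. Qed.

Lemma expectation_scale k f : intg f -> EE (fun w => k * f w) = k * EE f.
Proof. exact: RintegralZl. Qed.

Lemma expectation_le f g : intg f -> intg g -> (forall w, f w <= g w) ->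
  EE f <= EE g.
Proof. by move=> fi gi fg; apply: le_Rintegral. Qed.

Lemma expectation_cst k : EE (fun=> k) = k.
Proof. by rewrite Rintegral_cst//= [fine _](_ : _ = 1) ?mulr1// probability_setT. Qed.

Lemma expectation_sum (I : Type) (s : seq I) (h : I -> Omega -> R) :
  (forall i, intg (h i)) ->
  EE (fun w => \sum_(i <- s) h i w) = \sum_(i <- s) EE (h i).
Proof.
move=> hi; elim: s => [|i s IH].
  by under eq_Rintegral do rewrite big_nil; rewrite expectation_cst big_nil.
under eq_Rintegral do rewrite big_cons.
by rewrite expectation_add ?IH ?big_cons//; exact: integrable_sum_EFin.
Qed.

Lemma expectation_indic f A : measurable A ->
  EE (fun w => \1_A w * f w) = \int[P]_(w in A) f w.
Proof.
move=> mA; rewrite [RHS]Rintegral_mkcond; apply: eq_Rintegral => w _.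
by rewrite patchE indicE; case: ifPn => /= _; rewrite ?mul1r ?mul0r.
Qed.

Lemma EFin_expectation f : intg f -> (EE f)%:E = (\int[P]_w (f w)%:E)%E.
Proof. by move=> fi; rewrite fineK//; exact: integrable_fin_num. Qed.

Lemma integrable_ge0 f : measurable_fun [set: Omega] f -> (forall w, 0 <= f w) ->
  (\int[P]_w (f w)%:E < +oo)%E -> intg f.
Proof.
move=> mf f0 foo; apply/integrableP; split; first exact/measurable_EFinP.
by under eq_integral do rewrite gee0_abs ?lee_fin//.
Qed.

(* The Lebesgue integral of a nonnegative function that is not measurable is
   still the supremum over the simple functions below it. *)
Lemma ge0_le_integralT (f g : Omega -> \bar R) :
  (forall w, (0 <= f w)%E) -> (forall w, (f w <= g w)%E) ->
  (\int[P]_w f w <= \int[P]_w g w)%E.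
Proof.
move=> f0 fg; rewrite !ge0_integralTE//; last first.
  by move=> w; exact: le_trans (f0 w) (fg w).
apply: ge_ereal_sup => _ [h hf <-]; apply: ereal_sup_ubound; exists h => // w.
exact: le_trans (hf w) (fg w).
Qed.

(** No measurability of [f] is assumed, so the comparison is made to hold everywhere by raising [g]
    to [+oo] on a measurable null set, which leaves the integral of [g] unchanged. *)
Lemma ae_le_integral_l (f g : Omega -> \bar R) :
  (forall w, (0 <= f w)%E) -> (forall w, (0 <= g w)%E) ->
  measurable_fun [set: Omega] g -> {ae P, forall w, (f w <= g w)%E} ->
  (\int[P]_w f w <= \int[P]_w g w)%E.
Proof.
move=> f0 g0 mg [N [mN N0 sub]].
have : (\int[P]_w f w <= \int[P]_w (if w \in N then +oo else g w))%E.
  apply: ge0_le_integralT => // w; case: ifPn => [_|]; first exact: leey.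
  by rewrite notin_setE => nN; apply: contrapT => h; apply: nN; exact: sub.
move=> /le_trans; apply; rewrite le_eqVlt; apply/orP; left; apply/eqP.
apply: ge0_ae_eq_integral => //.
- apply: measurable_fun_ifT => //; apply: (measurable_fun_bool true).
  by rewrite setTI (_ : _ @^-1` _ = N)//; apply/seteqP; split => w;
    [exact: set_mem|exact: mem_set].
- by move=> w _; case: ifPn.
- by exists N; split => // w /= nP; apply: contrapT => nN; apply: nP => _;
    rewrite memNset.
Qed.

(** Mirror image of the previous lemma: [f] is lowered to 0 on the null set and [g] is arbitrary. It
    serves for bounds by the total variation of a path, whose measurability in [w] is not
    established. *)
Lemma ae_le_integral_r (f g : Omega -> \bar R) :
  (forall w, (0 <= f w)%E) -> (forall w, (0 <= g w)%E) ->
  measurable_fun [set: Omega] f -> {ae P, forall w, (f w <= g w)%E} ->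
  (\int[P]_w f w <= \int[P]_w g w)%E.
Proof.
move=> f0 g0 mf [N [mN N0 sub]].
apply: (@le_trans _ _ (\int[P]_w (if w \in N then 0 else f w))%E); last first.
  apply: ge0_le_integralT => [w|w]; case: ifPn => // wN.
  by apply: contrapT => h; move: wN; rewrite notin_setE; apply; exact: sub.
rewrite le_eqVlt; apply/orP; left; apply/eqP.
apply: ge0_ae_eq_integral => //.
- apply: measurable_fun_ifT => //; apply: (measurable_fun_bool true).
  by rewrite setTI (_ : _ @^-1` _ = N)//; apply/seteqP; split => w;
    [exact: set_mem|exact: mem_set].
- by move=> w _; case: ifPn.
- by exists N; split => // w /= nP; apply: contrapT => nN; apply: nP => _;
    rewrite memNset.
Qed.

End expectation.

Section expectation_limits.
Context {d : measure_display} {Omega : measurableType d} {R : realType}.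
Variable P : probability Omega R.
Implicit Types (f g u v : Omega -> R) (A B : set Omega).

Local Notation intg f := (P.-integrable [set: Omega] (EFin \o f)).
Local Notation EE f := (Rintegral P [set: Omega] f).

Lemma expectation_cvg (h : nat -> Omega -> R) f g :
  (forall n, measurable_fun [set: Omega] (h n)) -> measurable_fun [set: Omega] f ->
  intg g -> (forall n w, `|h n w| <= g w) ->
  {ae P, forall w, h n w @[n --> \oo] --> f w} ->
  intg f /\ EE (h n) @[n --> \oo] --> EE f.
Proof.
move=> mh mf gi hg hf.
have cE : {ae P, forall w, [set: Omega] w ->
    (h n w)%:E @[n --> \oo] --> (f w)%:E}.
  by apply: filterS hf => w hw _; apply: cvg_EFin => //; exact: nearW.
have [] := @dominated_convergence _ _ _ P setT measurableT
  (fun n w => (h n w)%:E) (EFin \o f) (EFin \o g) _ _ cE gi.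
- by move=> n; apply/measurable_EFinP.
- exact/measurable_EFinP.
- by apply: aeW => w n _; rewrite lee_fin.
move=> fi _ cv.
split => //; apply: fine_cvg.
by rewrite EFin_expectation.
Qed.

(** Monotone convergence applied to the tail infima [I n]. Since [f] is arbitrary, the supremum of a
    process over all times can stand on the left. *)
Lemma fatou_le (h : nat -> Omega -> R) (f : Omega -> \bar R) (C : \bar R) :
  (forall n, measurable_fun [set: Omega] (h n)) -> (forall n w, 0 <= h n w) ->
  (forall w, (0 <= f w)%E) ->
  {ae P, forall w, (f w <= limn_einf (fun n => (h n w)%:E))%E} ->
  (forall n, (\int[P]_w (h n w)%:E <= C)%E) -> (\int[P]_w f w <= C)%E.
Proof.
move=> mh h0 f0 fh hC.
pose I n w := einfs (fun k => (h k w)%:E) n.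
have mI n : measurable_fun [set: Omega] (I n).
  by apply: measurable_fun_einfs => k; exact/measurable_EFinP.
have I0 n w : (0 <= I n w)%E.
  by apply: le_ereal_inf_tmp => _ [m _ <-]; rewrite lee_fin.
have ndI w : {homo I^~ w : n m / (n <= m)%N >-> (n <= m)%E}.
  exact: nondecreasing_einfs.
have cI w : cvgn (I^~ w) by exact: ereal_nondecreasing_is_cvgn.
apply: (@le_trans _ _ (\int[P]_w limn (I^~ w))%E).
  apply: ae_le_integral_l => //.
  - by move=> w; apply: lime_ge => //; exact: nearW.
  - by apply: (emeasurable_fun_cvg I) => // w _; exact: cI.
  - by apply: filterS fh => w; rewrite limn_einf_lim.
rewrite monotone_convergence//; apply: lime_le.
  apply: ereal_nondecreasing_is_cvgn => m n mn.
  by apply: ge0_le_integral => // w _; exact: ndI.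
apply: nearW => n; apply: le_trans (hC n).
apply: ge0_le_integral => //; first exact/measurable_EFinP.
by move=> w _; apply: ereal_inf_lbound; exists n => //=.
Qed.

Lemma fatou_le_cvg (h : nat -> Omega -> R) (f : Omega -> R) (C : \bar R) :
  (forall n, measurable_fun [set: Omega] (h n)) -> (forall n w, 0 <= h n w) ->
  (forall w, 0 <= f w) -> {ae P, forall w, h n w @[n --> \oo] --> f w} ->
  (forall n, (\int[P]_w (h n w)%:E <= C)%E) -> (\int[P]_w (f w)%:E <= C)%E.
Proof.
move=> mh h0 f0 hf hC; apply: fatou_le hC => //.
apply: filterS hf => w hw.
have cw : (h n w)%:E @[n --> \oo] --> (f w)%:E by apply: cvg_EFin => //; exact: nearW.
by rewrite is_cvg_limn_einfE; [rewrite (cvg_lim _ cw)|apply/cvg_ex; exists (f w)%:E].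
Qed.

End expectation_limits.

(** * Measurability and orthogonality with respect to a sub-sigma-algebra *)

Section measurable_wrt.
Context {d : measure_display} {Omega : measurableType d} {R : realType}.
Variable G : set (set Omega).
Hypothesis sG : sigma_algebra [set: Omega] G.
Implicit Types (f g : Omega -> R).

Lemma measurable_g_sigma_algebra : @measurable _ (g_sigma_algebraType G) = G.
Proof. exact: sigma_algebra_id. Qed.

Lemma measurable_wrtP f : measurable_wrt G f <->
  measurable_fun [set: g_sigma_algebraType G] (f : g_sigma_algebraType G -> R).
Proof.
split=> [h _ B mB|h _ [B mB <-]].
  by rewrite measurable_g_sigma_algebra; apply: h; exists B.
by rewrite -measurable_g_sigma_algebra; exact: h.
Qed.

Lemma measurable_wrt_fun f : G `<=` measurable -> measurable_wrt G f ->
  measurable_fun [set: Omega] f.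
Proof. by move=> Gm h _ B mB; apply: Gm; apply: h; exists B. Qed.

Lemma measurable_wrt_comp (g : R -> R) f : measurable_fun [set: R] g ->
  measurable_wrt G f -> measurable_wrt G (g \o f).
Proof. by rewrite !measurable_wrtP; exact: measurableT_comp. Qed.

Lemma measurable_wrtD f g : measurable_wrt G f -> measurable_wrt G g ->
  measurable_wrt G (fun w => f w + g w).
Proof. by rewrite !measurable_wrtP; exact: measurable_funD. Qed.

Lemma measurable_wrtB f g : measurable_wrt G f -> measurable_wrt G g ->
  measurable_wrt G (fun w => f w - g w).
Proof. by rewrite !measurable_wrtP; exact: measurable_funB. Qed.

Lemma measurable_wrtM f g : measurable_wrt G f -> measurable_wrt G g ->
  measurable_wrt G (fun w => f w * g w).
Proof. by rewrite !measurable_wrtP; exact: measurable_funM. Qed.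

Lemma measurable_wrt_max f g : measurable_wrt G f -> measurable_wrt G g ->
  measurable_wrt G (fun w => Num.max (f w) (g w)).
Proof. by rewrite !measurable_wrtP; exact: measurable_maxr. Qed.

Lemma measurable_wrt_cst k : measurable_wrt G (fun=> k : R).
Proof. by rewrite measurable_wrtP; exact: measurable_cst. Qed.

Lemma measurable_wrt_sum (I : Type) (s : seq I) (h : I -> Omega -> R) :
  (forall i, measurable_wrt G (h i)) ->
  measurable_wrt G (fun w => \sum_(i <- s) h i w).
Proof.
move=> mh; elim: s => [|i s IH].
  by under eq_fun do rewrite big_nil; exact: measurable_wrt_cst.
by under eq_fun do rewrite big_cons; exact: measurable_wrtD.
Qed.

Lemma measurable_wrt_cvg (h : nat -> Omega -> R) f :
  (forall n, measurable_wrt G (h n)) -> (forall w, h n w @[n --> \oo] --> f w) ->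
  measurable_wrt G f.
Proof.
move=> mh hf; apply/measurable_wrtP.
apply: (@measurable_fun_cvg _ (g_sigma_algebraType G) _ _ h) => // n.
exact/measurable_wrtP.
Qed.

Lemma measurable_wrt_indic B : G B -> measurable_wrt G (\1_B : Omega -> R).
Proof.
move=> GB; apply/measurable_wrtP.
by apply: (@measurable_indic _ (g_sigma_algebraType G)); rewrite measurable_g_sigma_algebra.
Qed.

Lemma measurable_wrt_ge f (x : R) : measurable_wrt G f -> G [set w | x <= f w].
Proof.
move=> mf; rewrite (_ : mkset _ = setT `&` f @^-1` `[x, +oo[).
  by apply: mf; exists `[x, +oo[%classic.
by apply/seteqP; split=> w /=; rewrite in_itv/= andbT; [split|case].
Qed.

Lemma measurable_wrt_gt f (x : R) : measurable_wrt G f -> G [set w | x < f w].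
Proof.
move=> mf; rewrite (_ : mkset _ = setT `&` f @^-1` `]x, +oo[).
  by apply: mf; exists `]x, +oo[%classic.
by apply/seteqP; split=> w /=; rewrite in_itv/= andbT; [split|case].
Qed.

Lemma sigma_algebra_setC B : G B -> G (~` B).
Proof. by rewrite -measurable_g_sigma_algebra => ?; exact: measurableC. Qed.

Lemma sigma_algebra_setI A B : G A -> G B -> G (A `&` B).
Proof. by rewrite -measurable_g_sigma_algebra => ? ?; exact: measurableI. Qed.

Lemma sigma_algebra_setU A B : G A -> G B -> G (A `|` B).
Proof. by rewrite -measurable_g_sigma_algebra => ? ?; exact: measurableU. Qed.

Lemma sigma_algebra_bigcupT (A : nat -> set Omega) :
  (forall n, G (A n)) -> G (\bigcup_n A n).
Proof. by rewrite -measurable_g_sigma_algebra => ?; exact: bigcupT_measurable. Qed.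

Lemma sigma_algebra_bigcapT (A : nat -> set Omega) :
  (forall n, G (A n)) -> G (\bigcap_n A n).
Proof. by rewrite -measurable_g_sigma_algebra => ?; exact: bigcapT_measurable. Qed.

Lemma sigma_algebra_setT : G [set: Omega].
Proof. by rewrite -measurable_g_sigma_algebra; exact: measurableT. Qed.

End measurable_wrt.

Lemma measurable_wrtS {d : measure_display} {Omega : measurableType d} {R : realType}
  (G G' : set (set Omega)) (f : Omega -> R) : G `<=` G' ->
  measurable_wrt G f -> measurable_wrt G' f.
Proof. by move=> GG' h B /h/GG'. Qed.

Section orthogonality.
Context {d : measure_display} {Omega : measurableType d} {R : realType}.
Variable P : probability Omega R.
Implicit Types (f g u v : Omega -> R) (G : set (set Omega)).

Local Notation intg f := (P.-integrable [set: Omega] (EFin \o f)).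
Local Notation EE f := (Rintegral P [set: Omega] f).

(** The sum counts the integers from 1 to [n] that are at most [x], so it is the integer part of
    [x]. *)
Lemma sum_indic_floor (n : nat) (x : R) : 0 <= x <= n%:R ->
  0 <= x - \sum_(k < n) (k.+1%:R <= x)%R%:R <= 1.
Proof.
elim: n => [|n IH] /andP[x0 xn]; first by rewrite big_ord0; lra.
rewrite big_ord_recr/=; have [nx|xn'] := leP x n%:R.
  have := IH; rewrite x0 nx => /(_ isT).
  have [xn1|_] := leP n.+1%:R x; last by rewrite addr0.
  by have := le_trans xn1 nx; rewrite ler_nat ltnn.
rewrite (eq_bigr (fun=> 1)); last first.
  move=> i _; rewrite (_ : _ <= x)//; apply/ltW/(le_lt_trans _ xn').
  by rewrite ler_nat.
rewrite sumr_const card_ord.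
rewrite -natr1 in xn *; have [h|h] := leP (n%:R + 1) x; rewrite /= ?mulr1n ?mulr0n; lra.
Qed.

(* [g] is a uniform limit of combinations of indicators of level sets. *)
Lemma expectation_orthogonal G (u g : Omega -> R) (K : R) :
  sigma_algebra [set: Omega] G -> G `<=` measurable -> intg u ->
  (forall B, G B -> \int[P]_(w in B) u w = 0) ->
  measurable_wrt G g -> (forall w, `|g w| <= K) ->
  EE (fun w => g w * u w) = 0.
Proof.
move=> sG Gm ui u0 mg gK.
have EEu : EE u = 0 by apply: u0; exact: sigma_algebra_setT.
have [K0|K0] := leP K 0.
  rewrite (_ : (fun w => g w * u w) = fun=> 0) ?expectation_cst//.
  apply/funext => w; have /le_trans/(_ K0) := gK w.
  by rewrite normr_le0 => /eqP ->; rewrite mul0r.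
(* An affine change brings [g] into [0, 1]; the added constant is harmless because [u] has
   expectation 0. *)
pose v w := (g w + K) / (2 * K).
have v01 w : 0 <= v w <= 1.
  have := gK w; rewrite ler_norml => /andP[g1 g2].
  by rewrite divr_ge0/= ?ler_pdivrMr; lra.
have mv : measurable_wrt G v.
  apply: (measurable_wrt_comp sG (g := fun x => (x + K) / (2 * K))) mg.
  by apply: measurable_funM => //; apply: measurable_funD.
have mgO := measurable_wrt_fun Gm mg.
have mvO := measurable_wrt_fun Gm mv.
have vui : intg (fun w => v w * u w).
  apply: (@integrable_boundedM _ _ _ _ 1) => // w.
  by have /andP[a b] := v01 w; rewrite ger0_norm.
have Ev : EE (fun w => v w * u w) = 0.
  apply/eqP; rewrite -normr_le0; apply/ler_addgt0Pl => e e0; rewrite addr0.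
  (* Replacing [v] by its approximation costs at most the expectation of [|u|] divided by [n.+1];
     this [n] makes the cost at most [e]. *)
  have [n nE] : exists n : nat, EE (fun w => `|u w|) <= e * n.+1%:R.
    exists (Num.truncn (EE (fun w => `|u w|) / e)).
    by rewrite mulrC -ler_pdivrMr// ltW// truncnS_gt.
  pose L k := [set w | k.+1%:R / n.+1%:R <= v w].
  have GL k : G (L k) by exact: measurable_wrt_ge.
  (* This is [n.+1%:R * v w] rounded down and divided by [n.+1%:R]. *)
  pose vn (w : Omega) : R := \sum_(k < n.+1) n.+1%:R^-1 * \1_(L k) w.
  have Lui k : intg (fun w => \1_(L k) w * u w).
    apply: (@integrable_boundedM _ _ _ _ 1) => //.
      by apply: measurable_indic; exact: Gm.
    by move=> w; rewrite indicE; case: (_ \in _); rewrite ?normr1 ?normr0.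
  have vnui : intg (fun w => vn w * u w).
    under eq_fun do rewrite mulr_suml.
    by apply: integrable_sum_EFin => k; under eq_fun do rewrite -mulrA;
      exact: integrableZ_EFin.
  have Evn : EE (fun w => vn w * u w) = 0.
    under eq_Rintegral do rewrite mulr_suml.
    rewrite expectation_sum; last first.
      by move=> k; under eq_fun do rewrite -mulrA; exact: integrableZ_EFin.
    rewrite big1// => k _; under eq_Rintegral do rewrite -mulrA.
    by rewrite expectation_scale// expectation_indic ?u0 ?mulr0//; exact: Gm.
  rewrite -[X in `|X|]subr0 -[X in _ - X]Evn -expectation_sub//.
  apply: (le_trans (le_normr_Rintegral _ _)) => //; first exact: integrableB_EFin.
  apply: (@le_trans _ _ (EE (fun w => n.+1%:R^-1 * `|u w|))).
    apply: expectation_le.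
    - by apply: integrable_norm; exact: integrableB_EFin.
    - by apply: integrableZ_EFin; exact: integrable_norm.
    - move=> w; rewrite -mulrBl normrM ler_wpM2r//.
      have vnE : vn w = n.+1%:R^-1 * \sum_(k < n.+1) (k.+1%:R <= n.+1%:R * v w)%R%:R.
        rewrite /vn mulr_sumr; apply: eq_bigr => k _; congr (_ * _).
        rewrite indicE mulrC -ler_pdivrMr//; congr (nat_of_bool _)%:R.
        by apply/idP/idP; [exact: set_mem|exact: mem_set].
      have : 0 <= n.+1%:R * v w <= n.+1%:R.
        by have /andP[a b] := v01 w; rewrite mulr_ge0//= ler_piMr.
      move=> /sum_indic_floor; rewrite vnE; set s := \sum_(k < _) _ => /andP[s0 s1].
      have -> : v w - n.+1%:R^-1 * s = n.+1%:R^-1 * (n.+1%:R * v w - s).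
        by rewrite mulrBr mulKf// pnatr_eq0.
      by rewrite ger0_norm ?mulr_ge0 ?invr_ge0// ler_piMr ?invr_ge0.
  by rewrite expectation_scale ?integrable_norm// mulrC ler_pdivrMr.
have gE w : g w * u w = 2 * K * (v w * u w) - K * u w.
  by rewrite /v; field; rewrite gt_eqF.
under eq_Rintegral do rewrite gE.
rewrite expectation_sub ?expectation_scale ?Ev ?EEu ?mulr0 ?subrr//;
  exact: integrableZ_EFin.
Qed.

Lemma condexp_orthogonal G (Z Y g : Omega -> R) (K : R) :
  sigma_algebra [set: Omega] G -> G `<=` measurable -> intg Z ->
  is_condexp P G Z Y -> measurable_wrt G g -> (forall w, `|g w| <= K) ->
  EE (fun w => g w * (Z w - Y w)) = 0.
Proof.
move=> sG Gm Zi [Yi _ YZ]; apply: expectation_orthogonal => //.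
  exact: integrableB_EFin.
move=> B GB; have mB : measurable B := Gm _ GB.
rewrite RintegralB//; [|by apply: integrableS Zi|by apply: integrableS Yi].
by rewrite /Rintegral (YZ _ GB) subrr.
Qed.

End orthogonality.

(** * Doob's maximal inequality *)

Section power_inequalities.
Context {R : realType}.
Implicit Types (a b p x y e : R).

Lemma le_powR p x y : 0 <= p -> 0 <= x -> x <= y -> x `^ p <= y `^ p.
Proof.
move=> p0 x0 xy; apply: ge0_ler_powR; rewrite ?nnegrE//.
exact: le_trans xy.
Qed.

(** If [y <= e * x] the first term alone dominates, otherwise the second one does. The weight [e] is
    free, which is what the absorption arguments need. *)
Lemma young_powR e x y a b : 0 < e -> 0 <= x -> 0 <= y -> 0 <= a -> 0 < b ->
  x `^ a * y `^ b <= e `^ b * x `^ (a + b) + e `^ (- a) * y `^ (a + b).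
Proof.
move=> e0 x0 y0 a0 b0; have ab0 : a + b != 0 by rewrite gt_eqF// ltr_wpDl.
have D z : 0 <= z -> z `^ (a + b) = z `^ a * z `^ b.
  by move=> z0; rewrite powRD// (negbTE ab0).
have [yx|xy] := leP y (e * x).
  apply: (@le_trans _ _ (e `^ b * x `^ (a + b))).
    rewrite D// mulrCA ler_wpM2l ?powR_ge0// -powRM ?(ltW e0)//.
    exact: le_powR (ltW b0) y0 yx.
  by rewrite lerDl mulr_ge0 ?powR_ge0.
apply: (@le_trans _ _ (e `^ (- a) * y `^ (a + b))).
  rewrite D// mulrA ler_wpM2r ?powR_ge0// powRN ler_pdivlMl ?powR_gt0//.
  rewrite -powRM ?(ltW e0)//; apply: le_powR => //; last exact: ltW.
  by rewrite mulr_ge0// ltW.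
by rewrite lerDr mulr_ge0 ?powR_ge0.
Qed.

(** Young's inequality for the conjugate exponents [p / (p - 1)] and [p]. It is the convexity of the
    p-th power in disguise, and the next lemma reads the tangent line inequality off it. *)
Lemma young_powR_tangent p x y : 1 < p -> 0 <= x -> 0 <= y ->
  x `^ (p - 1) * y <= (p - 1) / p * x `^ p + y `^ p / p.
Proof.
move=> p1 x0 y0; have p0 : 0 < p by lra.
have p10 : 0 < p - 1 by lra.
have pE : (x `^ (p - 1)) `^ (p / (p - 1)) = x `^ p.
  by rewrite -powRrM mulrCA mulfV ?mulr1// gt_eqF.
have := @conjugate_powR R (x `^ (p - 1)) y (p / (p - 1)) p (powR_ge0 _ _) y0.
rewrite pE divr_gt0// p0 => /(_ isT isT) h.
apply: le_trans (h _) _; first by field; rewrite !gt_eqF.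
by rewrite invf_div mulrC.
Qed.

Lemma powR_ge_tangent p x y : 1 < p -> 0 <= x -> 0 <= y ->
  x `^ p + p * x `^ (p - 1) * (y - x) <= y `^ p.
Proof.
move=> p1 x0 y0; have p0 : 0 < p by lra.
have := young_powR_tangent p1 x0 y0.
rewrite -(ler_pM2l p0).
have -> : p * ((p - 1) / p * x `^ p + y `^ p / p) = (p - 1) * x `^ p + y `^ p.
  by field; rewrite gt_eqF.
have := mulr_powRB1 x0 p0; move: (x `^ (p - 1)) (x `^ p) => z t <-.
lra.
Qed.

Lemma powRD_le p x y : 0 <= p -> 0 <= x -> 0 <= y ->
  (x + y) `^ p <= 2 `^ p * (x `^ p + y `^ p).
Proof.
move=> p0 x0 y0.
have [xy|yx] := leP x y.
  apply: (@le_trans _ _ ((2 * y) `^ p)).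
    by apply: le_powR => //; lra.
  by rewrite powRM// ler_wpM2l ?powR_ge0// lerDr powR_ge0.
apply: (@le_trans _ _ ((2 * x) `^ p)).
  by apply: le_powR => //; lra.
by rewrite powRM// ler_wpM2l ?powR_ge0// lerDl powR_ge0.
Qed.

Lemma powR_subr1 p x : 1 < p -> 0 <= x -> x `^ (p - 1) * x = x `^ p.
Proof. by move=> p1 x0; rewrite mulrC mulr_powRB1//; lra. Qed.

End power_inequalities.

Lemma measurable_sgr {R : realType} : measurable_fun [set: R] (@Num.sg R).
Proof.
rewrite (_ : Num.sg = fun x : R => \1_(`]0, +oo[%classic) x - \1_(`]-oo, 0[%classic) x).
  by apply: measurable_funB; apply: measurable_indic.
apply/funext => x; rewrite !indicE !mem_setE !in_itv/= andbT.
by case: sgrP => //= _; rewrite ?subr0 ?sub0r.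
Qed.

Section running_maximum.
Context {R : realType}.
Implicit Types (s : nat -> R) (a p : R) (n : nat).

(** Starting the maximum at 0 makes it nonnegative for every [s]; for the absolute values to which
    it is applied this changes nothing. *)
Fixpoint running_max s n : R :=
  if n is m.+1 then Num.max (running_max s m) (s m.+1) else Num.max 0 (s 0%N).

Lemma running_max_ge0 s n : 0 <= running_max s n.
Proof. by elim: n => [|n IH] /=; rewrite le_max ?lexx ?IH. Qed.

Lemma running_max_ge s n k : (k <= n)%N -> s k <= running_max s n.
Proof.
elim: n => [|n IH] /=; first by rewrite leqn0 => /eqP ->; rewrite le_max lexx orbT.
rewrite leq_eqVlt => /predU1P[->|kn]; rewrite le_max ?lexx ?orbT//.
by rewrite IH.
Qed.

Lemma running_max_le s n x : 0 <= x -> (forall k, (k <= n)%N -> s k <= x) ->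
  running_max s n <= x.
Proof.
move=> x0; elim: n => [|n IH] sx /=; rewrite ge_max ?x0 sx//= ?andbT.
by apply: IH => k kn; apply: sx; exact: leqW.
Qed.

(* Summation by parts, the increments of the truncated maximum occurring only
   when the maximum is attained. *)
Lemma doob_pathwise s a p n (b := fun k => Num.min a (running_max s k)) :
  1 < p -> 0 <= a -> (forall k, 0 <= s k) ->
  (p - 1) / p * b n `^ p <=
  b n `^ (p - 1) * s n - \sum_(k < n) b k `^ (p - 1) * (s k.+1 - s k).
Proof.
move=> p1 a0 s0; have p0 : 0 < p by lra.
have b0 k : 0 <= b k by rewrite le_min a0 running_max_ge0.
elim: n => [|n IH].
  rewrite big_ord0 subr0; have bs : b 0%N <= s 0%N.
    by rewrite /b /= max_r// ge_min lexx orbT.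
  apply: (@le_trans _ _ (b 0%N `^ p)).
    by rewrite ler_piMl ?powR_ge0// ler_pdivrMr//; lra.
  by rewrite -powR_subr1// ler_wpM2l ?powR_ge0.
rewrite big_ord_recr/=.
(* From [n] to [n.+1] the right-hand side grows by exactly [s n.+1] times the increment of the
   (p-1)-th power of [b]. *)
suff : (p - 1) / p * (b n.+1 `^ p - b n `^ p) <=
    s n.+1 * (b n.+1 `^ (p - 1) - b n `^ (p - 1)).
  move: IH; set S := \sum_(_ < _) _; set A := (p - 1) / p.
  by move: (b n.+1 `^ p) (b n `^ p) (b n.+1 `^ _) (b n `^ _) => *; lra.
(* When the truncated maximum moves, its new value is still at most [s n.+1]; hence [b n.+1] may
   replace [s n.+1], and Young's inequality concludes. *)
have [E|bs] : b n.+1 = b n \/ b n <= b n.+1 <= s n.+1.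
  rewrite /b /=; case: (leP (running_max s n) (s n.+1)) => h; last by left.
  by right; rewrite le_min ge_min lexx /= ge_min h orbT ge_min lexx orbT.
  by rewrite E !subrr !mulr0.
have /andP[bb bs'] := bs.
apply: (@le_trans _ _ (b n.+1 * (b n.+1 `^ (p - 1) - b n `^ (p - 1)))).
  rewrite [leRHS]mulrBr mulr_powRB1// [b n.+1 * _]mulrC.
  have := young_powR_tangent p1 (b0 n) (b0 n.+1).
  have -> : b n.+1 `^ p / p = b n.+1 `^ p - (p - 1) / p * b n.+1 `^ p.
    by rewrite -[X in X - _]mul1r -mulrBl mulrC; congr (_ * _); field; rewrite gt_eqF.
  lra.
rewrite ler_wpM2r// subr_ge0; by apply: le_powR => //; lra.
Qed.

End running_maximum.

Section doob.
Context {d : measure_display} {Omega : measurableType d} {R : realType}.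
Variable P : probability Omega R.

Local Notation intg f := (P.-integrable [set: Omega] (EFin \o f)).
Local Notation EE f := (Rintegral P [set: Omega] f).

(** With [A = (p - 1) / p], Young's inequality of weight [A / 2] allows half of [A] times the moment
    of the maximum to be absorbed, and division by the other half gives this value. It equals
    [(2 * p / (p - 1))^p], that is [2^p] times the sharp constant. *)
Definition doob_cst (p : R) : R :=
  ((p - 1) / p / 2) `^ (- (p - 1)) / ((p - 1) / p / 2).

Lemma doob_cst_gt0 (p : R) : 1 < p -> 0 < doob_cst p.
Proof.
move=> p1; have ? : 0 < (p - 1) / p / 2 by rewrite !divr_gt0//; lra.
by rewrite divr_gt0// powR_gt0.
Qed.

Variables (G : nat -> set (set Omega)) (f : nat -> Omega -> R) (n : nat) (p : R).
Hypotheses (sG : forall k, sigma_algebra [set: Omega] (G k))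
  (Gm : forall k, G k `<=` measurable) (Gle : forall k, G k `<=` G k.+1)
  (ce : forall k, (k < n)%N -> is_condexp P (G k) (f k.+1) (f k))
  (fni : intg (f n)) (p1 : 1 < p).

Let s w k := `|f k w|.

Let fi k : (k <= n)%N -> intg (f k).
Proof. by rewrite leq_eqVlt => /predU1P[->//|/ce[]]. Qed.

Let max_wrt k : (k < n)%N -> measurable_wrt (G k) (fun w => running_max (s w) k).
Proof.
elim: k => [|k IH] kn; have [_ mfk _] := ce kn.
  by apply: measurable_wrt_max => //; [exact: measurable_wrt_cst|
    exact: (measurable_wrt_comp (sG 0) (g := Num.norm))].
apply: measurable_wrt_max => //; last exact: (measurable_wrt_comp (sG k.+1) (g := Num.norm)).
by apply: (measurable_wrtS (@Gle k)); apply: IH; exact: ltnW.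
Qed.

Let max_meas k : (k <= n)%N -> measurable_fun [set: Omega] (fun w => running_max (s w) k).
Proof.
elim: k => [|k IH] kn; apply: measurable_maxr => //.
- by apply: measurableT_comp => //; exact: integrable_measurable (fi kn).
- exact/IH/ltnW.
- by apply: measurableT_comp => //; exact: integrable_measurable (fi kn).
Qed.

(* Truncating at [a] makes the p-th moment finite, so that it can be absorbed. *)
Lemma doob_truncated (a : R) : 0 <= a -> intg (fun w => `|f n w| `^ p) ->
  EE (fun w => Num.min a (running_max (fun k => `|f k w|) n) `^ p) <=
  doob_cst p * EE (fun w => `|f n w| `^ p).
Proof.
move=> a0 fpi; pose b w k := Num.min a (running_max (s w) k).
have b0 w k : 0 <= b w k by rewrite le_min a0 running_max_ge0.
have ba w k r : 0 <= r -> `|b w k `^ r| <= a `^ r.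
  move=> r0; rewrite ger0_norm ?powR_ge0//; apply: le_powR => //.
  by rewrite ge_min lexx.
have p1' : 1 < p := p1.
have p10 : 0 <= p - 1 by lra.
have mb k : (k <= n)%N -> measurable_fun [set: Omega] (b ^~ k).
  by move=> kn; apply: measurable_minr => //; exact: max_meas.
have mbr k r : (k <= n)%N -> measurable_fun [set: Omega] (fun w => b w k `^ r).
  by move=> kn; apply: (@measurableT_comp _ _ _ _ _ _ (@powR R ^~ r)) => //; exact: mb.
have si k : (k <= n)%N -> intg (s ^~ k).
  by move=> kn; apply: integrable_norm; exact: fi.
have bpi : intg (fun w => b w n `^ p).
  by apply: (@integrable_bounded _ _ _ _ (a `^ p)) => [|w]; [exact: mbr|apply: (ba _ _ p); rewrite (le_trans _ (ltW p1))].
have bsi k j : (k <= n)%N -> (j <= n)%N -> intg (fun w => b w k `^ (p - 1) * s w j).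
  move=> kn jn; apply: (@integrable_boundedM _ _ _ _ (a `^ (p - 1))) => //.
  - exact: mbr.
  - by move=> w; exact: ba.
  - exact: si.
have bdi k : (k < n)%N -> intg (fun w => b w k `^ (p - 1) * (s w k.+1 - s w k)).
  move=> kn; under eq_fun do rewrite mulrBr.
  by apply: integrableB_EFin; apply: bsi => //; exact: ltnW.
have pos k : (k < n)%N -> 0 <= EE (fun w => b w k `^ (p - 1) * (s w k.+1 - s w k)).
  (* The product [sg (f k) * (f k.+1 - f k)] is at most [s k.+1 - s k], and its expectation against
     the weight is 0: the submartingale property of [|f|] in tested form. *)
  move=> kn; pose g w := b w k `^ (p - 1) * Num.sg (f k w).
  have gle w : `|g w| <= a `^ (p - 1).
    rewrite normrM -[leRHS]mulr1 ler_pM// ?ba// normr_sg.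
    by case: (_ != _).
  have mg : measurable_wrt (G k) g.
    apply: measurable_wrtM => //.
      apply: (measurable_wrt_comp (sG k) (g := fun x => Num.min a x `^ (p - 1))).
        apply: (@measurableT_comp _ _ _ _ _ _ (@powR R ^~ (p - 1))) => //.
        exact: measurable_minr.
      exact: max_wrt.
    apply: (measurable_wrt_comp (sG k) (g := Num.sg)); first exact: measurable_sgr.
    by have [] := ce kn.
  have E := condexp_orthogonal (sG k) (@Gm k) (fi kn) (ce kn) mg gle.
  rewrite -E; apply: expectation_le; [|exact: bdi|].
    apply: (@integrable_boundedM _ _ _ _ (a `^ (p - 1))) => //.
      exact: (measurable_wrt_fun (@Gm k)).
    by apply: integrableB_EFin; apply: fi => //; exact: ltnW.
  move=> w; rewrite /g -mulrA ler_wpM2l ?powR_ge0// mulrBr -normrEsg lerB//.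
  by rewrite (le_trans (ler_norm _))// normrM normr_sg; case: (_ != _); rewrite ?mul1r// mul0r normr_ge0.
set A := (p - 1) / p.
have A0 : 0 < A by rewrite divr_gt0//; lra.
have step1 : A * EE (fun w => b w n `^ p) <= EE (fun w => b w n `^ (p - 1) * s w n).
  apply: (@le_trans _ _ (EE (fun w => b w n `^ (p - 1) * s w n -
      \sum_(k < n) b w k `^ (p - 1) * (s w k.+1 - s w k)))).
    rewrite -expectation_scale//; apply: expectation_le.
    - exact: integrableZ_EFin.
    - by apply: integrableB_EFin; [exact: bsi|apply: integrable_sum_EFin => k; exact: bdi].
    - by move=> w; exact: (doob_pathwise n p1 a0 (fun k => normr_ge0 (f k w))).
  rewrite expectation_sub; [|exact: bsi|by apply: integrable_sum_EFin => k; exact: bdi].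
  rewrite expectation_sum => [|k]; last exact: bdi.
  by rewrite gerBl sumr_ge0// => k _; exact: pos.
have step2 : EE (fun w => b w n `^ (p - 1) * s w n) <=
    A / 2 * EE (fun w => b w n `^ p) + (A / 2) `^ (- (p - 1)) * EE (fun w => s w n `^ p).
  rewrite -!expectation_scale// -expectation_add; [|exact: integrableZ_EFin..].
  apply: expectation_le; first exact: bsi.
    by apply: integrableD_EFin; exact: integrableZ_EFin.
  move=> w; have A2 : 0 < A / 2 by rewrite divr_gt0.
  have := young_powR A2 (b0 w n) (normr_ge0 (f n w)) p10 ltr01.
  by rewrite !powRr1 ?(ltW A2)// subrK.
have A2 : 0 < A / 2 by rewrite divr_gt0.
rewrite /doob_cst -/A mulrAC ler_pdivlMr//.
by move: step1 step2; set x := EE _; set y := EE _; set z := EE _; lra.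
Qed.

(** If the right-hand side is infinite there is nothing to prove. Otherwise the truncated inequality
    applies at each level [m%:R]; for each [w] the truncation is eventually inactive, and Fatou's
    lemma removes it. *)
Lemma doob_discrete :
  (\int[P]_w (running_max (fun k => `|f k w|) n `^ p)%:E <=
   (doob_cst p)%:E * \int[P]_w (`|f n w| `^ p)%:E)%E.
Proof.
have mfn : measurable_fun [set: Omega] (fun w => `|f n w| `^ p).
  apply: (@measurableT_comp _ _ _ _ _ _ (@powR R ^~ p)) => //.
  by apply: measurableT_comp => //; exact: integrable_measurable fni.
have [|] := ltP (\int[P]_w (`|f n w| `^ p)%:E)%E +oo%E; last first.
  by rewrite leye_eq => /eqP ->; rewrite gt0_muley ?leey// lte_fin doob_cst_gt0.
have p1' : 1 < p := p1.
move=> foo; have fpi := integrable_ge0 mfn (fun w => powR_ge0 _ _) foo.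
apply: (@fatou_le_cvg _ _ _ P
  (fun m w => Num.min m%:R (running_max (fun k => `|f k w|) n) `^ p)).
- move=> m; apply: (@measurableT_comp _ _ _ _ _ _ (@powR R ^~ p)) => //.
  by apply: measurable_minr => //; exact: max_meas.
- by move=> m w; exact: powR_ge0.
- by move=> w; exact: powR_ge0.
- apply: aeW => w; apply: cvg_near_cst.
  near=> m; rewrite min_r//; near: m; exact: nbhs_infty_ger.
move=> m; rewrite -EFin_expectation; last first.
  apply: (@integrable_bounded _ _ _ _ (m%:R `^ p)).
    apply: (@measurableT_comp _ _ _ _ _ _ (@powR R ^~ p)) => //.
    by apply: measurable_minr => //; exact: max_meas.
  move=> w; rewrite ger0_norm ?powR_ge0//; apply: le_powR.
  - lra.
  - by rewrite le_min running_max_ge0 ler0n.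
  - by rewrite ge_min lexx.
by rewrite -EFin_expectation// -EFinM lee_fin; exact: doob_truncated.
Unshelve. all: by end_near. Qed.

End doob.

(** * Continuous paths, uniform grids and discretized times *)

Section paths.
Context {R : realType}.
Implicit Types (f : R -> R) (T s t sigma : R) (u : nat -> R) (m k : nat).

(** The Heine-Cantor theorem, from the near-covering form of compactness. Later arguments use path
    continuity mostly in this epsilon-delta form. *)
Lemma path_uniformly_continuous f T : continuous_path T f ->
  forall e, 0 < e -> exists2 del : R, 0 < del &
    forall x y, 0 <= x <= T -> 0 <= y <= T -> `|x - y| < del -> `|f x - f y| < e.
Proof.
move=> cf e e0; have /subspace_continuousP cf' := cf.
have := (compact_near_coveringP _).1 (@segment_compact R 0 T) _ (0^'+)
  (fun del x => 0 <= x <= T -> forall y, 0 <= y <= T -> `|x - y| < del ->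
    `|f x - f y| < e) _.
case.
  move=> x xT; have := cf' x xT; move/cvgrPdist_lt => /(_ (e / 2)).
  rewrite divr_gt0// => /(_ isT); rewrite near_withinE => /nbhs_ballP[r /= r0 rP].
  have ff z : 0 <= z <= T -> `|x - z| < r -> `|f x - f z| < e / 2.
    by move=> zT xz; apply: rP; rewrite //= in_itv.
  near=> z del.
  have xz : `|x - z| < r / 2.
    by near: z; apply: nbhsx_ballx; rewrite divr_gt0.
  have dr : del < r / 2 by near: del; apply: nbhs_right_lt; rewrite divr_gt0.
  move=> zT y yT zy.
  have xy : `|x - y| < r.
    rewrite -(subrK z x) -addrA (le_lt_trans (ler_normD _ _))//.
    by rewrite [r]splitr ltrD// (lt_trans zy).
  rewrite -(subrK (f x) (f z)) -addrA (le_lt_trans (ler_normD _ _))//.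
  rewrite [e]splitr ltrD//; last exact: ff.
  by rewrite distrC ff// (lt_trans xz)// ltr_pdivrMr//; lra.
move=> del /= del0 h; exists (del / 2); first by rewrite divr_gt0.
move=> x y xT yT xy; apply: (h (del / 2)) => //=.
- by rewrite sub0r normrN gtr0_norm ?divr_gt0// ltr_pdivrMr//; lra.
- by rewrite divr_gt0.
Unshelve. all: by end_near. Qed.

Lemma path_bounded f T : 0 <= T -> continuous_path T f ->
  exists2 K : R, 0 < K & forall x, 0 <= x <= T -> `|f x| <= K.
Proof.
move=> T0 cf.
have [c _ hc] := EVT_max T0 cf; have [c' _ hc'] := EVT_min T0 cf.
exists (`|f c| + `|f c'| + 1) => [|x xT]; first by rewrite ltr_wpDl// addr_ge0.
have := hc x; have := hc' x; rewrite in_itv/= => /(_ xT) a /(_ xT) b.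
have := ler_norm (f c); have := ler_norm (- f c'); rewrite normrN => *.
by have ? := normr_ge0 (f c); have ? := normr_ge0 (f c'); rewrite ler_norml; lra.
Qed.

Lemma path_cvg f T (x : nat -> R) y : continuous_path T f ->
  (forall n, 0 <= x n <= T) -> 0 <= y <= T -> x n @[n --> \oo] --> y ->
  f (x n) @[n --> \oo] --> f y.
Proof.
move=> cf xT yT xy; apply/cvgrPdist_lt => e e0.
have [del del0 h] := path_uniformly_continuous cf e0.
move/cvgrPdist_lt : xy => /(_ _ del0); apply: filterS => n yx.
exact: h.
Qed.

(** The index is capped at [m.+1], so that the sequence is monotone and stays in [[s, t]] for all
    indices, being constant equal to [t] from there on; [m.+1] intervals avoid division by zero. *)
Definition grid s t m k : R := s + (t - s) * ((minn k m.+1)%:R / m.+1%:R).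

Lemma grid0 s t m : grid s t m 0 = s.
Proof. by rewrite /grid min0n mul0r mulr0 addr0. Qed.

Lemma grid_end s t m : grid s t m m.+1 = t.
Proof. by rewrite /grid minnn mulfV ?pnatr_eq0// mulr1 addrC subrK. Qed.

Lemma gridS s t m k : (k <= m)%N -> grid s t m k.+1 = grid s t m k + (t - s) / m.+1%:R.
Proof.
move=> km; rewrite /grid (minn_idPl _)// (minn_idPl _); last exact: leqW.
by rewrite -(natr1 k) [X in _ * X]mulrDl mul1r mulrDr addrA.
Qed.

Lemma grid_le s t m : s <= t -> {homo grid s t m : k l / (k <= l)%N >-> k <= l}.
Proof.
move=> st k l kl; rewrite lerD2l ler_wpM2l ?subr_ge0// ler_wpM2r ?invr_ge0// ler_nat.
by rewrite leq_min geq_minr andbT (leq_trans (geq_minl _ _)).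
Qed.

Lemma grid_itv s t m k : s <= t -> s <= grid s t m k <= t.
Proof.
move=> st; rewrite /grid lerDl mulr_ge0 ?subr_ge0//= ?divr_ge0//.
rewrite -lerBrDl ler_piMr ?subr_ge0// ler_pdivrMr// mul1r ler_nat.
exact: geq_minr.
Qed.

Lemma grid_step_cvg0 (x : R) : x / m.+1%:R @[m --> \oo] --> (0 : R).
Proof.
rewrite -[X in _ --> X](mulr0 x); apply: cvgM; first exact: cvg_cst.
exact: cvg_harmonic.
Qed.

(** The value is [m] when no [u k] with [k < m] reaches [sigma]. For a grid on [[s, t]] the bound is
    [m.+1], so this default points to [t] and the selected point approximates [min t sigma]. *)
Definition first_index sigma u m := find (fun k => sigma <= u k) (iota 0 m).

Lemma first_index_le sigma u m : (first_index sigma u m <= m)%N.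
Proof. by rewrite -[X in (_ <= X)%N](size_iota 0 m) find_size. Qed.

Lemma first_indexP sigma u m :
  (first_index sigma u m < m)%N -> sigma <= u (first_index sigma u m).
Proof.
move=> h; have hs : has (fun k => sigma <= u k) (iota 0 m).
  by rewrite has_find size_iota.
by have := nth_find 0%N hs; rewrite nth_iota.
Qed.

Lemma before_first_index sigma u m k : (k < first_index sigma u m)%N -> u k < sigma.
Proof.
move=> h; have := before_find 0%N h; rewrite nth_iota ?add0n.
  by rewrite ltNge => ->.
exact: leq_trans h (first_index_le _ _ _).
Qed.

Lemma first_index_eq sigma u m k : (k <= m)%N ->
  (first_index sigma u m = k) <->
  ((k < m)%N -> sigma <= u k) /\ (forall j, (j < k)%N -> u j < sigma).
Proof.
move=> km; split=> [<-|[h1 h2]].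
  by split; [exact: first_indexP|exact: before_first_index].
apply/eqP; rewrite eqn_leq; apply/andP; split; rewrite leqNgt; apply/negP => h.
  have := before_first_index h; rewrite ltNge h1//.
  exact: leq_trans h (first_index_le _ _ _).
have := h2 _ h; rewrite ltNge first_indexP//.
exact: leq_trans h km.
Qed.

(** The preceding grid point lies below [sigma], so the selected one exceeds [min t sigma] by at
    most one step. Approximation from above is what adaptedness demands. *)
Lemma grid_first_index_near s t sigma m : s <= t -> s <= sigma ->
  `|Num.min t sigma - grid s t m (first_index sigma (grid s t m) m.+1)|
  <= (t - s) / m.+1%:R.
Proof.
move=> st ss; set u := grid s t m; set k := first_index _ _ _.
have km : (k <= m.+1)%N := first_index_le _ _ _.
have d0 : 0 <= (t - s) / m.+1%:R by rewrite divr_ge0 ?subr_ge0.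
have [k0|k0] := posnP k.
  have := @first_indexP sigma u m.+1; rewrite -/k k0 /u grid0 => /(_ isT) h.
  have E : sigma = s by apply/eqP; rewrite eq_le h ss.
  by rewrite E min_r// subrr normr0.
have := @before_first_index sigma u m.+1 k.-1; rewrite -/k ltn_predL => /(_ k0) h1.
have kE : u k = u k.-1 + (t - s) / m.+1%:R.
  by rewrite -[in LHS](prednK k0) /u gridS// -ltnS prednK.
have /andP[su ut] : s <= u k <= t by exact: grid_itv.
have h2 : Num.min t sigma <= u k.
  move: km; rewrite leq_eqVlt => /predU1P[kE'|klt].
    by rewrite kE' /u grid_end ge_min lexx.
  by rewrite ge_min (first_indexP klt) orbT.
have h3 : u k.-1 <= Num.min t sigma.
  by rewrite le_min (ltW h1) andbT; have /andP[] := grid_itv m k.-1 st.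
rewrite distrC ger0_norm ?subr_ge0// -(lerD2r (Num.min t sigma)) subrK kE addrC.
by rewrite lerD2l.
Qed.

Lemma grid_first_index_cvg s t sigma : s <= t -> s <= sigma ->
  grid s t m (first_index sigma (grid s t m) m.+1) @[m --> \oo] --> Num.min t sigma.
Proof.
move=> st ss; apply/cvgrPdist_le => e e0.
have /cvgrPdist_le/(_ _ e0) := grid_step_cvg0 (t - s).
apply: filterS => m; rewrite sub0r normrN => h.
exact: le_trans (grid_first_index_near m st ss) (le_trans (ler_norm _) h).
Qed.

End paths.

(** * Stopped processes and optional stopping *)

Section stopping.
Context {d : measure_display} {Omega : measurableType d} {R : realType}.
Variables (P : probability Omega R) (T : R) (F : R -> set (set Omega)).
Hypothesis filF : is_filtration T F.

Local Notation intg f := (P.-integrable [set: Omega] (EFin \o f)).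
Local Notation EE f := (Rintegral P [set: Omega] f).

Lemma filtration_measurable_fun (X : Omega -> R) s : 0 <= s <= T -> measurable_wrt (F s) X ->
  measurable_fun [set: Omega] X.
Proof. by move=> sT; apply: measurable_wrt_fun; exact: (filtration_measurable filF). Qed.

(** The event is decided by comparing [sigma] with the times [u j] for [j <= k]; for the default
    index [k = m] the comparison at [k] itself is void. *)
Lemma first_index_set (sigma : Omega -> R) (u : nat -> R) m k :
  is_stopping_time T F sigma -> (forall j, 0 <= u j <= T) ->
  {homo u : i j / (i <= j)%N >-> i <= j} -> (k <= m)%N ->
  F (u k) [set w | first_index (sigma w) u m = k].
Proof.
move=> ss uT ndu km; have sF := filtration_sigma filF (uT k).
have Fu j : (j <= k)%N -> F (u j) `<=` F (u k).
  move=> jk; have /andP[? ?] := uT j; have /andP[? ?] := uT k.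
  by apply: (filtration_le filF) => //; exact: ndu.
pose A := \bigcap_j (if (j < k)%N then ~` [set w | sigma w <= u j] else setT).
pose B := if (k < m)%N then [set w | sigma w <= u k] else setT.
rewrite (_ : mkset _ = A `&` B); last first.
  apply/seteqP; split=> w /=.
    move=> /(first_index_eq _ _ km)[h1 h2]; split.
      by move=> j _; case: ifPn => // /h2; rewrite ltNge => /negP.
    by rewrite /B; case: ifPn.
  move=> [h1 h2]; apply/(first_index_eq _ _ km); split.
    by move: h2; rewrite /B; case: ifPn.
  by move=> j jk; have := h1 j Logic.I; rewrite jk /= => /negP; rewrite -ltNge.
apply: (sigma_algebra_setI sF); last first.
  by rewrite /B; case: ifPn => _; [exact: (stopping_measurable ss)|exact: sigma_algebra_setT].
apply: (sigma_algebra_bigcapT sF) => j; case: ifPn => jk; last exact: sigma_algebra_setT.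
apply: (sigma_algebra_setC sF); apply: (Fu j (ltnW jk)).
exact: (stopping_measurable ss).
Qed.

(** By continuity the stopped value is the limit of the values at the discretized times. These are
    finite sums of an indicator from [first_index_set] times the process at a grid time, all known
    at time [t]. *)
Lemma stopped_adapted (X : R -> Omega -> R) (sigma : Omega -> R) :
  adapted T F X -> is_stopping_time T F sigma ->
  (forall w, continuous_path T (X ^~ w)) -> adapted T F (stopped X sigma).
Proof.
move=> aX ss cX t tT; have /andP[t0 tT'] := tT; have sF := filtration_sigma filF tT.
have uT m k : 0 <= grid 0 t m k <= T.
  by have /andP[-> /= h] := grid_itv m k t0; exact: le_trans tT'.
pose h m w := \sum_(k < m.+2)
  \1_[set w | first_index (sigma w) (grid 0 t m) m.+1 = k] w * X (grid 0 t m k) w.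
apply: (@measurable_wrt_cvg _ _ _ _ sF h).
  move=> m; apply: measurable_wrt_sum => // k.
  have Fk : F (grid 0 t m k) `<=` F t.
    have /andP[? ?] := uT m k; apply: (filtration_le filF) => //.
    by have /andP[] := grid_itv m k t0.
  apply: measurable_wrtM => //; last by apply: (measurable_wrtS Fk); exact: aX.
  apply: measurable_wrt_indic => //; apply: Fk.
  by apply: first_index_set => //; [exact: grid_le|rewrite -ltnS].
move=> w; have hE m : h m w = X (grid 0 t m (first_index (sigma w) (grid 0 t m) m.+1)) w.
  pose k0 := Ordinal (first_index_le (sigma w) (grid 0 t m) m.+1 : (_ < m.+2)%N).
  rewrite /h (bigD1 k0)//= big1 ?addr0 => [|k kk0].
    by rewrite indicE mem_set ?mul1r.
  rewrite indicE memNset ?mul0r//= => E; move/eqP: kk0; apply.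
  by apply: val_inj; rewrite /= E.
under eq_fun do rewrite hE.
apply: (path_cvg (cX w)) => //; last exact: grid_first_index_cvg t0 (stopping_ge0 ss w).
by rewrite le_min t0 (stopping_ge0 ss)/= ge_min tT'.
Qed.

Lemma expectation_ae_eq (f g : Omega -> R) : measurable_fun [set: Omega] f ->
  measurable_fun [set: Omega] g -> {ae P, forall w, f w = g w} -> EE f = EE g.
Proof.
move=> mf mg fg; congr fine; apply: ae_eq_integral => //.
- exact/measurable_EFinP.
- exact/measurable_EFinP.
- by apply: filterS fg => w -> _.
Qed.

(* The weight [K / max K |x|], equal to 1 on [-K,K], makes both sides of the
   identity for the discretized stopping time pass to the limit without uniform
   integrability. *)
Lemma optional_stopping_bounded (N m : R -> Omega -> R) (sigma : Omega -> R) (K : R)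
    (s t : R) (B : set Omega) :
  is_martingale P T F N -> is_stopping_time T F sigma -> 0 < K ->
  (forall v w, 0 <= v <= T -> `|m v w| <= K) -> adapted T F m ->
  {ae P, forall w, continuous_path T (N ^~ w)} ->
  {ae P, forall w v, 0 <= v <= T -> m v w = N (Num.min v (sigma w)) w} ->
  0 <= s -> s <= t -> t <= T -> F s B ->
  EE (fun w => \1_B w * (m t w - m s w)) = 0.
Proof.
move=> mN ss K0 mK am cN mE s0 st tT FB.
have sT : 0 <= s <= T by rewrite s0 (le_trans st).
have tT' : 0 <= t <= T by rewrite (le_trans s0 st).
have uT n k : 0 <= grid s t n k <= T.
  by have /andP[a b] := grid_itv n k st; rewrite (le_trans s0 a) (le_trans b).
have su n k : s <= grid s t n k by have /andP[] := grid_itv n k st.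
have ut n k : grid s t n k <= t by have /andP[] := grid_itv n k st.
have sF v : 0 <= v <= T -> sigma_algebra setT (F v) by exact: (filtration_sigma filF).
have Fm v : 0 <= v <= T -> F v `<=` measurable by exact: (filtration_measurable filF).
(* Where [sigma <= s] the stopped process no longer moves after [s], so only this part of [B]
   matters; on it the grid over [[s, t]] can follow [min t sigma]. *)
pose B' := B `&` ~` [set w | sigma w <= s].
have FB' : F s B'.
  apply: (sigma_algebra_setI (sF s sT)) => //.
  by apply: (sigma_algebra_setC (sF s sT)); exact: (stopping_measurable ss).
have mB' : measurable B' by exact: Fm FB'.
have mB : measurable B by exact: Fm FB.
pose W (x : R) : R := K / Num.max K `|x|.
have W0 (x : R) : 0 < Num.max K `|x| by rewrite lt_max K0.
have W1 (x : R) : `|W x| <= 1.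
  by rewrite ger0_norm ?divr_ge0 ?(ltW K0) ?(ltW (W0 _))// ler_pdivrMr// mul1r le_max lexx.
have WK (x : R) : `|x * W x| <= K.
  rewrite normrM [`|W x|]ger0_norm ?divr_ge0 ?(ltW K0) ?(ltW (W0 _))//.
  by rewrite mulrCA ler_piMr ?(ltW K0)// ler_pdivrMr// mul1r le_max lexx orbT.
have WE (x : R) : `|x| <= K -> W x = 1.
  by move=> xK; rewrite /W max_l// mulfV// gt_eqF.
have cW : continuous W.
  move=> x; apply: cvgM; first exact: cvg_cst.
  apply: cvgV; first by rewrite gt_eqF.
  apply: (@continuous_max _ _ (fun=> K) Num.norm); first exact: cvg_cst.
  exact: norm_continuous.
have mW : measurable_fun [set: R] W by exact: continuous_measurable_fun.
pose kap n (w : Omega) := first_index (sigma w) (grid s t n) n.+1.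
pose Rn n (w : Omega) : R := N (grid s t n (kap n w)) w.
(* Bounded and known at the grid time of index [k], hence orthogonal to the increment of [N] from
   there to [t]. Summing over [k] produces the weight at the discretized stopping time. *)
pose term n k (w : Omega) : R := \1_B' w * \1_[set w | kap n w = k] w * W (N (grid s t n k) w).
have Nmeas v : 0 <= v <= T -> measurable_wrt (F v) (N v).
  exact: martingale_adapted mN v.
have Nint v : 0 <= v <= T -> intg (N v) by exact: martingale_integrable mN v.
have term_wrt n k : (k <= n.+1)%N -> measurable_wrt (F (grid s t n k)) (term n k).
  move=> kn; have sk := sF _ (uT n k); have /andP[g0 gT] := uT n k.
  apply: measurable_wrtM => //; first apply: measurable_wrtM => //.
  - apply: measurable_wrt_indic => //.
    by have := filtration_le filF s0 (su n k) gT; apply.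
  - by apply: measurable_wrt_indic => //; apply: first_index_set => //; exact: grid_le.
  - by apply: (measurable_wrt_comp sk mW); exact: Nmeas.
have term_le n k w : `|term n k w| <= 1.
  rewrite /term; move: (W1 (N (grid s t n k) w)); move: (W _) => x x1.
  by rewrite !normrM !indicE; do 2![case: (_ \in _)];
    rewrite !(normr1, normr0, mul1r, mul0r).
have sum_term n w : \sum_(k < n.+2) term n k w * (N t w - N (grid s t n k) w) =
    \1_B' w * W (Rn n w) * (N t w - Rn n w).
  pose k0 := Ordinal (first_index_le (sigma w) (grid s t n) n.+1 : (_ < n.+2)%N).
  rewrite (bigD1 k0)//= big1 ?addr0 => [|k kk0].
    by rewrite /term [X in _ * X * _]indicE mem_set ?mulr1.
  rewrite /term [X in _ * X * _ * _]indicE memNset ?mulr0 ?mul0r//= => E.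
  by move/eqP: kk0; apply; apply: val_inj; rewrite /= -E.
have termi n k : (k <= n.+1)%N -> intg (fun w => term n k w * (N t w - N (grid s t n k) w)).
  move=> kn; apply: (@integrable_boundedM _ _ _ _ 1) => //.
    exact: filtration_measurable_fun (uT n k) (term_wrt n k kn).
  by apply: integrableB_EFin; exact: Nint.
have E0 n : EE (fun w => \1_B' w * W (Rn n w) * (N t w - Rn n w)) = 0.
  under eq_Rintegral do rewrite -sum_term.
  rewrite expectation_sum => [|k]; last by apply: termi; rewrite -ltnS.
  rewrite big1// => k _; have kn : (k <= n.+1)%N by rewrite -ltnS.
  apply: (condexp_orthogonal (sF _ (uT n k)) (Fm _ (uT n k)) (Nint t tT')
    _ (term_wrt n k kn) (@term_le n k)).
  by have /andP[? ?] := uT n k; apply: (martingale_condexp mN).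
have mind : measurable_fun [set: Omega] (\1_B' : Omega -> R) by exact: measurable_indic.
have ind1 w : `|\1_B' w : R| <= 1.
  by rewrite indicE; case: (_ \in _); rewrite ?normr1 ?normr0.
have mmeas v : 0 <= v <= T -> measurable_fun [set: Omega] (m v).
  by move=> vT; apply: (filtration_measurable_fun vT); exact: am.
have mint v : 0 <= v <= T -> intg (m v).
  by move=> vT; apply: (@integrable_bounded _ _ _ _ K); [exact: mmeas|move=> w; exact: mK].
have Nmf v : 0 <= v <= T -> measurable_fun [set: Omega] (N v).
  by move=> vT; exact: integrable_measurable (Nint v vT).
have [||||| _ cv] := @expectation_cvg _ _ _ P
  (fun n w => \1_B' w * W (Rn n w) * (N t w - Rn n w))
  (fun w => \1_B' w * (N t w - m t w)) (fun w => `|N t w| + K).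
- move=> n; rewrite (_ : (fun w => _) = (fun w => \sum_(k < n.+2) term n k w *
    (N t w - N (grid s t n k) w))); last by apply/funext => w; rewrite sum_term.
  apply: measurable_sum => k.
  by have kn : (k <= n.+1)%N by [rewrite -ltnS]; exact: integrable_measurable (termi n k kn).
- by apply: measurable_funM => //; apply: measurable_funB; [exact: Nmf|exact: mmeas].
- apply: integrableD_EFin; first exact/integrable_norm/Nint.
  by apply: (@integrable_bounded _ _ _ _ `|K|).
(* Domination: [|W x| <= 1] takes care of [N t], and [|x * W x| <= K] of the discretized value, on
   which no uniform control is available. *)
- move=> n w; rewrite -mulrA normrM mulrBr [W _ * Rn n w]mulrC.
  apply: (@le_trans _ _ (1 * `|W (Rn n w) * N t w - Rn n w * W (Rn n w)|)).
    by rewrite ler_wpM2r.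
  rewrite mul1r (le_trans (ler_normB _ _))// lerD// normrM.
  by rewrite -[leRHS]mul1r ler_wpM2r.
- apply: filterS2 cN mE => w cw mw; have [wB|wB] := boolP (w \in B'); last first.
    by rewrite indicE (negbTE wB); under eq_fun do rewrite !mul0r; rewrite mul0r; exact: cvg_cst.
  rewrite indicE wB; under eq_fun do rewrite mul1r; rewrite mul1r.
  have ssw : s <= sigma w.
    by move/set_mem : wB => [_ /negP]; rewrite -ltNge => /ltW.
  have cR : Rn n w @[n --> \oo] --> m t w.
    rewrite mw//; apply: (path_cvg cw) => //; last exact: grid_first_index_cvg.
    by rewrite le_min ge_min tT (le_trans s0 ssw) (le_trans s0 st).
  have c1 : W (Rn n w) @[n --> \oo] --> W (m t w).
    by apply: continuous_cvg => //; exact: cW.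
  have c2 : N t w - Rn n w @[n --> \oo] --> N t w - m t w.
    by apply: cvgB => //; exact: cvg_cst.
  (* The limiting weight is taken at [m t w], which is bounded by [K], so it equals 1. *)
  rewrite WE ?mK// in c1.
  by rewrite -[N t w - m t w]mul1r; apply: cvgM.
have Elim : EE (fun w => \1_B' w * (N t w - m t w)) = 0.
  move: cv; under eq_fun do rewrite E0; move=> /cvg_lim <-//.
  by rewrite lim_cst.
have i1 : intg (fun w => \1_B' w * (N t w - m t w)).
  by apply: (@integrable_boundedM _ _ _ _ 1) => //; apply: integrableB_EFin; [exact: Nint|exact: mint].
have i2 : intg (fun w => \1_B' w * (N t w - N s w)).
  by apply: (@integrable_boundedM _ _ _ _ 1) => //; apply: integrableB_EFin; exact: Nint.
have E2 : EE (fun w => \1_B' w * (N t w - N s w)) = 0.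
  apply: (condexp_orthogonal (sF _ sT) (Fm _ sT) (Nint t tT') _ _ ind1).
    exact: (martingale_condexp mN).
  by apply: measurable_wrt_indic => //; exact: sF.
(* The martingale property of [N] between [s] and [t], tested on [B'], trades [N t] for [N s], which
   almost surely equals [m s] on [B']. *)
rewrite -[RHS](subrr 0) -[X in X - _]E2 -[X in _ - X]Elim -expectation_sub//.
apply: expectation_ae_eq.
- apply: measurable_funM; first exact: measurable_indic.
  by apply: measurable_funB; exact: mmeas.
- by apply: measurable_funB; [exact: integrable_measurable i2|exact: integrable_measurable i1].
apply: filterS mE => w mw.
rewrite (_ : _ - \1_B' w * _ = \1_B' w * (m t w - N s w)); last by ring.
have [h|h] := leP (sigma w) s.
  rewrite !mw// !min_r ?(le_trans h st)// subrr mulr0 indicE memNset ?mul0r//.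
  by rewrite /B' => -[_ /=]; rewrite h.
rewrite [m s w]mw// min_l ?(ltW h)//; congr (_ * _); rewrite !indicE; congr (nat_of_bool _)%:R.
apply/idP/idP => /set_mem wB; apply/mem_set; last by case: wB.
by split => //=; apply/negP; rewrite -ltNge.
Qed.

End stopping.

(** * Moments of martingale transforms *)

Section power_taylor.
Context {R : realType}.
Implicit Types (p r x y h : R).

(** The odd extension of the power function: [p * spowR (p - 1) x] is the derivative of [|x|^p] for
    [p > 1]. *)
Definition spowR r x : R := Num.sg x * `|x| `^ r.

Lemma spowRN r x : spowR r (- x) = - spowR r x.
Proof. by rewrite /spowR sgrN normrN mulNr. Qed.

Lemma measurable_spowR r : measurable_fun [set: R] (spowR r).
Proof.
apply: measurable_funM; first exact: measurable_sgr.
by apply: (@measurableT_comp _ _ _ _ _ _ (@powR R ^~ r)).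
Qed.

Lemma spowR_ge0 r x : 0 < r -> 0 <= x -> spowR r x = x `^ r.
Proof.
rewrite /spowR le_eqVlt => r0 /predU1P[<-|x0].
  by rewrite sgr0 mul0r powR0// gt_eqF.
by rewrite gtr0_sg// mul1r gtr0_norm.
Qed.

Lemma norm_spowR r x : 0 < r -> `|spowR r x| = `|x| `^ r.
Proof.
move=> r0; rewrite /spowR normrM normr_sg [X in _ * X]ger0_norm ?powR_ge0//.
by have [->|] := eqVneq x 0; rewrite ?mul1r// normr0 powR0 ?mulr0// gt_eqF.
Qed.

Lemma powR_lipschitz r x y : 1 < r -> 0 <= x -> x <= y ->
  y `^ r - x `^ r <= r * y `^ (r - 1) * (y - x).
Proof.
move=> r1 x0 xy; have := powR_ge_tangent r1 (le_trans x0 xy) x0.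
by move: (_ `^ (r - 1)) => z; lra.
Qed.

(** By symmetry [|x| <= |y|] and [0 <= y]. For [x] of the same sign this is the tangent inequality
    at [y]; for opposite signs the two powers add up, and [|x|^r <= y^(r-1) * |x|] suffices because
    the distance is then [y + |x|]. *)
Lemma spowR_lipschitz r x y : 1 < r ->
  `|spowR r y - spowR r x| <= r * Num.max `|x| `|y| `^ (r - 1) * `|y - x|.
Proof.
move=> r1; have r0 : 0 < r by lra.
wlog xy : x y / `|x| <= `|y|.
  move=> H; have /orP[/H//|/H] := le_total `|x| `|y|.
  by rewrite (distrC (spowR r x)) (distrC x) (maxC `|y|).
wlog y0 : x y xy / 0 <= y.
  move=> H; have [y0|y0] := leP 0 y; first exact: H.
  have := H (- x) (- y); rewrite !normrN oppr_ge0 => /(_ xy (ltW y0)).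
  by rewrite !spowRN -!opprD !normrN.
rewrite max_r// (ger0_norm y0); rewrite (ger0_norm y0) in xy.
rewrite (spowR_ge0 _ y0)//; have [x0|x0] := leP 0 x.
  rewrite (ger0_norm x0) in xy.
  rewrite spowR_ge0// !ger0_norm ?subr_ge0//; first exact: powR_lipschitz.
  exact: le_powR (ltW r0) x0 xy.
have -> : spowR r x = - (`|x| `^ r) by rewrite /spowR ltr0_sg// mulN1r.
rewrite opprK ger0_norm ?addr_ge0 ?powR_ge0//.
rewrite [`|y - x|]ger0_norm; last by lra.
have e : `|x| = - x by rewrite ltr0_norm.
rewrite -mulrA; apply: (@le_trans _ _ (y `^ (r - 1) * (y - x))); last first.
  by rewrite ler_peMl ?mulr_ge0 ?powR_ge0//; lra.
rewrite mulrBr powR_subr1// lerD2l -mulrN -e -(powR_subr1 r1 (normr_ge0 x)).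
by rewrite ler_wpM2r// le_powR//; lra.
Qed.

(** The factor [p] comes from the tangent inequality, [p - 1] from the Lipschitz bound for the
    derivative, and [2^(p-2)] from splitting [(|x| + |h|)^(p-2)]. *)
Definition taylor_cst p : R := p * (p - 1) * 2 `^ (p - 2).

Lemma taylor_cst_gt0 p : 2 < p -> 0 < taylor_cst p.
Proof. by move=> p2; rewrite !mulr_gt0 ?powR_gt0//; lra. Qed.

Lemma sqr_powR2 x : `|x| `^ 2 = x ^+ 2.
Proof. by rewrite powR_mulrn// real_normK// num_real. Qed.

Lemma powR_taylor p x h : 2 < p ->
  `|x + h| `^ p <= `|x| `^ p + p * spowR (p - 1) x * h +
    taylor_cst p * (`|x| `^ (p - 2) * h ^+ 2 + `|h| `^ p).
Proof.
move=> p2; set y := x + h.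
(* The tangent is taken at the endpoint [y], where convexity bounds [|y|^p] from above; the
   derivative at [y] is then compared with the one at [x]. *)
have c1 : `|y| `^ p <= `|x| `^ p + p * spowR (p - 1) y * h.
  have := powR_ge_tangent (ltac:(lra) : 1 < p) (normr_ge0 y) (normr_ge0 x).
  have : - (Num.sg y * h) <= `|x| - `|y|.
    rewrite (normrEsg y) lerBrDr -mulrN -mulrDr /y.
    rewrite [- h + _]addrC addrK (le_trans (ler_norm _))// normrM normr_sg.
    by case: (_ != _); rewrite ?mul1r// mul0r.
  have : 0 <= p * `|y| `^ (p - 1) by rewrite mulr_ge0 ?powR_ge0//; lra.
  rewrite /spowR; move: (`|y| `^ (p - 1)) (`|y| `^ p) (`|x| `^ p) (`|x| - `|y|) (Num.sg y).
  by move=> a b c e s a0 se; have := ler_wpM2l a0 se; nra.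
have c2 : (spowR (p - 1) y - spowR (p - 1) x) * h <=
    (p - 1) * (2 `^ (p - 2) * (`|x| `^ (p - 2) + `|h| `^ (p - 2))) * h ^+ 2.
  apply: (le_trans (ler_norm _)); rewrite normrM -[h ^+ 2]sqr_powR2.
  rewrite powR_mulrn// expr2 mulrA ler_wpM2r//.
  have := @spowR_lipschitz (p - 1) x y; rewrite ltrBrDl => /(_ p2)/le_trans; apply.
  have -> : y - x = h by rewrite /y addrAC subrr add0r.
  rewrite ler_wpM2r// ler_wpM2l//; first lra.
  rewrite -addrA -opprD (_ : 1 + 1 = 2)//.
  apply: le_trans (powRD_le (ltac:(lra) : 0 <= p - 2) (normr_ge0 _) (normr_ge0 _)).
  apply: le_powR; [lra|by rewrite le_max normr_ge0|].
  by rewrite ge_max lerDl normr_ge0 ler_normD.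
have e : `|h| `^ p = `|h| `^ (p - 2) * h ^+ 2.
  rewrite -[h ^+ 2]sqr_powR2 -powRD; first by rewrite subrK.
  by rewrite subrK (_ : p == 0 = false)//; apply/negP => /eqP; lra.
rewrite e; apply: le_trans c1 _; rewrite -addrA lerD2l.
have -> : p * spowR (p - 1) y * h = p * spowR (p - 1) x * h +
  p * ((spowR (p - 1) y - spowR (p - 1) x) * h) by ring.
rewrite lerD2l; apply: (le_trans (ler_wpM2l _ c2)); first lra.
rewrite /taylor_cst -mulrDl le_eqVlt; apply/orP; left; apply/eqP; ring.
Qed.

End power_taylor.

(** * Transforms of a bounded martingale along one partition *)

Section bdg_partition.
Context {d : measure_display} {Omega : measurableType d} {R : realType}.
Variables (P : probability Omega R) (T : R) (F : R -> set (set Omega)).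
Hypothesis filF : is_filtration T F.

Local Notation intg f := (P.-integrable [set: Omega] (EFin \o f)).
Local Notation EE f := (Rintegral P [set: Omega] f).

(* [m] is a bounded continuous martingale with bracket [q], the martingale
   properties of [m] and [m^2 - q] being tested on indicators. *)
Record bounded_bracket (K : R) (m q : R -> Omega -> R) : Prop := {
  bb_adapted : adapted T F m ;
  bb_qadapted : adapted T F q ;
  bb_bounded : forall t w, 0 <= t <= T -> `|m t w| <= K ;
  bb_qbounded : forall t w, 0 <= t <= T -> `|q t w| <= K ;
  bb_continuous : forall w, continuous_path T (m ^~ w) ;
  bb_q0 : forall w, q 0 w = 0 ;
  bb_qnd : forall w s t, 0 <= s -> s <= t -> t <= T -> q s w <= q t w ;
  bb_martingale : forall s t B, 0 <= s -> s <= t -> t <= T -> F s B ->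
    EE (fun w => \1_B w * (m t w - m s w)) = 0 ;
  bb_bracket : forall s t B, 0 <= s -> s <= t -> t <= T -> F s B ->
    EE (fun w => \1_B w * ((m t w ^+ 2 - q t w) - (m s w ^+ 2 - q s w))) = 0
}.

Variables (K : R) (m q : R -> Omega -> R).
Hypothesis bb : bounded_bracket K m q.
Variables (u : nat -> R).
Hypotheses (uT : forall k, 0 <= u k <= T) (uS : forall k, u k <= u k.+1).

Let D k w : R := m (u k.+1) w - m (u k) w.
Let Dq k w : R := q (u k.+1) w - q (u k) w.

Let sF k : sigma_algebra [set: Omega] (F (u k)).
Proof. exact: (filtration_sigma filF). Qed.

Let Fm k : F (u k) `<=` measurable.
Proof. exact: (filtration_measurable filF). Qed.

Let FS k : F (u k) `<=` F (u k.+1).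
Proof.
by have /andP[? ?] := uT k; have /andP[? ?] := uT k.+1; exact: (filtration_le filF).
Qed.

Lemma increment_wrt (X : R -> Omega -> R) k : adapted T F X ->
  measurable_wrt (F (u k.+1)) (fun w => X (u k.+1) w - X (u k) w).
Proof.
move=> aX; apply: measurable_wrtB => //; first exact: aX.
by apply: (measurable_wrtS (@FS k)); exact: aX.
Qed.

Let mD k : measurable_fun [set: Omega] (D k).
Proof. by apply: (measurable_wrt_fun (@Fm k.+1)); apply: increment_wrt; exact: bb_adapted bb. Qed.

Let mDq k : measurable_fun [set: Omega] (Dq k).
Proof. by apply: (measurable_wrt_fun (@Fm k.+1)); apply: increment_wrt; exact: bb_qadapted bb. Qed.

Let DK k w : `|D k w| <= 2 * K.
Proof.
rewrite (le_trans (ler_normB _ _))// (_ : 2 * K = K + K) ?lerD ?(bb_bounded bb)//.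
by rewrite mulr_natl mulr2n.
Qed.

Let DqK k w : `|Dq k w| <= 2 * K.
Proof.
rewrite (le_trans (ler_normB _ _))// (_ : 2 * K = K + K) ?lerD ?(bb_qbounded bb)//.
by rewrite mulr_natl mulr2n.
Qed.

Let Dq_ge0 k w : 0 <= Dq k w.
Proof.
rewrite subr_ge0; have /andP[? ?] := uT k; have /andP[? ?] := uT k.+1.
exact: (bb_qnd bb).
Qed.

Lemma indicator_orthogonal (X g : Omega -> R) k L : intg X ->
  (forall B, F (u k) B -> EE (fun w => \1_B w * X w) = 0) ->
  measurable_wrt (F (u k)) g -> (forall w, `|g w| <= L) -> EE (fun w => g w * X w) = 0.
Proof.
move=> Xi X0 mg gL; apply: (expectation_orthogonal (sF k) (@Fm k) Xi _ mg gL) => B FB.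
by rewrite -expectation_indic ?X0//; exact: Fm FB.
Qed.

Lemma bracket_orthogonal (g : Omega -> R) k L : measurable_wrt (F (u k)) g ->
  (forall w, `|g w| <= L) -> EE (fun w => g w * D k w) = 0.
Proof.
move=> mg gL; apply: indicator_orthogonal mg gL.
  by apply: (@integrable_bounded _ _ _ _ (2 * K)).
by have /andP[? ?] := uT k; have /andP[? ?] := uT k.+1; move=> B FB;
  exact: (bb_martingale bb).
Qed.

Let intM (g h : Omega -> R) (L L' : R) : measurable_fun [set: Omega] g -> (forall w, `|g w| <= L) ->
  measurable_fun [set: Omega] h -> (forall w, `|h w| <= L') -> intg (fun w => g w * h w).
Proof.
move=> mg gL mh hL; apply: (@integrable_boundedM _ _ _ _ L) => //.
exact: (@integrable_bounded _ _ _ _ L').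
Qed.

Let D2K k w : `|D k w ^+ 2| <= (2 * K) ^+ 2.
Proof. by rewrite normrX lerXn2r ?nnegrE ?DK// (le_trans _ (DK k w)). Qed.

(** The squared increment of [m] is the increment [X] of [m^2 - q], plus that of [q], minus
    [2 * m (u k)] times that of [m]. Against a weight known at [u k], the first and the last have
    expectation 0. *)
Lemma bracket_sqr (g : Omega -> R) k L : measurable_wrt (F (u k)) g -> (forall w, `|g w| <= L) ->
  EE (fun w => g w * D k w ^+ 2) = EE (fun w => g w * Dq k w).
Proof.
move=> mg gL; have mg' := measurable_wrt_fun (@Fm k) mg.
have mk : measurable_wrt (F (u k)) (m (u k)) by exact: (bb_adapted bb).
have mmf j : measurable_fun [set: Omega] (m (u j)).
  by apply: (measurable_wrt_fun (@Fm j)); exact: (bb_adapted bb).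
have mqf j : measurable_fun [set: Omega] (q (u j)).
  by apply: (measurable_wrt_fun (@Fm j)); exact: (bb_qadapted bb).
have E1 : EE (fun w => (g w * m (u k) w) * D k w) = 0.
  apply: (bracket_orthogonal (L := L * K)); first exact: measurable_wrtM.
  by move=> w; rewrite normrM ler_pM// (bb_bounded bb).
pose X w : R := (m (u k.+1) w ^+ 2 - q (u k.+1) w) - (m (u k) w ^+ 2 - q (u k) w).
have mX : measurable_fun [set: Omega] X.
  by apply: measurable_funB; apply: measurable_funB => //; exact: measurable_funX.
have XK w : `|X w| <= (K ^+ 2 + K) + (K ^+ 2 + K).
  rewrite (le_trans (ler_normB _ _))// lerD// (le_trans (ler_normB _ _))//;
    rewrite lerD ?(bb_qbounded bb)// normrX lerXn2r ?nnegrE ?(bb_bounded bb)//.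
    by rewrite (le_trans _ (bb_bounded bb w (uT k.+1))).
  by rewrite (le_trans _ (bb_bounded bb w (uT k))).
have E2 : EE (fun w => g w * X w) = 0.
  apply: (indicator_orthogonal _ _ mg gL); first exact: integrable_bounded XK.
  by have /andP[? ?] := uT k; have /andP[? ?] := uT k.+1; move=> B FB;
    exact: (bb_bracket bb).
have i1 : intg (fun w => (g w * m (u k) w) * D k w).
  apply: (intM (L := L * K) (L' := 2 * K)) => //; first exact: measurable_funM.
  by move=> w; rewrite normrM ler_pM// (bb_bounded bb).
have i2 : intg (fun w => g w * X w) by apply: intM XK.
have i3 : intg (fun w => g w * Dq k w) by apply: intM (DqK k).
have -> : (fun w => g w * D k w ^+ 2) =
    (fun w => (g w * X w + g w * Dq k w) - 2 * (g w * m (u k) w * D k w)).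
  by apply/funext => w; rewrite /X /D /Dq; ring.
rewrite expectation_sub ?expectation_add ?expectation_scale//; last 2 first.
- exact: integrableD_EFin.
- exact: integrableZ_EFin.
by rewrite E1 E2 mulr0 add0r subr0.
Qed.

Lemma sum_bracket n w : \sum_(k < n) Dq k w <= q T w.
Proof.
have -> : \sum_(k < n) Dq k w = q (u n) w - q (u 0%N) w.
  by rewrite -(big_mkord xpredT (fun k => Dq k w)) telescope_sumr.
have h t : 0 <= t <= T -> 0 <= q t w.
  by move=> /andP[t0 tT]; rewrite -(bb_q0 bb w); exact: (bb_qnd bb).
have := h _ (uT 0); have /andP[a b] := uT n; have := bb_qnd bb w a b (lexx T).
lra.
Qed.

Let V n w : R := \sum_(k < n) D k w ^+ 2.

Let mV n : measurable_wrt (F (u n)) (V n).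
Proof.
elim: n => [|n IH].
  by rewrite /V; under eq_fun do rewrite big_ord0; exact: measurable_wrt_cst.
rewrite /V; under eq_fun do rewrite big_ord_recr/=.
apply: measurable_wrtD => //; first exact: (measurable_wrtS (@FS n)).
apply: (measurable_wrt_comp (sF _) (g := fun x : R => x ^+ 2)).
  exact: exprn_measurable.
by apply: increment_wrt; exact: (bb_adapted bb).
Qed.

Let VK n w : `|V n w| <= (2 * K) ^+ 2 *+ n.
Proof.
rewrite (le_trans (ler_norm_sum _ _ _))// -[X in _ <= _ *+ X]card_ord -sumr_const.
by apply: ler_sum => k _.
Qed.

Let V_ge0 n w : 0 <= V n w.
Proof. by apply: sumr_ge0 => k _; exact: sqr_ge0. Qed.

Hypothesis K0 : 0 <= K.
Hypothesis T0 : 0 <= T.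

Lemma expectation_sum_sqr n : EE (V n) <= K.
Proof.
have i k : intg (fun w => D k w ^+ 2).
  by apply: (@integrable_bounded _ _ _ _ ((2 * K) ^+ 2)) => //; exact: measurable_funX.
rewrite expectation_sum// (eq_bigr (fun k : 'I_n => EE (Dq k))); last first.
  move=> k _; have h1 (w : Omega) : `|1 : R| <= 1 by rewrite normr1.
  have mc : measurable_wrt (F (u k)) (fun=> 1 : R) by apply: measurable_wrt_cst; exact: sF.
  have := bracket_sqr mc h1.
  by under eq_Rintegral do rewrite mul1r; under [in RHS]eq_Rintegral do rewrite mul1r.
have iq k : intg (Dq k) by exact: (@integrable_bounded _ _ _ _ (2 * K)).
rewrite -expectation_sum// -[leRHS](expectation_cst P); apply: expectation_le.
- exact: integrable_sum_EFin.
- exact: (@integrable_bounded _ _ _ _ `|K|).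
- move=> w; rewrite (le_trans (sum_bracket n w))// (le_trans (ler_norm _))//.
  by rewrite (bb_qbounded bb)// T0 lexx.
Qed.

(** The bound does not depend on [n]: sums of squared increments are bounded in L^2 however fine the
    partition, which is what makes the remainder vanish later. In the constant, [2 * K] bounds twice
    the total bracket, [(2 * K) ^+ 2] the largest squared increment, and the last [K] the
    expectation of [V n]. *)
Lemma expectation_sum_sqr_sqr n : EE (fun w => V n w ^+ 2) <= (2 * K + (2 * K) ^+ 2) * K.
Proof.
have mVf k : measurable_fun [set: Omega] (V k).
  by apply: (measurable_wrt_fun (@Fm k)); exact: mV.
have iVD k : intg (fun w => V k w * D k w ^+ 2).
  by apply: (intM (L := (2 * K) ^+ 2 *+ k) (L' := (2 * K) ^+ 2)) => //; exact: measurable_funX.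
have iVq k : intg (fun w => V k w * Dq k w).
  by apply: (intM (L := (2 * K) ^+ 2 *+ k) (L' := (2 * K))).
have iD2 k : intg (fun w => D k w ^+ 2).
  by apply: (@integrable_bounded _ _ _ _ ((2 * K) ^+ 2)) => //; exact: measurable_funX.
have iV2 k : intg (fun w => V k w ^+ 2).
  apply: (@integrable_bounded _ _ _ _ (((2 * K) ^+ 2 *+ k) ^+ 2)).
    exact: measurable_funX.
  by move=> w; rewrite normrX lerXn2r ?nnegrE ?VK// (le_trans _ (VK k w)).
have iV k : intg (V k) by exact: (@integrable_bounded _ _ _ _ ((2 * K) ^+ 2 *+ k)).
(* Expanding [V k.+1 ^+ 2], one factor of the fourth power of [D k] is bounded by [(2 * K) ^+ 2],
   and against the weight [V k] the square of [D k] is exchanged for [Dq k]. *)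
have H k : EE (fun w => V k w ^+ 2) <=
    2 * EE (fun w => \sum_(j < k) V j w * Dq j w) + (2 * K) ^+ 2 * EE (V k).
  elim: k => [|k IH].
    rewrite (_ : (fun w => V 0 w ^+ 2) = fun=> 0) ?expectation_cst; last first.
      by apply/funext => w; rewrite /V big_ord0 expr0n.
    by rewrite addr_ge0 ?mulr_ge0 ?sqr_ge0//; apply: Rintegral_ge0 => w _ //;
      rewrite big_ord0.
  have iS j : intg (fun w => \sum_(i < j) V i w * Dq i w).
    by apply: integrable_sum_EFin => i.
  apply: (@le_trans _ _ (EE (fun w => V k w ^+ 2 +
      (2 * (V k w * D k w ^+ 2) + (2 * K) ^+ 2 * D k w ^+ 2)))).
    apply: expectation_le => //.
      apply: integrableD_EFin => //; apply: integrableD_EFin; exact: integrableZ_EFin.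
    move=> w; rewrite {1}/V big_ord_recr/= -/(V k w) sqrrD -addrA lerD2l.
    rewrite -mulr_natl lerD2l [leLHS]expr2 ler_wpM2r ?sqr_ge0//.
    by have := D2K k w; rewrite ger0_norm ?sqr_ge0.
  have iZ1 : intg (fun w => 2 * (V k w * D k w ^+ 2)) by exact: integrableZ_EFin.
  have iZ2 : intg (fun w => (2 * K) ^+ 2 * D k w ^+ 2) by exact: integrableZ_EFin.
  rewrite expectation_add//; last exact: integrableD_EFin.
  rewrite expectation_add// !expectation_scale//.
  rewrite (bracket_sqr (@mV k) (VK k)).
  under [X in _ <= 2 * Rintegral _ _ X + _]eq_fun do rewrite big_ord_recr/=.
  rewrite expectation_add//; last exact: iS.
  have -> : EE (V k.+1) = EE (V k) + EE (fun w => D k w ^+ 2).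
    by rewrite -expectation_add//; congr (Rintegral _ _ _); apply/funext => w;
      rewrite /V big_ord_recr.
  by rewrite !mulrDr; lra.
apply: (le_trans (H n)).
have h1 : EE (fun w => \sum_(j < n) V j w * Dq j w) <= K * EE (V n).
  rewrite -expectation_scale//; apply: expectation_le.
  - by apply: integrable_sum_EFin => i.
  - exact: integrableZ_EFin.
  move=> w; apply: (@le_trans _ _ (\sum_(j < n) V n w * Dq j w)).
    apply: ler_sum => j _; rewrite ler_wpM2r//.
    have Vnd : {homo V ^~ w : i j / (i <= j)%N >-> i <= j}.
      apply: homo_leq => [x //|x y z|k]; first exact: le_trans.
      by rewrite /V big_ord_recr lerDl sqr_ge0.
    exact/Vnd/ltnW.
  rewrite -mulr_sumr mulrC ler_wpM2r// (le_trans (sum_bracket n w))//.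
  by rewrite (le_trans (ler_norm _))// (bb_qbounded bb)// T0 lexx.
have h2 := expectation_sum_sqr n.
have h3 : 0 <= EE (V n) by apply: Rintegral_ge0 => w _; exact: V_ge0.
rewrite (le_trans (lerD (ler_wpM2l (ler0n R 2) h1) (lexx _)))//.
by rewrite mulrA -mulrDl ler_wpM2l// addr_ge0 ?sqr_ge0// mulr_ge0.
Qed.


Variables (c : nat -> R) (cc p : R).
Hypotheses (c_le : forall k, `|c k| <= cc) (p2 : 2 < p).

Let f k w : R := \sum_(i < k) c i * D i w.
Let s w k : R := `|f k w|.
Let b n w : R := running_max (s w) n.

Let cc0 : 0 <= cc. Proof. exact: le_trans (c_le 0). Qed.

Let mf k : measurable_wrt (F (u k)) (f k).
Proof.
elim: k => [|k IH].
  by rewrite /f; under eq_fun do rewrite big_ord0; exact: measurable_wrt_cst.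
rewrite /f; under eq_fun do rewrite big_ord_recr/=.
apply: measurable_wrtD => //; first exact: (measurable_wrtS (@FS k)).
apply: measurable_wrtM => //; first exact: measurable_wrt_cst.
by apply: increment_wrt; exact: (bb_adapted bb).
Qed.

Let mfO k : measurable_fun [set: Omega] (f k).
Proof. by apply: (measurable_wrt_fun (@Fm k)); exact: mf. Qed.

Let L k : R := (cc * (2 * K)) *+ k.

Let fL k w : `|f k w| <= L k.
Proof.
rewrite /L (le_trans (ler_norm_sum _ _ _))// -[X in _ <= _ *+ X]card_ord -sumr_const.
by apply: ler_sum => i _; rewrite normrM ler_pM.
Qed.

Let L_le (k n : nat) : (k <= n)%N -> L k <= L n.
Proof. by move=> kn; rewrite ler_wpMn2l// mulr_ge0// mulr_ge0. Qed.

Let mpow (g : Omega -> R) (r : R) : measurable_fun [set: Omega] g ->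
  measurable_fun [set: Omega] (fun w => g w `^ r : R).
Proof. by move=> mg; apply: (@measurableT_comp _ _ _ _ _ _ (@powR R ^~ r)). Qed.

Let mnorm (g : Omega -> R) : measurable_fun [set: Omega] g ->
  measurable_fun [set: Omega] (fun w => `|g w|).
Proof. by move=> mg; apply: measurableT_comp. Qed.

Let ipow (g : Omega -> R) r C : 0 <= r -> measurable_fun [set: Omega] g ->
  (forall w, 0 <= g w <= C) -> intg (fun w => g w `^ r).
Proof.
move=> r0 mg gC; apply: (@integrable_bounded _ _ _ _ (C `^ r)); first exact: mpow.
by move=> w; have /andP[? ?] := gC w; rewrite ger0_norm ?powR_ge0// le_powR.
Qed.

Let ifpow k r : 0 <= r -> intg (fun w => `|f k w| `^ r).
Proof. by move=> r0; apply: (@ipow _ _ (L k)) => // [|w]; [exact: mnorm|rewrite normr_ge0 fL]. Qed.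

Let iDpow k r : 0 <= r -> intg (fun w => `|D k w| `^ r).
Proof. by move=> r0; apply: (@ipow _ _ (2 * K)) => // [|w]; [exact: mnorm|rewrite normr_ge0 DK]. Qed.

Let ifi k : intg (f k).
Proof. exact: (@integrable_bounded _ _ _ _ (L k)). Qed.

Let iDi k : intg (D k).
Proof. exact: (@integrable_bounded _ _ _ _ (2 * K)). Qed.

Lemma transform_condexp k : is_condexp P (F (u k)) (f k.+1) (f k).
Proof.
split; [exact: ifi|exact: mf|move=> B FB].
have mB : measurable B := Fm FB.
have h j : P.-integrable B (EFin \o f j).
  by apply: integrableS (ifi j).
have hD : P.-integrable B (EFin \o D k) by apply: integrableS (iDi k).
have E : (\int[P]_(w in B) (D k w)%:E = 0)%E.
  rewrite -(fineK (integrable_fin_num mB hD)); congr EFin.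
  have /andP[? ?] := uT k; have /andP[? ?] := uT k.+1.
  have := bb_martingale bb; move=> /(_ (u k) (u k.+1) B); rewrite expectation_indic//.
  by apply.
transitivity (\int[P]_(w in B) ((f k w)%:E + (c k)%:E * (D k w)%:E))%E.
  rewrite integralD//; [|exact: h|exact: integrableZl].
  by rewrite integralZl// E mule0 adde0.
by apply: eq_integral => w _; rewrite /f big_ord_recr.
Qed.

Let mb n : measurable_fun [set: Omega] (b n).
Proof. by elim: n => [|n IH]; apply: measurable_maxr => //; exact: mnorm. Qed.

Let bL n w : 0 <= b n w <= L n.
Proof.
rewrite running_max_ge0/=; apply: running_max_le.
  exact: le_trans (normr_ge0 _) (fL n w).
by move=> k kn; rewrite /s (le_trans (fL _ _))// L_le.
Qed.

Let doob_b n : EE (fun w => b n w `^ p) <= doob_cst p * EE (fun w => `|f n w| `^ p).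
Proof.
have p1 : 1 < p by have h := p2; lra.
have p0 : 0 <= p by lra.
have Gle k : F (u k) `<=` F (u k.+1) by exact: FS.
have := doob_discrete sF Fm Gle (fun k (_ : (k < n)%N) => transform_condexp k) (ifi n) p1.
have ib : intg (fun w => b n w `^ p) by exact: ipow (bL n).
by rewrite -!EFin_expectation ?ifpow// -EFinM lee_fin.
Qed.

(** In the expansion of [|f k + c k * D k|^p] the first-order term has expectation 0, its weight
    being known at [u k]; in the second-order term [bracket_sqr] exchanges the squared increment for
    [Dq k]. *)
Let step k : EE (fun w => `|f k.+1 w| `^ p) <= EE (fun w => `|f k w| `^ p) +
  taylor_cst p * (cc ^+ 2 * EE (fun w => `|f k w| `^ (p - 2) * Dq k w) +
                  cc `^ p * EE (fun w => `|D k w| `^ p)).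
Proof.
have p2' : 2 < p := p2; have p0 : 0 <= p by lra.
have mfp r : measurable_wrt (F (u k)) (fun w => `|f k w| `^ r).
  apply: (measurable_wrt_comp (sF k) (g := fun x => `|x| `^ r)) => //.
  apply: (@measurableT_comp _ _ _ _ _ _ (@powR R ^~ r)) => //.
have fpL r w : 0 <= r -> `| `|f k w| `^ r | <= L k `^ r.
  by move=> r0; rewrite ger0_norm ?powR_ge0// le_powR.
have p20 : 0 <= p - 2 by lra.
have E1 : EE (fun w => (c k * spowR (p - 1) (f k w)) * D k w) = 0.
  apply: (bracket_orthogonal (L := cc * L k `^ (p - 1))).
    apply: measurable_wrtM => //; first exact: measurable_wrt_cst.
    by apply: (measurable_wrt_comp (sF k) (g := spowR (p - 1))) => //; exact: measurable_spowR.
  move=> w; rewrite normrM ler_pM// norm_spowR ?le_powR//; lra.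
have i1 : intg (fun w => (c k * spowR (p - 1) (f k w)) * D k w).
  apply: (@integrable_boundedM _ _ _ _ (cc * L k `^ (p - 1))) => //.
    apply: measurable_funM => //; apply: (@measurableT_comp _ _ _ _ _ _ (spowR (p - 1))) => //.
    exact: measurable_spowR.
  move=> w; rewrite normrM ler_pM// norm_spowR ?le_powR//; lra.
have i2 : intg (fun w => `|f k w| `^ (p - 2) * D k w ^+ 2).
  apply: (intM (L := L k `^ (p - 2)) (L' := (2 * K) ^+ 2)) => //.
  - exact/mpow/mnorm.
  - by move=> w; exact: fpL.
  - exact: measurable_funX.
rewrite -(bracket_sqr (mfp (p - 2)) (fun w => fpL (p - 2) w p20)).
have Z1 : intg (fun w => cc ^+ 2 * (`|f k w| `^ (p - 2) * D k w ^+ 2)) by exact: integrableZ_EFin.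
have Z2 : intg (fun w => cc `^ p * `|D k w| `^ p) by exact/integrableZ_EFin/iDpow.
have Z12 := integrableD_EFin Z1 Z2.
have Z3 := integrableZ_EFin (taylor_cst p) Z12.
have Z4 := integrableZ_EFin p i1.
have Z5 := ifpow k p0.
apply: (@le_trans _ _ (EE (fun w => `|f k w| `^ p +
    (p * (c k * spowR (p - 1) (f k w) * D k w) +
    taylor_cst p * (cc ^+ 2 * (`|f k w| `^ (p - 2) * D k w ^+ 2) +
      cc `^ p * `|D k w| `^ p))))); last first.
  rewrite expectation_add//; last exact: integrableD_EFin.
  rewrite expectation_add// !expectation_scale// E1 mulr0 add0r.
  by rewrite expectation_add// !expectation_scale ?iDpow.
apply: expectation_le; [exact: ifpow| |].
  by apply: integrableD_EFin => //; exact: integrableD_EFin.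
move=> w; rewrite /f big_ord_recr/= -/(f k w).
apply: (le_trans (powR_taylor (f k w) (c k * D k w) p2')).
rewrite -addrA lerD2l; apply: lerD; first by rewrite le_eqVlt; apply/orP; left; apply/eqP; ring.
rewrite ler_wpM2l ?(ltW (taylor_cst_gt0 p2'))//; apply: lerD.
  rewrite exprMn mulrCA; apply: ler_wpM2r.
    by apply: mulr_ge0; [exact: powR_ge0|exact: sqr_ge0].
  by rewrite -[c k ^+ 2]real_normK ?num_real// lerXn2r ?nnegrE.
by rewrite normrM powRM// ler_wpM2r ?powR_ge0// le_powR.
Qed.

(* With this weight in Young's inequality the term carrying the p-th moment of
   the running maximum of the transform has coefficient 1/2 and is absorbed. *)
Definition bdg_scale (p : R) : R := Num.sqrt ((2 * taylor_cst p * doob_cst p)^-1).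

(** The factor [2 * taylor_cst p] remains once half of the moment has been absorbed. The power of
    [bdg_scale p] is the Young weight of the bracket term and 1 that of the remainder; their sum
    covers both. *)
Definition bdg_cst (p : R) : R := 2 * taylor_cst p * (bdg_scale p `^ (- (p - 2)) + 1).

(** After summation of the one-step bounds, each [|f k|^(p-2)] is replaced by the power of the
    running maximum, so that the increments of [q] add up to at most [q T]. Young's inequality with
    exponents [p - 2] and [2] separates the two, and Doob's inequality returns the maximum to the
    final value. *)
Lemma bdg_partition n :
  EE (fun w => `|f n w| `^ p) <= bdg_cst p * cc `^ p *
    (EE (fun w => Num.sqrt (q T w) `^ p) + \sum_(k < n) EE (fun w => `|D k w| `^ p)).
Proof.
have p2' : 2 < p := p2; have p0 : 0 <= p by lra.
have p20 : 0 <= p - 2 by lra.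
set C := taylor_cst p; set Dp := doob_cst p; set eta := bdg_scale p.
have C0 : 0 < C by exact: taylor_cst_gt0.
have Dp0 : 0 < Dp by apply: doob_cst_gt0; lra.
have eta0 : 0 < eta by rewrite sqrtr_gt0 invr_gt0 mulr_gt0// mulr_gt0.
(* The identity that determines [bdg_scale]: the Taylor, Young and Doob factors multiply to one
   half. *)
have eta2 : C * eta `^ 2 * Dp = 2^-1.
  rewrite powR_mulrn ?sqrtr_ge0// sqr_sqrtr.
    by rewrite -/C -/Dp; field; rewrite !gt_eqF.
  by rewrite invr_ge0 mulr_ge0 ?(ltW Dp0)// mulr_ge0// ltW.
have TT : 0 <= T <= T by rewrite T0 lexx.
have mqT : measurable_fun [set: Omega] (q T).
  by apply: (measurable_wrt_fun (filtration_measurable filF TT)); exact: (bb_qadapted bb).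
have q0 w : 0 <= q T w by rewrite -(bb_q0 bb w) (bb_qnd bb).
have isq r : 0 <= r -> intg (fun w => Num.sqrt (q T w) `^ r).
  move=> r0; apply: (@ipow _ _ (Num.sqrt K)) => // [|w].
    apply: (measurableT_comp _ mqT).
    by apply: continuous_measurable_fun; exact: sqrt_continuous.
  by rewrite sqrtr_ge0 ler_sqrt// (le_trans (ler_norm _))// (bb_qbounded bb).
pose e k := EE (fun w => `|f k w| `^ (p - 2) * Dq k w).
pose g k := EE (fun w => `|D k w| `^ p).
have sum_step : EE (fun w => `|f n w| `^ p) <=
    C * (cc ^+ 2 * \sum_(k < n) e k + cc `^ p * \sum_(k < n) g k).
  elim: n => [|n IH].
    rewrite !big_ord0 !mulr0 addr0 mulr0 (_ : (fun w => _) = fun=> 0) ?expectation_cst//.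
    by apply/funext => w; rewrite /f big_ord0 normr0 powR0// gt_eqF//; lra.
  apply: (le_trans (step n)); rewrite !big_ord_recr/= -/(e n) -/(g n) -/C.
  by move: IH; move: (\sum_(k < n) e k) (\sum_(k < n) g k) (e n) (g n) (EE _) => *; lra.
have iq k : intg (fun w => `|f k w| `^ (p - 2) * Dq k w).
  apply: (intM (L := L k `^ (p - 2)) (L' := 2 * K)) => //.
    exact/mpow/mnorm.
  by move=> w; rewrite ger0_norm ?powR_ge0// le_powR.
have ib : intg (fun w => b n w `^ p) by exact: ipow (bL n).
have ibq : intg (fun w => b n w `^ (p - 2) * q T w).
  apply: (intM (L := L n `^ (p - 2)) (L' := K)) => //; first exact: mpow.
    by move=> w; have /andP[? ?] := bL n w; rewrite ger0_norm ?powR_ge0// le_powR.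
  by move=> w; exact: (bb_qbounded bb).
have sum_e : \sum_(k < n) e k <= EE (fun w => b n w `^ (p - 2) * q T w).
  rewrite -expectation_sum//; apply: expectation_le => //.
    exact: integrable_sum_EFin.
  move=> w; apply: (@le_trans _ _ (\sum_(k < n) b n w `^ (p - 2) * Dq k w)).
    apply: ler_sum => k _; rewrite ler_wpM2r// le_powR//.
    exact: (running_max_ge (s w) (ltnW (ltn_ord k))).
  by rewrite -mulr_sumr ler_wpM2l ?powR_ge0// sum_bracket.
have young : cc ^+ 2 * EE (fun w => b n w `^ (p - 2) * q T w) <=
    eta `^ 2 * EE (fun w => b n w `^ p) +
    eta `^ (- (p - 2)) * (cc `^ p * EE (fun w => Num.sqrt (q T w) `^ p)).
  rewrite -!expectation_scale ?isq//; last exact/integrableZ_EFin/isq.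
  rewrite -expectation_add; [|exact: integrableZ_EFin|exact/integrableZ_EFin/integrableZ_EFin/isq].
  apply: expectation_le; first exact: integrableZ_EFin.
    apply: integrableD_EFin; first exact: integrableZ_EFin.
    exact/integrableZ_EFin/integrableZ_EFin/isq.
  move=> w; have /andP[b0 _] := bL n w.
  have := young_powR eta0 b0 (mulr_ge0 cc0 (sqrtr_ge0 (q T w))) p20 (ltr0n R 2).
  rewrite subrK [(cc * _) `^ 2%:R]powR_mulrn ?mulr_ge0 ?sqrtr_ge0// exprMn sqr_sqrtr//.
  by rewrite powRM ?sqrtr_ge0// mulrCA.
have := doob_b n; rewrite -/Dp.
have g0 : 0 <= \sum_(k < n) g k.
  by apply: sumr_ge0 => k _; apply: Rintegral_ge0 => w _; exact: powR_ge0.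
have qq0 : 0 <= EE (fun w => Num.sqrt (q T w) `^ p).
  by apply: Rintegral_ge0 => w _; exact: powR_ge0.
have ccp0 : 0 <= cc `^ p by exact: powR_ge0.
rewrite /bdg_cst -/C -/eta.
have h0 : 0 <= eta `^ (- (p - 2)) by exact: powR_ge0.
have h2 : 0 <= eta `^ 2 by exact: powR_ge0.
move: young sum_e sum_step eta2 g0 qq0 ccp0 h0 h2 => young /(ler_wpM2l (sqr_ge0 cc)).
move: young; move: (EE (fun w => `|f n w| `^ p)) (\sum_(k < n) e k) (\sum_(k < n) g k)
  (EE (fun w => b n w `^ p)) (EE (fun w => Num.sqrt (q T w) `^ p)) (EE _)
  (cc `^ p) (eta `^ (- (p - 2))) (eta `^ 2) (cc ^+ 2) => X E Gs Bp Q1 Bq c1 e1 e2 c2.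
move=> y1 y2 y3 y4 g0 q10 c10 e10 e20 y5; clearbody C Dp.
have z1 : C * e2 * Bp <= 2^-1 * X.
  rewrite -y4 -[C * e2 * Dp * X]mulrA; apply: ler_wpM2l => //.
  by apply: mulr_ge0 => //; exact: ltW.
have z2 : C * (c2 * E) <= C * (e2 * Bp + e1 * (c1 * Q1)).
  by rewrite ler_wpM2l ?(ltW C0)// (le_trans y2).
have z3 : X <= 2 * C * (e1 * (c1 * Q1) + c1 * Gs).
  by move: y3 z2 z1; lra.
apply: (le_trans z3); rewrite -subr_ge0.
rewrite (_ : _ - _ = 2 * C * (c1 * Q1 + e1 * (c1 * Gs))); last by ring.
apply: mulr_ge0; first by apply: mulr_ge0 => //; exact: ltW.
by apply: addr_ge0; apply: mulr_ge0 => //; exact: mulr_ge0.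
Qed.

End bdg_partition.

Section cvg_powR.
Context {R : realType}.

Lemma cvg_norm_powR (p : R) (x : nat -> R) (y : R) : 1 < p ->
  x n @[n --> \oo] --> y -> `|x n| `^ p @[n --> \oo] --> `|y| `^ p.
Proof.
move=> p1 xy; have p0 : 0 < p by lra.
pose C := p * (`|y| + 1) `^ (p - 1).
have C0 : 0 < C by rewrite mulr_gt0// powR_gt0// ltr_wpDl.
apply/cvgrPdist_lt => e e0.
have eC : 0 < e / C by rewrite divr_gt0.
have /cvgrPdist_lt/(_ _ ltr01) h1 := xy.
have /cvgrPdist_lt/(_ _ eC) h2 := xy.
near=> n.
have x1 : `|y - x n| < 1 by near: n.
have x2 : `|y - x n| < e / C by near: n.
rewrite -(spowR_ge0 p0 (normr_ge0 y)) -(spowR_ge0 p0 (normr_ge0 (x n))).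
apply: (le_lt_trans (spowR_lipschitz _ _ p1)); rewrite !normr_id.
apply: (@le_lt_trans _ _ (C * `|y - x n|)); last by rewrite mulrC -ltr_pdivlMr.
apply: ler_pM.
- by rewrite mulr_ge0 ?powR_ge0// ltW.
- exact: normr_ge0.
- rewrite ler_wpM2l ?(ltW p0)//; apply: le_powR; [lra|by rewrite le_max normr_ge0|].
  rewrite ge_max lerDl ler01 andbT.
  rewrite -[x n](subrK y) (le_trans (ler_normD _ _))// addrC lerD2l.
  by rewrite distrC ltW.
- exact: ler_dist_dist.
Unshelve. all: by end_near. Qed.

End cvg_powR.

(** * Refining partitions *)

Section bdg_limit.
Context {d : measure_display} {Omega : measurableType d} {R : realType}.
Variables (P : probability Omega R) (T : R) (F : R -> set (set Omega)).
Hypothesis filF : is_filtration T F.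

Local Notation intg f := (P.-integrable [set: Omega] (EFin \o f)).
Local Notation EE f := (Rintegral P [set: Omega] f).

Variables (K : R) (m q : R -> Omega -> R).
Hypotheses (bb : bounded_bracket P T F K m q) (K0 : 0 <= K) (T0 : 0 <= T).
Variables (u : nat -> nat -> R) (n : nat -> nat) (hm : nat -> R).
Hypotheses (uT : forall j k, 0 <= u j k <= T) (uS : forall j k, u j k <= u j k.+1)
  (hm_mesh : forall j k, u j k.+1 - u j k <= hm j) (hm0 : hm j @[j --> \oo] --> 0).

Let D j k w : R := m (u j k.+1) w - m (u j k) w.

Let mDm j k : measurable_fun [set: Omega] (D j k).
Proof.
have mm l : measurable_fun [set: Omega] (m (u j l)).
  apply: (measurable_wrt_fun (filtration_measurable filF (uT j l))).
  exact: (bb_adapted bb).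
exact: measurable_funB.
Qed.

Let DK j k w : `|D j k w| <= 2 * K.
Proof.
rewrite (le_trans (ler_normB _ _))// (_ : 2 * K = K + K) ?lerD ?(bb_bounded bb)//.
by rewrite mulr_natl mulr2n.
Qed.

Let mpow (g : Omega -> R) r : measurable_fun [set: Omega] g ->
  measurable_fun [set: Omega] (fun w => g w `^ r : R).
Proof. by move=> mg; apply: (@measurableT_comp _ _ _ _ _ _ (@powR R ^~ r)). Qed.

(** The sum of the p-th powers is at most [U * V], with [U] the (p-2)-th power of the largest
    increment and [V] the sum of squares. [U] is bounded and tends to 0 by uniform continuity of
    each path, hence also in L^2, while [V] is bounded in L^2. *)
Lemma sum_powR_increments_cvg0 p : 2 < p ->
  \sum_(k < n j) EE (fun w => `|D j k w| `^ p) @[j --> \oo] --> (0 : R).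
Proof.
move=> p2; have p20 : 0 < p - 2 by lra.
pose M j w := running_max (fun k => `|D j k w|) (n j).
pose U j w := M j w `^ (p - 2).
pose V j w := \sum_(k < n j) D j k w ^+ 2.
have M0 j w : 0 <= M j w by exact: running_max_ge0.
have MK j w : M j w <= 2 * K by apply: running_max_le => //; rewrite mulr_ge0.
have mM j : measurable_fun [set: Omega] (M j).
  rewrite /M; elim: (n j) => [|k IH]; apply: measurable_maxr => //;
    exact: measurableT_comp.
have mU j : measurable_fun [set: Omega] (U j) by exact: mpow.
have mV j : measurable_fun [set: Omega] (V j).
  by apply: measurable_sum => k; exact: measurable_funX.
pose UK : R := (2 * K) `^ (p - 2).
have UK0 j w : 0 <= U j w <= UK.
  by rewrite powR_ge0 le_powR// ltW.
have U2K j w : `|U j w ^+ 2| <= UK ^+ 2.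
  by have /andP[a b] := UK0 j w; rewrite ger0_norm ?sqr_ge0// lerXn2r// nnegrE (le_trans a).
have V2 j : EE (fun w => V j w ^+ 2) <= (2 * K + (2 * K) ^+ 2) * K.
  exact: (expectation_sum_sqr_sqr filF bb (uT j) (uS j) K0 T0 (n j)).
pose VK j : R := \sum_(k < n j) (2 * K) ^+ 2.
have VKle j w : `|V j w| <= VK j.
  rewrite (le_trans (ler_norm_sum _ _ _))//; apply: ler_sum => k _.
  by rewrite normrX lerXn2r ?nnegrE// mulr_ge0.
have iU2 j : intg (fun w => U j w ^+ 2).
  by apply: (@integrable_bounded _ _ _ _ (UK ^+ 2)) => //; exact: measurable_funX.
have iV2 j : intg (fun w => V j w ^+ 2).
  apply: (@integrable_bounded _ _ _ _ (VK j ^+ 2)); first exact: measurable_funX.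
  by move=> w; rewrite normrX lerXn2r ?nnegrE// (le_trans _ (VKle j w)).
have iD j k : intg (fun w => `|D j k w| `^ p).
  apply: (@integrable_bounded _ _ _ _ ((2 * K) `^ p)).
    by apply: mpow; apply: measurableT_comp.
  by move=> w; rewrite ger0_norm ?powR_ge0// le_powR//; lra.
have U0 w : U j w @[j --> \oo] --> (0 : R).
  apply/cvgrPdist_le => e e0; pose eta := e `^ (p - 2)^-1.
  have eta0 : 0 < eta by exact: powR_gt0.
  have cw : continuous_path T (m ^~ w) by exact: (bb_continuous bb).
  have [del del0 hdel] := path_uniformly_continuous cw eta0.
  have /cvgrPdist_lt/(_ _ del0) := hm0; apply: filterS => j; rewrite sub0r normrN => hj.
  rewrite sub0r normrN ger0_norm ?powR_ge0//.
  have <- : eta `^ (p - 2) = e by rewrite -powRrM mulVf ?powRr1 ?(ltW e0)// gt_eqF.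
  apply: le_powR => //; first exact: ltW.
  apply: running_max_le => [|k _]; first exact: ltW.
  apply/ltW/hdel => //; rewrite ger0_norm ?subr_ge0//.
  exact: le_lt_trans (hm_mesh j k) (le_lt_trans (ler_norm _) hj).
have EU : EE (fun w => U j w ^+ 2) @[j --> \oo] --> (0 : R).
  have [||||| _] := @expectation_cvg _ _ _ P (fun j w => U j w ^+ 2) (fun=> 0) (fun=> UK ^+ 2).
  - by move=> j; exact: measurable_funX.
  - exact: measurable_cst.
  - by apply: (@integrable_bounded _ _ _ _ (`|UK ^+ 2|)).
  - by [].
  - by apply: aeW => w; rewrite -(mulr0 (0 : R)); exact: (cvgM (U0 w) (U0 w)).
  by rewrite expectation_cst.
pose CV : R := (2 * K + (2 * K) ^+ 2) * K + 1.
have CV0 : 0 < CV by rewrite ltr_wpDl// mulr_ge0 ?addr_ge0 ?sqr_ge0 ?mulr_ge0.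
apply/cvgrPdist_le => e e0.
(* From [U * V <= del * V^2 + U^2 / del]: this [del] makes the first term contribute at most
   [e / 2], and the second does so as soon as the second moment of [U] is below [del * (e / 2)]. *)
pose del := e / (2 * CV).
have del0 : 0 < del by rewrite divr_gt0// mulr_gt0.
have de : 0 < del * (e / 2) by rewrite mulr_gt0// divr_gt0.
have /cvgrPdist_le/(_ _ de) := EU; apply: filterS => j.
rewrite !sub0r !normrN; have EU0 : 0 <= EE (fun w => U j w ^+ 2).
  by apply: Rintegral_ge0 => w _; exact: sqr_ge0.
rewrite (ger0_norm EU0) ger0_norm; last first.
  by apply: sumr_ge0 => k _; apply: Rintegral_ge0 => w _; exact: powR_ge0.
move=> hU; rewrite -expectation_sum//.
apply: (@le_trans _ _ (EE (fun w => del * V j w ^+ 2 + del^-1 * U j w ^+ 2))).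
  apply: expectation_le.
  - exact: integrable_sum_EFin.
  - by apply: integrableD_EFin; exact: integrableZ_EFin.
  move=> w; apply: (@le_trans _ _ (U j w * V j w)).
    rewrite mulr_sumr; apply: ler_sum => k _.
    have -> : `|D j k w| `^ p = `|D j k w| `^ (p - 2) * D j k w ^+ 2.
      rewrite -[D j k w ^+ 2]sqr_powR2 -powRD; first by rewrite subrK.
      by rewrite subrK (_ : p == 0 = false)//; apply/negP => /eqP; lra.
    apply: ler_wpM2r; first exact: sqr_ge0.
    apply: le_powR => //; first exact: ltW.
    exact: (running_max_ge (fun k => `|D j k w|) (ltnW (ltn_ord k))).
  rewrite -subr_ge0; have -> : del * V j w ^+ 2 + del^-1 * U j w ^+ 2 - U j w * V j w =
      del^-1 * ((del * V j w - U j w / 2) ^+ 2 + 3 / 4 * U j w ^+ 2).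
    by field; rewrite gt_eqF.
  apply: mulr_ge0; first by rewrite invr_ge0 ltW.
  by apply: addr_ge0; [exact: sqr_ge0|apply: mulr_ge0; [lra|exact: sqr_ge0]].
rewrite expectation_add; [|exact: integrableZ_EFin|exact: integrableZ_EFin].
rewrite !expectation_scale//.
have h1 : del * EE (fun w => V j w ^+ 2) <= e / 2.
  apply: (@le_trans _ _ (del * CV)).
    by rewrite ler_wpM2l ?(ltW del0)// (le_trans (V2 j))// /CV lerDl.
  by rewrite /del le_eqVlt; apply/orP; left; apply/eqP; field; rewrite gt_eqF.
have h2 : del^-1 * EE (fun w => U j w ^+ 2) <= e / 2 by rewrite ler_pdivrMl.
by rewrite [leRHS]splitr lerD.
Qed.

Variables (c : nat -> nat -> R) (cc p : R) (Lm : Omega -> R).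
Hypotheses (c_le : forall j k, `|c j k| <= cc) (p2 : 2 < p)
  (Lm_lim : forall w, \sum_(k < n j) c j k * D j k w @[j --> \oo] --> Lm w).

Lemma bdg_limit : (\int[P]_w (`|Lm w| `^ p)%:E <=
  (bdg_cst p * cc `^ p)%:E * \int[P]_w (Num.sqrt (q T w) `^ p)%:E)%E.
Proof.
have p2' : 2 < p := p2; have p0 : 0 <= p by lra.
have TT : 0 <= T <= T by rewrite T0 lexx.
have mqT : measurable_fun [set: Omega] (q T).
  by apply: (measurable_wrt_fun (filtration_measurable filF TT)); exact: (bb_qadapted bb).
have q0 w : 0 <= q T w by rewrite -(bb_q0 bb w) (bb_qnd bb).
have isq : intg (fun w => Num.sqrt (q T w) `^ p).
  apply: (@integrable_bounded _ _ _ _ (Num.sqrt K `^ p)).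
    apply: mpow; apply: (measurableT_comp _ mqT).
    by apply: continuous_measurable_fun; exact: sqrt_continuous.
  move=> w; rewrite ger0_norm ?powR_ge0// le_powR ?sqrtr_ge0//.
  by rewrite ler_sqrt// (le_trans (ler_norm _))// (bb_qbounded bb).
set X := EE (fun w => Num.sqrt (q T w) `^ p); set B := bdg_cst p * cc `^ p.
have B0 : 0 <= B.
  rewrite mulr_ge0 ?powR_ge0// mulr_ge0 ?addr_ge0 ?powR_ge0//.
  by rewrite mulr_ge0// ltW// taylor_cst_gt0.
rewrite -(EFin_expectation isq) -EFinM; apply/lee_addgt0Pr => e e0.
have eB : 0 < e / (B + 1) by rewrite divr_gt0// ltr_wpDl.
have /cvgrPdist_le/(_ _ eB)[J _ hJ] := sum_powR_increments_cvg0 p2.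
(* Shifting the index by [J] makes the remainder small at every index, as this form of Fatou's lemma
   requires; the limit is unchanged. *)
apply: (@fatou_le_cvg _ _ _ P
  (fun i w => `|\sum_(k < n (i + J)%N) c (i + J)%N k * D (i + J)%N k w| `^ p)).
- move=> i; apply: mpow; apply: measurableT_comp => //; apply: measurable_sum => k.
  exact: measurable_funM.
- by move=> i w; exact: powR_ge0.
- by move=> w; exact: powR_ge0.
- apply: aeW => w; apply: cvg_norm_powR; first lra.
  have Lw : \sum_(k < n j) c j k * D j k w @[j --> \oo] --> Lm w by exact: Lm_lim.
  by rewrite -(cvg_shiftn J) in Lw.
move=> i; set j := (i + J)%N.
have mS : measurable_fun [set: Omega] (fun w => \sum_(k < n j) c j k * D j k w).
  by apply: measurable_sum => k; exact: measurable_funM.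
have SK w : `|\sum_(k < n j) c j k * D j k w| <= \sum_(k < n j) cc * (2 * K).
  rewrite (le_trans (ler_norm_sum _ _ _))//; apply: ler_sum => k _.
  by rewrite normrM ler_pM.
rewrite -EFin_expectation; last first.
  apply: (@integrable_bounded _ _ _ _ ((\sum_(k < n j) cc * (2 * K)) `^ p)).
    by apply: mpow; apply: measurableT_comp.
  by move=> w; rewrite ger0_norm ?powR_ge0// le_powR.
rewrite -EFinD lee_fin.
apply: (le_trans (bdg_partition filF bb (uT j) (uS j) K0 T0 (c_le j) p2 (n j))).
rewrite -/B -/X mulrDr lerD2l.
have := hJ j (leq_addl i J); rewrite /= sub0r normrN => /(le_trans (ler_norm _)) h.
apply: (le_trans (ler_wpM2l B0 h)); rewrite mulrCA ler_piMr ?(ltW e0)//.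
by rewrite ler_pdivrMr ?ltr_wpDl// mul1r lerDl.
Qed.

End bdg_limit.

(** * Localization *)

Section continuous_paths.
Context {R : realType}.
Implicit Types (f g : R -> R) (T : R).

Lemma uniformly_continuous_path f T :
  (forall e, 0 < e -> exists2 del : R, 0 < del &
    forall x y, 0 <= x <= T -> 0 <= y <= T -> `|x - y| < del -> `|f x - f y| < e) ->
  continuous_path T f.
Proof.
move=> H; apply/subspace_continuousP => x xT; apply/cvgrPdist_lt => e e0.
have [del del0 h] := H e e0; rewrite near_withinE.
apply: filterS (nbhsx_ballx x del del0) => y xy yT.
by apply: h.
Qed.

Lemma continuous_path_stopped f T (s : R) : 0 <= s -> continuous_path T f ->
  continuous_path T (fun v => f (Num.min v s)).
Proof.
move=> s0 cf; apply: uniformly_continuous_path => e e0.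
have [del del0 h] := path_uniformly_continuous cf e0; exists del => // x y xT yT xy.
have m v : 0 <= v <= T -> 0 <= Num.min v s <= T.
  by move=> /andP[v0 vT]; rewrite le_min v0 s0 ge_min vT.
apply: h; [exact: m|exact: m|]; apply: le_lt_trans xy.
by case: (leP x s) => hx; case: (leP y s) => hy //; rewrite ?subrr ?normr0//;
  rewrite ler_norml; apply/andP; split; have := ler_norm (x - y);
  have := ler_norm (y - x); rewrite [`|y - x|]distrC; lra.
Qed.

Lemma eq_continuous_path f g T : (forall v, 0 <= v <= T -> f v = g v) ->
  continuous_path T f -> continuous_path T g.
Proof.
move=> fg cf; apply: uniformly_continuous_path => e e0.
have [del del0 h] := path_uniformly_continuous cf e0; exists del => // x y xT yT xy.
by rewrite -!fg//; exact: h.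
Qed.

Lemma continuous_path_normD f g T : continuous_path T f -> continuous_path T g ->
  continuous_path T (fun v => `|f v| + g v).
Proof.
move=> cf cg; apply: uniformly_continuous_path => e e0.
have e2 : 0 < e / 2 by rewrite divr_gt0.
have [a a0 ha] := path_uniformly_continuous cf e2.
have [b b0 hb] := path_uniformly_continuous cg e2.
exists (Num.min a b) => [|x y xT yT]; first by rewrite lt_min a0.
rewrite lt_min => /andP[xa xb].
have -> : `|f x| + g x - (`|f y| + g y) = (`|f x| - `|f y|) + (g x - g y) by ring.
apply: (le_lt_trans (ler_normD _ _)); rewrite [e]splitr ltrD ?hb//.
by apply: le_lt_trans (ha _ _ xT yT xa); exact: ler_dist_dist.
Qed.

Lemma continuous_path_le f T t : t <= T -> continuous_path T f -> continuous_path t f.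
Proof.
move=> tT; apply: continuous_subspaceW => x /=; rewrite !in_itv/= => /andP[-> xt].
exact: le_trans tT.
Qed.

End continuous_paths.

(** * Hitting times and localizing sequences *)

Section hitting.
Context {d : measure_display} {Omega : measurableType d} {R : realType}.
Variables (T : R) (F : R -> set (set Omega)).
Hypotheses (filF : is_filtration T F) (T0 : 0 <= T).
Variables (Y : R -> Omega -> R) (K : R).
Hypotheses (K0 : 0 < K) (cY : forall w, continuous_path T (Y ^~ w))
  (Y0 : forall w, Y 0 w = 0) (aY : adapted T F Y).

(** The extra point [T + 1] keeps the set nonempty; it lies beyond the horizon, so a path that never
    reaches the level is not stopped on [[0, T]]. *)
Definition hitting_time w : R :=
  inf ([set v | 0 <= v <= T /\ K <= Y v w] `|` [set T + 1]).

Let S w := [set v | 0 <= v <= T /\ K <= Y v w] `|` [set T + 1].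

Let S_lb w : lbound (S w) 0.
Proof. by move=> v [[/andP[]]|->]//; rewrite addr_ge0. Qed.

Let S0 w : S w !=set0. Proof. by exists (T + 1); right. Qed.

Let infS w v : S w v -> hitting_time w <= v.
Proof. by move=> Sv; apply: ge_inf => //; exists 0 => x Sx; exact: (S_lb Sx). Qed.

Lemma hitting_ge0 w : 0 <= hitting_time w.
Proof. by apply: lb_le_inf => [|x Sx]; [exact: (S0 w)|exact: (S_lb Sx)]. Qed.

(** The infimum is attained: if [Y] stayed below [K] on [[0, t]], its maximum there would leave a
    margin, and uniform continuity would keep [Y] below [K] a little beyond [t]. *)
Lemma hitting_leP w t : 0 <= t <= T ->
  hitting_time w <= t <-> exists2 v, 0 <= v <= t & K <= Y v w.
Proof.
move=> /andP[t0 tT]; split=> [ht|[v /andP[v0 vt] KY]]; last first.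
  apply: (le_trans (infS _) vt); left; split => //.
  by rewrite v0 (le_trans vt).
apply: contrapT => nex.
have cYw : continuous_path T (Y ^~ w) by exact: cY.
have [c cI hc] := EVT_max t0 (continuous_path_le tT cYw).
rewrite in_itv/= in cI.
have Yc : Y c w < K by rewrite ltNge; apply/negP => h; apply: nex; exists c.
have g0 : 0 < K - Y c w by rewrite subr_gt0.
have [del del0 hdel] := path_uniformly_continuous cYw g0.
have : Num.min (t + del) (T + 1) <= hitting_time w.
  apply: lb_le_inf => [|v [[/andP[v0 vT] KY]|->]]; [exact: (S0 w)| |by rewrite ge_min lexx orbT].
  rewrite ge_min; apply/orP; left; rewrite leNgt; apply/negP => vt.
  have [vt'|tv] := leP v t.
    by apply: nex; exists v; rewrite ?v0.
  have := hdel v t; rewrite v0 vT t0 tT ger0_norm ?subr_ge0 ?(ltW tv)//.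
  rewrite ltrBlDl vt => /(_ isT isT isT)/(le_lt_trans (ler_norm _)).
  have := hc t; rewrite in_itv/= t0 lexx => /(_ isT).
  lra.
move=> /le_trans/(_ ht); rewrite ge_min; apply/negP; rewrite negb_or -!ltNge.
by rewrite ltrDl del0/= (le_lt_trans tT)// ltrDl.
Qed.

(** A value above [K] at [v] would by continuity persist slightly earlier, contradicting
    [v <= hitting_time]; there is room to the left because [Y] starts at 0, below [K]. *)
Lemma hitting_bound w v : 0 <= v <= T -> v <= hitting_time w -> Y v w <= K.
Proof.
move=> /andP[v0 vT] vh; rewrite leNgt; apply/negP => KY.
have cYw : continuous_path T (Y ^~ w) by exact: cY.
have g0 : 0 < Y v w - K by rewrite subr_gt0.
have [del del0 hdel] := path_uniformly_continuous cYw g0.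
have vpos : 0 < v.
  rewrite lt_neqAle v0 andbT; apply/eqP => v0'; move: KY.
  by rewrite -v0' Y0 ltNge ltW.
pose x := Num.max 0 (v - del / 2).
have x0 : 0 <= x by rewrite le_max lexx.
have xv : x < v by rewrite gt_max vpos; lra.
have xd : v - x < del by rewrite ltrBlDr -ltrBlDl lt_max; apply/orP; right; lra.
have xT : x <= T by rewrite (le_trans (ltW xv)).
have vI : 0 <= v <= T by rewrite v0.
have xI : 0 <= x <= T by rewrite x0.
have xd' : `|v - x| < del by rewrite ger0_norm// subr_ge0 ltW.
have h := le_lt_trans (ler_norm _) (hdel v x vI xI xd').
have Sx : S w x by left; split => //; apply/ltW; move: h; lra.
by have := le_trans vh (infS Sx); rewrite leNgt xv.
Qed.

Lemma hitting_gt w : (forall v, 0 <= v <= T -> Y v w < K) -> T <= hitting_time w.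
Proof.
move=> h; apply: lb_le_inf => [|v [[vT]|->]]; [exact: (S0 w)| |by rewrite lerDl].
by rewrite leNgt h.
Qed.

(** Attaining the level [K] on [[0, t]] means that every [K - j.+1%:R^-1] is exceeded at some point
    of a uniform grid: a countable combination of events known at time [t]. The converse uses that
    the maximum over [[0, t]] is attained. *)
Lemma hitting_stopping : is_stopping_time T F hitting_time.
Proof.
split=> [w|t tT]; first exact: hitting_ge0.
have /andP[t0 tT'] := tT; have sF := filtration_sigma filF tT.
have uT m k : 0 <= grid 0 t m k <= T.
  by have /andP[-> /= h] := grid_itv m k t0; exact: le_trans tT'.
rewrite (_ : mkset _ = \bigcap_j \bigcup_m \bigcup_k
    [set w | K - j.+1%:R^-1 < Y (grid 0 t m k) w]).
  apply: (sigma_algebra_bigcapT sF) => j; apply: (sigma_algebra_bigcupT sF) => m.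
  apply: (sigma_algebra_bigcupT sF) => k; apply: measurable_wrt_gt.
  apply: (measurable_wrtS (G := F (grid 0 t m k))); last exact: aY.
  have /andP[? ?] := uT m k; apply: (filtration_le filF) => //.
  by have /andP[] := grid_itv m k t0.
apply/seteqP; split=> w /=.
  move=> /(hitting_leP _ tT)[v /andP[v0 vt] KY] j _.
  have j0 : (0 : R) < j.+1%:R^-1 by rewrite invr_gt0.
  have cYw : continuous_path T (Y ^~ w) by exact: cY.
  have [del del0 hdel] := path_uniformly_continuous cYw j0.
  have /cvgrPdist_lt/(_ _ del0)[m _ hm] := grid_step_cvg0 t.
  exists m => //; exists (first_index v (grid 0 t m) m.+1) => //=.
  have := hm m (leqnn m); rewrite /= sub0r normrN => /(le_lt_trans (ler_norm _)) tm.
  have := grid_first_index_near m t0 v0; rewrite subr0 min_r// => /le_lt_trans/(_ tm).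
  move=> /hdel; rewrite v0 (le_trans vt tT') uT => /(_ isT isT).
  move=> /(le_lt_trans (ler_norm _)) h; rewrite ltrBlDr -ltrBlDl.
  by apply: le_lt_trans h; rewrite lerD2r.
move=> h; apply/(hitting_leP _ tT).
have cYw : continuous_path T (Y ^~ w) by exact: cY.
have [c cI hc] := EVT_max t0 (continuous_path_le tT' cYw).
rewrite in_itv/= in cI; exists c => //.
apply/ler_addgt0Pl => e e0.
pose j := Num.truncn e^-1.
have je : j.+1%:R^-1 < e by rewrite invf_plt ?posrE// truncnS_gt.
have [m _ [k _ /=]] := h j Logic.I; rewrite ltrBlDr => KY.
have := hc (grid 0 t m k); rewrite in_itv/= grid_itv// => /(_ isT) gc.
by rewrite addrC; apply/ltW/(lt_le_trans KY); rewrite lerD// ltW.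
Qed.

End hitting.

Lemma stopping_min {d : measure_display} {Omega : measurableType d} {R : realType}
    (T : R) (F : R -> set (set Omega)) (s t : Omega -> R) : is_filtration T F ->
  is_stopping_time T F s -> is_stopping_time T F t ->
  is_stopping_time T F (fun w => Num.min (s w) (t w)).
Proof.
move=> filF hs ht; split=> [w|v vT].
  by rewrite le_min (stopping_ge0 hs) (stopping_ge0 ht).
rewrite (_ : mkset _ = [set w | s w <= v] `|` [set w | t w <= v]).
  apply: (sigma_algebra_setU (filtration_sigma filF vT)).
    exact: (stopping_measurable hs).
  exact: (stopping_measurable ht).
by apply/seteqP; split=> w /=; rewrite ge_min; [case/orP; [left|right]|case=> ->; rewrite ?orbT].
Qed.

Section localization.
Context {d : measure_display} {Omega : measurableType d} {R : realType}.
Variables (P : probability Omega R) (T : R) (F : R -> set (set Omega)).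
Hypotheses (filF : is_filtration T F) (T0 : 0 <= T).

Local Notation intg f := (P.-integrable [set: Omega] (EFin \o f)).
Local Notation EE f := (Rintegral P [set: Omega] f).

(** The stopped process need only coincide almost surely, for all times at once, with some
    martingale. The notion therefore survives a change of the process on a null set. *)
Definition localized (X : R -> Omega -> R) := exists (tau : nat -> Omega -> R)
  (N : nat -> R -> Omega -> R),
  [/\ forall i, is_stopping_time T F (tau i),
      {ae P, forall w, \forall i \near \oo, T <= tau i w},
      forall i, is_martingale P T F (N i) &
      forall i, {ae P, forall w v, 0 <= v <= T -> N i v w = X (Num.min v (tau i w)) w}].

Variables (M Q : R -> Omega -> R).
Hypotheses (aM : adapted T F M) (aQ : adapted T F Q)
  (cM : forall w, continuous_path T (M ^~ w)) (cQ : forall w, continuous_path T (Q ^~ w))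
  (M0 : forall w, M 0 w = 0) (Q0 : forall w, Q 0 w = 0)
  (Qnd : forall w s t, 0 <= s -> s <= t -> t <= T -> Q s w <= Q t w)
  (locM : localized M) (locX : localized (fun v w => M v w ^+ 2 - Q v w)).

(** Since [sigma <= tau], stopping [N] at [sigma] is stopping [X] at [sigma]; optional stopping for
    the true martingale [N] thus transfers to [m]. *)
Lemma optional_stopping_localized (X N m : R -> Omega -> R) (tau sigma : Omega -> R) C s t B :
  is_martingale P T F N -> is_stopping_time T F tau -> is_stopping_time T F sigma ->
  (forall w, sigma w <= tau w) -> (forall w, continuous_path T (X ^~ w)) ->
  {ae P, forall w v, 0 <= v <= T -> N v w = X (Num.min v (tau w)) w} ->
  0 < C -> adapted T F m -> (forall v w, 0 <= v <= T -> `|m v w| <= C) ->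
  (forall v w, 0 <= v <= T -> m v w = X (Num.min v (sigma w)) w) ->
  0 <= s -> s <= t -> t <= T -> F s B ->
  EE (fun w => \1_B w * (m t w - m s w)) = 0.
Proof.
move=> mN st ss sle cX NX C0 am mC mX s0 le_st tT FB.
apply: (optional_stopping_bounded filF mN ss C0 mC am _ _ s0 le_st tT FB).
- apply: filterS NX => w NXw; apply: (@eq_continuous_path _ (fun v => X (Num.min v (tau w)) w)).
    by move=> v vT; rewrite NXw.
  by apply: (@continuous_path_stopped _ (X ^~ w)) => //; exact: (stopping_ge0 st).
- apply: filterS NX => w NXw v /[dup] vT /andP[v0 vT'].
  rewrite mX// NXw -?minA ?(min_l (sle w))//.
  by rewrite le_min v0 (stopping_ge0 ss)/= ge_min vT'.
Qed.

Variables (u : nat -> nat -> R) (n : nat -> nat) (hm : nat -> R)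
  (c : nat -> nat -> R) (cc p : R) (Lf : (R -> R) -> R).
Hypotheses (uT : forall j k, 0 <= u j k <= T) (uS : forall j k, u j k <= u j k.+1)
  (hm_mesh : forall j k, u j k.+1 - u j k <= hm j) (hm0 : hm j @[j --> \oo] --> 0)
  (c_le : forall j k, `|c j k| <= cc) (p2 : 2 < p)
  (Lf_lim : forall f, continuous_path T f ->
    \sum_(k < n j) c j k * (f (u j k.+1) - f (u j k)) @[j --> \oo] --> Lf f).

(** [Lf] is known only as a limit of sums that see the values on [[0, T]], and limits are unique. *)
Let Lf_eq f g : continuous_path T f -> (forall v, 0 <= v <= T -> f v = g v) -> Lf f = Lf g.
Proof.
move=> cf fg; have cg := eq_continuous_path fg cf.
have h1 := @Lf_lim _ cf; have := @Lf_lim _ cg.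
rewrite (_ : (fun j => \sum_(k < n j) c j k * (g (u j k.+1) - g (u j k))) =
  (fun j => \sum_(k < n j) c j k * (f (u j k.+1) - f (u j k)))); last first.
  by apply/funext => j; apply: eq_bigr => k _; rewrite !fg.
by move=> h2; rewrite -(cvg_lim (@Rhausdorff R) h1) -(cvg_lim (@Rhausdorff R) h2).
Qed.

(** Stopping when [|M| + Q] reaches [i.+1] bounds martingale and bracket by one constant. The
    bounded case then applies, with a right-hand side at most that for [Q T], uniformly in [i]. *)
Lemma bdg_localized : (\int[P]_w (`|Lf (M ^~ w)| `^ p)%:E <=
  (bdg_cst p * cc `^ p)%:E * \int[P]_w (Num.sqrt (Q T w) `^ p)%:E)%E.
Proof.
have [tau [N [st rt mN NM]]] := locM.
have [tau' [N' [st' rt' mN' NX]]] := locX.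
pose Y v w := `|M v w| + Q v w.
have Q_ge0 w v : 0 <= v <= T -> 0 <= Q v w.
  by move=> /andP[v0 vT]; rewrite -(Q0 w); exact: Qnd.
have cY w : continuous_path T (Y ^~ w).
  by apply: continuous_path_normD; [exact: cM|exact: cQ].
have Y0 w : Y 0 w = 0 by rewrite /Y M0 Q0 normr0 addr0.
have aY : adapted T F Y.
  move=> v vT; have sF := filtration_sigma filF vT; apply: measurable_wrtD => //.
    by apply: (measurable_wrt_comp sF (g := Num.norm)) => //; exact: aM.
  exact: aQ.
pose rho i := hitting_time T Y i.+1%:R.
have srho i : is_stopping_time T F (rho i) by exact: hitting_stopping.
(* Besides the hitting time, the minimum involves the sequences that localize [M] and [M^2 - Q], so
   that both can be stopped here. *)
pose th i w := Num.min (rho i w) (Num.min (tau i w) (tau' i w)).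
have sth i : is_stopping_time T F (th i).
  by apply: stopping_min => //; exact: stopping_min.
have th_itv i v w : 0 <= v <= T -> 0 <= Num.min v (th i w) <= T.
  by move=> /andP[v0 vT]; rewrite le_min v0 (stopping_ge0 (sth i))/= ge_min vT.
pose m i := stopped M (th i); pose q i := stopped Q (th i).
have mqY i v w : 0 <= v <= T -> `|m i v w| + q i v w <= i.+1%:R.
  move=> vT; apply: (hitting_bound T0 (ltr0Sn R i) cY Y0) (th_itv i v w vT) _.
  by rewrite ge_min; apply/orP; right; rewrite /th ge_min lexx.
have q_ge0 i v w : 0 <= v <= T -> 0 <= q i v w.
  by move=> vT; apply: Q_ge0; exact: th_itv.
have mK i v w : 0 <= v <= T -> `|m i v w| <= i.+1%:R.
  by move=> vT; apply: le_trans (mqY i v w vT); rewrite lerDl q_ge0.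
have qK i v w : 0 <= v <= T -> `|q i v w| <= i.+1%:R.
  by move=> vT; rewrite ger0_norm ?q_ge0//; apply: le_trans (mqY i v w vT); rewrite lerDr.
have am i : adapted T F (m i) by exact: stopped_adapted.
have aq i : adapted T F (q i) by exact: stopped_adapted.
have cm i w : continuous_path T (m i ^~ w).
  by apply: (@continuous_path_stopped _ (M ^~ w)) => //; exact: (stopping_ge0 (sth i)).
have i0 i : (0 : R) < i.+1%:R by [].
have cX w : continuous_path T (fun v => M v w ^+ 2 - Q v w).
  have [C C0 MC] := path_bounded T0 (@cM w).
  apply: uniformly_continuous_path => e e0.
  have e1 : 0 < e / 2 / (2 * C) by rewrite !divr_gt0// mulr_gt0.
  have e2 : 0 < e / 2 by rewrite divr_gt0.
  have [a a0 ha] := path_uniformly_continuous (@cM w) e1.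
  have [b b0 hb] := path_uniformly_continuous (@cQ w) e2.
  exists (Num.min a b) => [|x y xT yT]; first by rewrite lt_min a0.
  rewrite lt_min => /andP[xa xb].
  have -> : M x w ^+ 2 - Q x w - (M y w ^+ 2 - Q y w) =
    (M x w - M y w) * (M x w + M y w) + (Q y w - Q x w) by ring.
  apply: (le_lt_trans (ler_normD _ _)); rewrite [e]splitr ltrD//; last by rewrite distrC hb.
  rewrite normrM; apply: (@le_lt_trans _ _ (`|M x w - M y w| * (2 * C))).
    rewrite ler_wpM2l// (le_trans (ler_normD _ _))// (_ : 2 * C = C + C) ?lerD ?MC//.
    by rewrite mulr_natl mulr2n.
  by rewrite -ltr_pdivlMr ?mulr_gt0//; exact: ha.
have bb i : bounded_bracket P T F i.+1%:R (m i) (q i).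
  split => //.
  - by move=> t w; exact: mK.
  - by move=> t w; exact: qK.
  - by move=> w; rewrite /q /stopped min_l ?Q0//; exact: (stopping_ge0 (sth i)).
  - move=> w s t s0 s_le tT; apply: Qnd.
    + by rewrite le_min s0; exact: (stopping_ge0 (sth i)).
    + by rewrite le_min; apply/andP; split; rewrite ge_min ?s_le ?lexx ?orbT.
    + by rewrite ge_min tT.
  - move=> s t B s0 s_le tT FB.
    apply: (optional_stopping_localized (mN i) (st i) (sth i) _ cM (NM i) (i0 i)) => //.
    + by move=> w; rewrite /th !ge_min lexx orbT.
    + by move=> v w; exact: mK.
  - move=> s t B s0 s_le tT FB.
    have C0 : (0 : R) < i.+1%:R ^+ 2 + i.+1%:R by rewrite addr_gt0// exprn_gt0.
    apply: (optional_stopping_localized (m := fun v w => m i v w ^+ 2 - q i v w)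
      (mN' i) (st' i) (sth i) _ cX (NX i) C0) => //.
    + by move=> w; rewrite /th !ge_min lexx !orbT.
    + move=> v vT; have sF := filtration_sigma filF vT; apply: measurable_wrtB => //.
        apply: (measurable_wrt_comp sF (g := fun x : R => x ^+ 2)).
          exact: exprn_measurable.
        exact: am.
      exact: aq.
    + move=> v w vT; rewrite (le_trans (ler_normB _ _))// lerD ?qK//.
      by rewrite normrX lerXn2r ?nnegrE ?mK.
pose Lm i w := Lf (m i ^~ w).
have Lm_lim i w : \sum_(k < n j) c j k * (m i (u j k.+1) w - m i (u j k) w) @[j --> \oo] -->
    Lm i w by exact: Lf_lim.
have mLm i : measurable_fun [set: Omega] (Lm i).
  apply: (@measurable_fun_cvg _ _ _ _ (fun j w => \sum_(k < n j) c j k *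
      (m i (u j k.+1) w - m i (u j k) w))) => [j|w _]; last exact: Lm_lim.
  apply: measurable_sum => k; apply: measurable_funM => //; apply: measurable_funB;
    (apply: (filtration_measurable_fun filF (uT _ _)); exact: am).
have bound i : (\int[P]_w (`|Lm i w| `^ p)%:E <=
    (bdg_cst p * cc `^ p)%:E * \int[P]_w (Num.sqrt (Q T w) `^ p)%:E)%E.
  apply: le_trans (bdg_limit filF (bb i) (ler0n R i.+1) T0 uT uS hm_mesh hm0
    c_le p2 (Lm_lim i)) _.
  have p0 : 0 <= p by have h := p2; lra.
  apply: lee_wpmul2l.
    rewrite lee_fin mulr_ge0 ?powR_ge0// mulr_ge0 ?addr_ge0 ?powR_ge0//.
    by rewrite mulr_ge0// ltW// taylor_cst_gt0.
  apply: ge0_le_integralT => w; rewrite lee_fin ?powR_ge0// le_powR ?sqrtr_ge0//.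
  apply: ler_wsqrtr; apply: Qnd => //.
    by rewrite le_min T0; exact: (stopping_ge0 (sth i)).
  by rewrite ge_min lexx.
apply: (@fatou_le_cvg _ _ _ P (fun i w => `|Lm i w| `^ p)) bound.
- move=> i; apply: (@measurableT_comp _ _ _ _ _ _ (@powR R ^~ p)) => //.
  exact: measurableT_comp.
- by move=> i w; exact: powR_ge0.
- by move=> w; exact: powR_ge0.
(* For almost every [w] all three times eventually reach [T], the path of [|M| + Q] being bounded;
   from then on the stopped path is the path itself and the sequence is constant. *)
apply: filterS2 rt rt' => w h h'; apply: cvg_near_cst.
have [C C0 YC] := path_bounded T0 (cY w).
have h'' : \forall i \near \oo, C < i.+1%:R.
  by near=> i; rewrite (@lt_trans _ _ i%:R) ?ltr_nat//; near: i; exact: nbhs_infty_gtr.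
near=> i; congr (`| _ | `^ p); apply: Lf_eq => // v /andP[v0 vT].
rewrite /m /stopped min_l// (le_trans vT)//.
rewrite !le_min; apply/and3P; split; [|by near: i|by near: i].
apply: hitting_gt => // x xT; apply: (le_lt_trans (ler_norm _)).
by apply: (le_lt_trans (YC x xT)); near: i.
Unshelve. all: by end_near. Qed.

End localization.

(** * Completeness and versions regular for every outcome *)

Section completeness.
Context {d : measure_display} {Omega : measurableType d} {R : realType}.
Variables (P : probability Omega R) (T : R) (F : R -> set (set Omega)).
Hypotheses (filF : is_filtration T F) (usF : usual_conditions P T F) (T0 : 0 <= T).

Lemma usual_negligible B t : 0 <= t <= T -> P.-negligible B -> F t B.
Proof.
move=> /andP[t0 tT] /(usual_complete usF) FB.
by have := filtration_le filF (lexx 0) t0 tT; apply.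
Qed.

Lemma usual_ae B t : 0 <= t <= T -> {ae P, forall w, B w} -> F t B.
Proof.
move=> tT aeB; rewrite -(setCK B).
apply: (sigma_algebra_setC (filtration_sigma filF tT)).
exact: usual_negligible.
Qed.

Lemma ae_measurable B : {ae P, forall w, B w} -> measurable B.
Proof.
have tT : 0 <= (0 : R) <= T by rewrite lexx.
by move=> /(usual_ae tT); apply: (filtration_measurable filF).
Qed.

(** Where [f] and [g] differ, the preimages under [g] are negligible sets, and by completeness these
    belong to [F 0]. *)
Lemma ae_eq_measurable (f g : Omega -> R) : measurable_fun [set: Omega] f ->
  {ae P, forall w, f w = g w} -> measurable_fun [set: Omega] g.
Proof.
move=> mf fg _ B mB; rewrite setTI.
set E := [set w | f w = g w].
have mE : measurable E by exact: ae_measurable.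
have mg : measurable (g @^-1` B `&` ~` E).
  have tT : 0 <= (0 : R) <= T by rewrite lexx.
  apply: (filtration_measurable filF tT); apply: usual_negligible => //.
  by apply: negligibleS fg => w [].
rewrite (_ : g @^-1` B = (f @^-1` B `&` E) `|` (g @^-1` B `&` ~` E)).
  apply: measurableU => //; apply: measurableI => //.
  by rewrite -[X in measurable X]setTI; exact: mf.
apply/seteqP; split=> w /=; last by move=> [[fB E']|[]//]; rewrite -E'.
have [Ew|nEw] := pselect (E w); last by right.
by move=> gB; left; split => //; rewrite Ew.
Qed.

End completeness.

Section good_versions.
Context {d : measure_display} {Omega : measurableType d} {R : realType}.
Variables (P : probability Omega R) (T : R) (F : R -> set (set Omega)).
Hypotheses (filF : is_filtration T F) (usF : usual_conditions P T F) (T0 : 0 <= T).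

(** Setting the process to 0 off a set [G] of full measure preserves adaptedness, [G] being in every
    [F t] by completeness, and gives continuity for every [w] from continuity on [G]. *)
Definition restricted (G : set Omega) (X : R -> Omega -> R) : R -> Omega -> R :=
  fun v w => \1_G w * X v w.

Lemma restrictedT G X v w : G w -> restricted G X v w = X v w.
Proof. by move=> Gw; rewrite /restricted indicE mem_set// mul1r. Qed.

Lemma restrictedF G X v w : ~ G w -> restricted G X v w = 0.
Proof. by move=> Gw; rewrite /restricted indicE memNset// mul0r. Qed.

Lemma restricted_adapted (G : set Omega) X : {ae P, forall w, G w} ->
  adapted T F X -> adapted T F (restricted G X).
Proof.
move=> aeG aX t tT; apply: (measurable_wrtM (filtration_sigma filF tT)).
  apply: (measurable_wrt_indic (filtration_sigma filF tT)).
  exact: (usual_ae filF usF).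
exact: aX.
Qed.

Lemma restricted_continuous (G : set Omega) X :
  (forall w, G w -> continuous_path T (X ^~ w)) ->
  forall w, continuous_path T (restricted G X ^~ w).
Proof.
move=> cX w; have [Gw|nGw] := pselect (G w).
  by apply: eq_continuous_path (cX w Gw) => v _; rewrite restrictedT.
apply: (@eq_continuous_path _ (fun=> 0)) => [v _|]; first by rewrite restrictedF.
by move=> x; exact: cvg_cst.
Qed.

Variables (M Q : R -> Omega -> R).
Hypotheses (lM : is_local_martingale P T F M) (cM : continuous_process P T M)
  (M0 : null_at_0 P M) (qQ : is_quadratic_variation P T F M Q).

Variables (u : nat -> nat -> R) (n : nat -> nat) (hm : nat -> R)
  (c : nat -> nat -> R) (cc p : R) (Lf : (R -> R) -> R).
Hypotheses (uT : forall j k, 0 <= u j k <= T) (uS : forall j k, u j k <= u j k.+1)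
  (hm_mesh : forall j k, u j k.+1 - u j k <= hm j) (hm0 : hm j @[j --> \oo] --> 0)
  (c_le : forall j k, `|c j k| <= cc) (p2 : 2 < p)
  (Lf_lim : forall f, continuous_path T f ->
    \sum_(k < n j) c j k * (f (u j k.+1) - f (u j k)) @[j --> \oo] --> Lf f).

Lemma functional_measurable X : adapted T F X -> (forall w, continuous_path T (X ^~ w)) ->
  measurable_fun [set: Omega] (fun w => Lf (X ^~ w)).
Proof.
move=> aX cX; apply: (@measurable_fun_cvg _ _ _ _ (fun j w => \sum_(k < n j) c j k *
    (X (u j k.+1) w - X (u j k) w))) => [j|w _]; last exact: Lf_lim.
apply: measurable_sum => k; apply: measurable_funM => //; apply: measurable_funB;
  (apply: (filtration_measurable_fun filF (uT _ _)); exact: aX).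
Qed.

Lemma localized_local_martingale (G : set Omega) (X Y : R -> Omega -> R) :
  {ae P, forall w, G w} -> is_local_martingale P T F X ->
  (forall w, G w -> X 0 w = 0) -> (forall v w, G w -> Y v w = X v w) ->
  localized P T F Y.
Proof.
move=> aeG [_ _ [tau [st _ rt] mN]] X0 YX.
exists tau, (fun i t w => stopped X (tau i) t w - X 0 w); split => // i.
apply: filterS aeG => w Gw v vT; rewrite X0// subr0 /stopped YX//.
Qed.

(** The localized bound holds for the restricted versions of [M] and [Q]. Returning to the originals
    changes the left side on a null set only, and can only increase the integrand on the right. *)
Lemma bdg_local_martingale : (\int[P]_w (`|Lf (M ^~ w)| `^ p)%:E <=
  (bdg_cst p * cc `^ p)%:E * \int[P]_w (Num.sqrt (Q T w) `^ p)%:E)%E.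
Proof.
pose G := [set w | [/\ continuous_path T (M ^~ w), M 0 w = 0,
  continuous_path T (Q ^~ w), Q 0 w = 0 &
  forall s t, 0 <= s -> s <= t -> t <= T -> Q s w <= Q t w]].
have aeG : {ae P, forall w, G w}.
  have h : {ae P, forall w, continuous_path T (M ^~ w) /\ M 0 w = 0}.
    by apply: filterS2 cM M0 => w.
  by apply: filterS3 (quadratic_variation_continuous qQ) (quadratic_variation_null0 qQ)
    (filterI h (quadratic_variation_nondecreasing qQ)) => w c1 q0 [[? ?] ?]; split.
have aQ := quadratic_variation_adapted qQ.
have aM := local_martingale_adapted lM.
have cMG : forall w, continuous_path T (restricted G M ^~ w).
  by apply: restricted_continuous => w [].
have cQG : forall w, continuous_path T (restricted G Q ^~ w).
  by apply: restricted_continuous => w [].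
have aMG := restricted_adapted aeG aM; have aQG := restricted_adapted aeG aQ.
have M0G w : restricted G M 0 w = 0.
  by have [Gw|nGw] := pselect (G w); [rewrite restrictedT//; case: Gw|rewrite restrictedF].
have Q0G w : restricted G Q 0 w = 0.
  by have [Gw|nGw] := pselect (G w); [rewrite restrictedT//; case: Gw|rewrite restrictedF].
have ndG w s t : 0 <= s -> s <= t -> t <= T -> restricted G Q s w <= restricted G Q t w.
  move=> s0 st tT; have [Gw|nGw] := pselect (G w); last by rewrite !restrictedF.
  by rewrite !restrictedT//; case: Gw => _ _ _ _; apply.
have locM : localized P T F (restricted G M).
  apply: (localized_local_martingale aeG lM) => [w []//|v w Gw].
  by rewrite restrictedT.
have locX : localized P T F (fun v w => restricted G M v w ^+ 2 - restricted G Q v w).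
  apply: (localized_local_martingale aeG (quadratic_variation_lm qQ)) => [w [_ -> _ ->]|v w Gw].
    by rewrite expr0n subr0.
  by rewrite !restrictedT.
have := bdg_localized filF T0 aMG aQG cMG cQG M0G Q0G ndG locM locX uT uS hm_mesh hm0
  c_le p2 Lf_lim.
move=> H; apply: le_trans (le_trans H _).
  apply: ae_le_integral_l.
  - by move=> w; rewrite lee_fin powR_ge0.
  - by move=> w; rewrite lee_fin powR_ge0.
  - apply/measurable_EFinP; apply: (@measurableT_comp _ _ _ _ _ _ (@powR R ^~ p)) => //.
    by apply: measurableT_comp => //; exact: functional_measurable.
  - apply: filterS aeG => w Gw; rewrite lee_fin le_eqVlt; apply/orP; left; apply/eqP.
    congr (`| Lf _ | `^ p); apply/funext => v; by rewrite restrictedT.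
have p0 : 0 < p by have h := p2; lra.
apply: lee_wpmul2l.
  rewrite lee_fin mulr_ge0 ?powR_ge0// mulr_ge0 ?addr_ge0 ?powR_ge0//.
  by rewrite mulr_ge0// ltW// taylor_cst_gt0.
apply: ge0_le_integralT => w; rewrite lee_fin ?powR_ge0//.
have [Gw|nGw] := pselect (G w); first by rewrite restrictedT.
by rewrite restrictedF// sqrtr0 powR0 ?powR_ge0// gt_eqF.
Qed.

End good_versions.

(** * The gap between the time averages *)

Section riemann.
Context {R : realType}.
Local Notation mu := (@lebesgue_measure R).
Implicit Types (f : R -> R) (v : nat -> R).

Lemma Rintegral_step_error f (a b e : R) : a <= b ->
  mu.-integrable `]a, b] (EFin \o f) ->
  (forall x, a < x <= b -> `|f x - f a| <= e) ->
  `|\int[mu]_(x in `]a, b]) f x - f a * (b - a)| <= e * (b - a).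
Proof.
move=> ab fi fe.
have mE : fine (mu `]a, b]) = b - a.
  rewrite lebesgue_measure_itv/= lte_fin; case: ltP => // ba.
  by rewrite (_ : b = a) ?subrr//; apply/eqP; rewrite eq_le ba ab.
have moo : (mu `]a, b] < +oo)%E.
  by rewrite lebesgue_measure_itv/= lte_fin; case: ifP => _; rewrite ?ltry// ltry.
have ic k : mu.-integrable `]a, b] (EFin \o fun=> k : R).
  apply: measurable_bounded_integrable => //.
  exists `|k|; split; first exact: num_real.
  by move=> x kx w _ /=; rewrite ltW.
have ii : mu.-integrable `]a, b] (EFin \o (fun x => f x - f a)).
  by apply: eq_integrable (integrableB _ fi (ic (f a))).
rewrite -mE -[X in _ - X]Rintegral_cst// -RintegralB//.
apply: (le_trans (le_normr_Rintegral _ ii)) => //.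
rewrite -Rintegral_cst//; by apply: le_Rintegral => //; exact: integrable_norm.
Qed.

Lemma riemann_sum_error f T v e n : continuous_path T f -> v 0%N = 0 ->
  (forall k, v k <= v k.+1) -> (forall k, 0 <= v k <= T) ->
  (forall k x, (k < n)%N -> v k <= x <= v k.+1 -> `|f x - f (v k)| <= e) ->
  `|\int[mu]_(x in `[0, v n]) f x - \sum_(k < n) f (v k) * (v k.+1 - v k)| <= e * v n.
Proof.
move=> cf v0 vS vT; elim: n => [|n IH] fe.
  by rewrite v0 set_itv1 Rintegral_set1 big_ord0 subrr normr0 mulr0.
have int b : b <= T -> mu.-integrable `[0, b] (EFin \o f).
  move=> bT; apply: continuous_compact_integrable; first exact: segment_compact.
  exact: continuous_path_le cf.
have /andP[vn0 vnT] := vT n; have /andP[vS0 vST] := vT n.+1.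
have E := @Rintegral_itvB _ f (BLeft 0) (BRight (v n.+1)) (v n) (int _ vST).
rewrite !bnd_simp in E; have {}E := E vn0 (vS n).
have IH' := IH (fun k x kn => fe k x (ltnW kn : (k < n.+1)%N)).
have st : `|\int[mu]_(x in `]v n, v n.+1]) f x - f (v n) * (v n.+1 - v n)|
    <= e * (v n.+1 - v n).
  apply: Rintegral_step_error => //.
    apply: integrableS (int _ vST) => // x /=; rewrite !in_itv/= => /andP[a ->].
    by rewrite (le_trans vn0 (ltW a)).
  by move=> x /andP[a b]; apply: fe => //; rewrite (ltW a).
rewrite big_ord_recr/=.
have -> : \int[mu]_(x in `[0, v n.+1]) f x =
    \int[mu]_(x in `[0, v n]) f x + \int[mu]_(x in `]v n, v n.+1]) f x.
  by rewrite -E addrC subrK.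
move: IH' st; set I1 := Rintegral _ _ _; set I2 := Rintegral _ _ _; set S := \sum_(_ < _) _.
move=> IH' st; have -> : I1 + I2 - (S + f (v n) * (v n.+1 - v n)) =
  (I1 - S) + (I2 - f (v n) * (v n.+1 - v n)) by ring.
apply: (le_trans (ler_normD _ _)); apply: (le_trans (lerD IH' st)).
by rewrite -mulrDr addrC subrK.
Qed.

Lemma riemann_sum_cvg f T (v : nat -> nat -> R) (n : nat -> nat) (hm : nat -> R) :
  0 <= T -> continuous_path T f -> (forall m, v m 0%N = 0) -> (forall m, v m (n m) = T) ->
  (forall m k, v m k <= v m k.+1) -> (forall m k, 0 <= v m k <= T) ->
  (forall m k, v m k.+1 - v m k <= hm m) -> hm m @[m --> \oo] --> 0 ->
  \sum_(k < n m) f (v m k) * (v m k.+1 - v m k) @[m --> \oo] -->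
    \int[mu]_(x in `[0, T]) f x.
Proof.
move=> T0 cf v0 vn vS vT vh hm0; apply/cvgrPdist_le => e e0.
have eT : 0 < e / (T + 1) by rewrite divr_gt0// ltr_wpDl.
have [del del0 hdel] := path_uniformly_continuous cf eT.
have /cvgrPdist_lt/(_ _ del0) := hm0; apply: filterS => m.
rewrite sub0r normrN => hmd; rewrite -(vn m).
apply: (le_trans (@riemann_sum_error f T (v m) (e / (T + 1)) (n m) cf (v0 m) (vS m) (vT m) _)).
  move=> k x _ /andP[vx xv]; have /andP[a b] := vT m k; have /andP[a' b'] := vT m k.+1.
  apply/ltW/hdel; rewrite ?a// ?(le_trans a vx)/= ?(le_trans xv)//.
  rewrite ger0_norm ?subr_ge0//; apply: le_lt_trans hmd; apply: le_trans (ler_norm _).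
  by apply: le_trans (vh m k); rewrite lerD2r.
by rewrite vn mulrAC ler_pdivrMr ?ltr_wpDl// ler_wpM2l ?(ltW e0)// lerDl.
Qed.

End riemann.

(** * Summation by parts and refined monitoring grids *)

Section functional.
Context {R : realType}.
Implicit Types (f x y : R -> R).

Lemma summation_by_parts (x y : nat -> R) n :
  \sum_(k < n) x k.+1 * (y k.+1 - y k) =
  x n * y n - x 0%N * y 0%N - \sum_(k < n) y k * (x k.+1 - x k).
Proof.
elim: n => [|n IH]; first by rewrite !big_ord0 subrr subr0.
by rewrite !big_ord_recr/= IH; ring.
Qed.

Variables (T : R) (N : nat) (t : nat -> R).
Hypotheses (T0 : 0 < T) (N0 : (0 < N)%N) (gt : is_monitoring_grid T N t).

Let t0 : t 0%N = 0. Proof. exact: grid_first gt. Qed.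
Let tN : t N = T. Proof. exact: grid_last gt. Qed.

Lemma monitoring_grid_le i j : (i <= j)%N -> (j <= N)%N -> t i <= t j.
Proof.
elim: j => [|j IH]; first by rewrite leqn0 => /eqP ->.
rewrite leq_eqVlt => /predU1P[->//|ij] jN.
by rewrite (le_trans (IH ij (ltnW jN)))// ltW// (grid_lt gt).
Qed.

Lemma monitoring_grid_itv j : (j <= N)%N -> 0 <= t j <= T.
Proof. by move=> jN; rewrite -t0 -tN !monitoring_grid_le. Qed.

Lemma mesh_ge j : (j < N)%N -> t j.+1 - t j <= mesh N t.
Proof. by move=> jN; exact: (le_bigmax 0 (fun i : 'I_N => t i.+1 - t i) (Ordinal jN)). Qed.

Lemma mesh_gt0 : 0 < mesh N t.
Proof. by apply: lt_le_trans (mesh_ge N0); rewrite subr_gt0 (grid_lt gt). Qed.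

Lemma last_weight : t N - t N.-1 <= mesh N t.
Proof. by have := @mesh_ge N.-1; rewrite prednK//; apply. Qed.

Lemma total_weightE : total_weight N t = T + (t N - t N.-1).
Proof.
rewrite /total_weight big_ord_recr/= /weight ltnn; congr (_ + _).
rewrite (eq_bigr (fun j : 'I_N => t j.+1 - t j)) => [|j _]; last by rewrite ltn_ord.
by rewrite -(big_mkord xpredT (fun j => t j.+1 - t j)) telescope_sumr// t0 tN subr0.
Qed.

Lemma last_weight_gt0 : 0 < t N - t N.-1.
Proof. by have := @grid_lt _ _ _ _ gt N.-1; rewrite prednK// leqnn subr_gt0; apply. Qed.

Lemma total_weight_gt : T < total_weight N t.
Proof. by rewrite total_weightE ltrDl last_weight_gt0. Qed.

Lemma weight_ge0 j : (j <= N)%N -> 0 <= weight N t j.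
Proof.
rewrite /weight; case: ifPn => [jN _|_ _]; last exact/ltW/last_weight_gt0.
by rewrite subr_ge0 ltW// (grid_lt gt).
Qed.

(* Applied to log S it is log G^N - log G^c. *)
Definition average_gap f : R :=
  (total_weight N t)^-1 * (\sum_(j < N.+1) weight N t j * f (t j)) -
  T^-1 * \int[lebesgue_measure]_(s in `[0, T]) f s.

(** Summation by parts leaves the boundary term [T * f T]; the additional weight at the last date
    completes it to [total_weight N t * f T], which gives [f T] with coefficient 1. *)
Lemma discrete_averageE f :
  (total_weight N t)^-1 * (\sum_(j < N.+1) weight N t j * f (t j)) =
  f T - (total_weight N t)^-1 * \sum_(j < N) t j.+1 * (f (t j.+1) - f (t j)).
Proof.
have W0 : total_weight N t != 0 by rewrite gt_eqF// (lt_trans T0 total_weight_gt).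
rewrite (summation_by_parts t (f \o t)) /= t0 mul0r subr0 tN.
rewrite big_ord_recr/= (eq_bigr (fun j : 'I_N => f (t j) * (t j.+1 - t j))); last first.
  by move=> j _; rewrite /weight ltn_ord mulrC.
rewrite /weight ltnn tN; set S := \sum_(_ < _) _.
apply: (mulfI W0); rewrite mulrBr !mulrA mulfV// !mul1r total_weightE tN.
by ring.
Qed.

(* Each monitoring interval is cut into [m.+1] pieces of equal length. *)
Definition refined m k : R :=
  let k' := minn k (N * m.+1) in
  t (k' %/ m.+1)%N + (t (k' %/ m.+1).+1 - t (k' %/ m.+1)%N) * ((k' %% m.+1)%:R / m.+1%:R).

(* The difference of the integrands against df obtained by summation by parts
   from the continuous and from the discrete average. *)
Definition refined_coef m k : R :=
  if (k < N * m.+1)%N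
  then refined m k.+1 / T - t (k %/ m.+1).+1 / total_weight N t else 0.

(** The case [i = m.+1] is included: the end of a block is the start of the next one, where the
    quotient jumps, and the two formulas agree. *)
Lemma refined_block m j i : (j < N)%N -> (i <= m.+1)%N ->
  refined m (j * m.+1 + i)%N = t j + (t j.+1 - t j) * (i%:R / m.+1%:R).
Proof.
move=> jN im; rewrite /refined (minn_idPl _); last first.
  by rewrite (leq_trans _ (leq_mul jN (leqnn m.+1)))// mulSnr leq_add2l.
move: im; rewrite leq_eqVlt => /predU1P[->|im]; last first.
  by rewrite divnMDl// divn_small// addn0 modnMDl modn_small.
by rewrite -mulSnr mulnK// modnMl mul0r mulr0 addr0 mulfV// mulr1 addrC subrK.
Qed.

Lemma refined0 m : refined m 0%N = 0.
Proof. by rewrite -[0%N]addn0 -[X in (X + _)%N](mul0n m.+1) refined_block// mul0r mulr0 addr0. Qed.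

Lemma refined_last m k : (N * m.+1 <= k)%N -> refined m k = T.
Proof. by move=> h; rewrite /refined (minn_idPr h) mulnK// modnMl mul0r mulr0 addr0. Qed.

Lemma refinedS m k : (k < N * m.+1)%N ->
  refined m k.+1 = refined m k + (t (k %/ m.+1).+1 - t (k %/ m.+1)%N) / m.+1%:R.
Proof.
move=> kN; have jN : (k %/ m.+1 < N)%N by rewrite ltn_divLR.
have im : (k %% m.+1 < m.+1)%N by rewrite ltn_mod.
have E1 := @refined_block m _ _ jN (ltnW im); rewrite -divn_eq in E1.
have E2 := @refined_block m _ _ jN im; rewrite addnS -divn_eq in E2.
by rewrite E1 E2 -(natr1 (k %% m.+1)%N) [X in _ * X]mulrDl mul1r mulrDr addrA.
Qed.

Lemma refined_step m k : 0 <= refined m k.+1 - refined m k <= mesh N t / m.+1%:R.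
Proof.
have [h|h] := leqP (N * m.+1)%N k.
  by rewrite !refined_last ?subrr ?lexx ?divr_ge0// ?(ltW mesh_gt0)// leqW.
have jN : (k %/ m.+1 < N)%N by rewrite ltn_divLR.
rewrite refinedS// addrAC subrr add0r divr_ge0//=; last first.
  by rewrite subr_ge0 ltW// (grid_lt gt).
by rewrite ler_wpM2r ?invr_ge0// mesh_ge.
Qed.

Lemma refined_le m k l : (k <= l)%N -> refined m k <= refined m l.
Proof.
apply: (homo_leq (r := fun x y : R => x <= y)) => [x //|x y z|i]; first exact: le_trans.
by have /andP[h _] := refined_step m i; rewrite -subr_ge0.
Qed.

Lemma refined_itv m k : 0 <= refined m k <= T.
Proof.
rewrite -{1}(refined0 m) refined_le//=.
have [h|h] := leqP (N * m.+1)%N k; first by rewrite refined_last.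
by rewrite -(refined_last (leqnn (N * m.+1)%N)) refined_le// ltnW.
Qed.

(** Put [j = k %/ m.+1]. The coefficient is [t j.+1 / T] times [last weight / total weight], minus
    the distance from the refined point to [t j.+1] divided by [T]. Each part is at most [mesh / T],
    for every [m]. *)
Lemma refined_coef_le m k : `|refined_coef m k| <= 2 / T * mesh N t.
Proof.
have M0 := mesh_gt0.
have Tw := total_weight_gt; have W0 : 0 < total_weight N t by exact: lt_trans Tw.
rewrite /refined_coef; case: ifPn => [kN|_]; last first.
  by rewrite normr0 mulr_ge0 ?divr_ge0// ltW.
have jN : (k %/ m.+1 < N)%N by rewrite ltn_divLR.
have im : (k %% m.+1 < m.+1)%N by rewrite ltn_mod.
have E2 := @refined_block m _ _ jN im; rewrite addnS -divn_eq in E2.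
rewrite E2; set j := (k %/ m.+1)%N; set i := (k %% m.+1).+1.
have i01 : 0 <= (i%:R / m.+1%:R : R) <= 1.
  by rewrite divr_ge0//= ler_pdivrMr// mul1r ler_nat.
have dj : 0 <= t j.+1 - t j <= mesh N t.
  by rewrite mesh_ge// andbT subr_ge0 ltW// (grid_lt gt).
have tj : 0 <= t j.+1 <= T by exact: monitoring_grid_itv.
have lw := last_weight; have lw0 := last_weight_gt0.
have -> : (t j + (t j.+1 - t j) * (i%:R / m.+1%:R)) / T - t j.+1 / total_weight N t =
    (t j.+1 / T) * ((t N - t N.-1) / total_weight N t) -
    ((t j.+1 - t j) * (1 - i%:R / m.+1%:R)) / T.
  have -> : t N - t N.-1 = total_weight N t - T by rewrite total_weightE addrAC subrr add0r.
  by field; rewrite !gt_eqF//= addrC natr1 ltr0n.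
have T0' : 0 < T := T0.
have -> : 2 / T * mesh N t = mesh N t / T + mesh N t / T.
  by field; rewrite gt_eqF.
apply: (le_trans (ler_normB _ _)); apply: lerD.
  have /andP[a b] := tj.
  rewrite ger0_norm; last by rewrite mulr_ge0// divr_ge0// ltW.
  apply: (@le_trans _ _ (1 * ((t N - t N.-1) / total_weight N t))).
    by rewrite ler_wpM2r ?divr_ge0 ?(ltW lw0) ?(ltW W0)// ler_pdivrMr// mul1r.
  rewrite mul1r ler_pM ?invr_ge0 ?(ltW lw0) ?(ltW W0)//.
  by rewrite lef_pV2 ?posrE// ltW.
have /andP[a b] := dj; have /andP[a' b'] := i01.
have x0 : 0 <= (1 - i%:R / m.+1%:R : R) by rewrite subr_ge0.
have x1 : (1 - i%:R / m.+1%:R : R) <= 1 by rewrite lerBlDr lerDl.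
rewrite ger0_norm; last by rewrite divr_ge0 ?(ltW T0')// mulr_ge0.
by rewrite ler_wpM2r ?invr_ge0 ?(ltW T0')// -[leRHS]mulr1 ler_pM.
Qed.

(** The discrete integrand is constant on each block, so the increments telescope there. *)
Lemma refined_sum_block f m J : (J <= N)%N ->
  \sum_(k < J * m.+1) t (k %/ m.+1).+1 * (f (refined m k.+1) - f (refined m k)) =
  \sum_(j < J) t j.+1 * (f (t j.+1) - f (t j)).
Proof.
elim: J => [|J IH] JN; first by rewrite mul0n !big_ord0.
rewrite mulSnr big_split_ord/= IH; last exact: ltnW.
rewrite [in RHS]big_ord_recr/=; congr (_ + _).
rewrite (eq_bigr (fun i : 'I_m.+1 => t J.+1 *
    (f (refined m (J * m.+1 + i.+1)%N) - f (refined m (J * m.+1 + i)%N)))); last first.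
  by move=> i _; rewrite divnMDl// divn_small// addn0 addnS.
rewrite -mulr_sumr; congr (_ * _).
rewrite -(big_mkord xpredT (fun i => f (refined m (J * m.+1 + i.+1)%N) -
  f (refined m (J * m.+1 + i)%N))) (telescope_sumr (fun i => f (refined m (J * m.+1 + i)%N)))//.
rewrite !refined_block// mul0r mulr0 addr0 mulfV ?pnatr_eq0// mulr1.
by rewrite [t J + _]addrC subrK.
Qed.

(** The discrete average is reproduced exactly for every [m]; only the time integral is replaced, by
    a left Riemann sum. *)
Lemma refined_sumE f m :
  \sum_(k < N * m.+1) refined_coef m k * (f (refined m k.+1) - f (refined m k)) =
  (total_weight N t)^-1 * (\sum_(j < N.+1) weight N t j * f (t j)) -
  T^-1 * \sum_(k < N * m.+1) f (refined m k) * (refined m k.+1 - refined m k).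
Proof.
rewrite discrete_averageE.
rewrite (eq_bigr (fun k : 'I_(N * m.+1) =>
  T^-1 * (refined m k.+1 * (f (refined m k.+1) - f (refined m k))) -
  (total_weight N t)^-1 * (t (k %/ m.+1).+1 * (f (refined m k.+1) - f (refined m k))))); last first.
  by move=> k _; rewrite /refined_coef ltn_ord; ring.
rewrite sumrB -!mulr_sumr refined_sum_block//.
rewrite (summation_by_parts (refined m) (f \o refined m))/= refined0 mul0r subr0 refined_last//.
by rewrite mulrBr mulrA mulVf ?gt_eqF// mul1r addrAC.
Qed.

Lemma average_gap_lim f : continuous_path T f ->
  \sum_(k < N * m.+1) refined_coef m k * (f (refined m k.+1) - f (refined m k))
    @[m --> \oo] --> average_gap f.
Proof.
move=> cf; under eq_fun do rewrite refined_sumE.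
apply: cvgB; first exact: cvg_cst.
apply: cvgM; first exact: cvg_cst.
apply: (riemann_sum_cvg (n := fun m => (N * m.+1)%N) (ltW T0) cf refined0).
- by move=> m; exact: refined_last.
- by move=> m k; exact: refined_le.
- exact: refined_itv.
- by move=> m k; have /andP[_] := refined_step m k; exact.
- exact: grid_step_cvg0.
Qed.

(** Additivity passes to the limit from the refined sums, in which [h 0] cancels because only
    increments occur. *)
Lemma average_gapD f g h : continuous_path T f -> continuous_path T g ->
  continuous_path T h ->
  (forall s, 0 <= s <= T -> h s = h 0 + f s + g s) ->
  average_gap h = average_gap f + average_gap g.
Proof.
move=> cf cg ch hE; have hh := average_gap_lim ch.
pose D x m := \sum_(k < N * m.+1) refined_coef m k * (x (refined m k.+1) - x (refined m k)).
have fg : D f m + D g m @[m --> \oo] --> average_gap f + average_gap g.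
  by apply: cvgD; exact: average_gap_lim.
rewrite -(cvg_lim (@Rhausdorff R) hh) -(cvg_lim (@Rhausdorff R) fg).
congr (lim (_ @ \oo)); apply/funext => m /=; rewrite /D -big_split/=.
apply: eq_bigr => k _; rewrite [h (refined m k.+1)]hE ?refined_itv//.
by rewrite [h (refined m k)]hE ?refined_itv//; ring.
Qed.

Lemma sum_total_variation f (v : nat -> R) n : (forall k, v k <= v k.+1) ->
  ((\sum_(k < n) `|f (v k.+1) - f (v k)|)%:E <= total_variation (v 0%N) (v n) f)%E.
Proof.
move=> vS; have v0 k : v 0%N <= v k.
  by elim: k => // k IH; exact: le_trans (vS k).
elim: n => [|n IH]; first by rewrite big_ord0 total_variationxx.
rewrite big_ord_recr/= EFinD (@total_variationD _ _ _ (v n))//.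
by apply: leeD => //; exact: total_variation_ge.
Qed.

Lemma average_gap_total_variation f : continuous_path T f ->
  (`|average_gap f|%:E <= (2 / T * mesh N t)%:E * total_variation 0 T f)%E.
Proof.
move=> cf; have T0' := T0; have M0 := mesh_gt0.
have c0 : 0 < 2 / T * mesh N t by rewrite mulr_gt0// divr_gt0.
have := total_variation_ge0 f (ltW T0).
case E : (total_variation 0 T f) => [V| |]// V0; last by rewrite gt0_muley ?lte_fin// leey.
rewrite -EFinM lee_fin.
have h : `|\sum_(k < N * m.+1) refined_coef m k * (f (refined m k.+1) - f (refined m k))|
    @[m --> \oo] --> `|average_gap f|.
  by apply: cvg_norm; exact: average_gap_lim.
rewrite -(cvg_lim (@Rhausdorff R) h); apply: limr_le.
  by apply/cvg_ex; exists `|average_gap f|.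
apply: nearW => m; apply: (le_trans (ler_norm_sum _ _ _)).
apply: (@le_trans _ _ (\sum_(k < N * m.+1) 2 / T * mesh N t *
    `|f (refined m k.+1) - f (refined m k)|)).
  by apply: ler_sum => k _; rewrite normrM ler_wpM2r// refined_coef_le.
rewrite -mulr_sumr ler_wpM2l ?(ltW c0)//.
have := @sum_total_variation f (refined m) (N * m.+1) (fun k => refined_le m (leqnSn k)).
by rewrite refined0 refined_last// E lee_fin.
Qed.

End functional.

(** * Moments of the geometric averages and of their gap *)

Section elementary.
Context {R : realType}.
Implicit Types (a b x y D q T : R).

Lemma expR_sub_le a b : `|expR a - expR b| <= `|a - b| * (expR a + expR b).
Proof.
wlog ab : a b / b <= a.
  move=> H; have /orP[/H//|/H] := le_total b a.
  by rewrite distrC [`|b - a|]distrC [expR b + _]addrC.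
rewrite !ger0_norm ?subr_ge0 ?ler_expR//.
apply: (@le_trans _ _ ((a - b) * expR a)); last first.
  by rewrite ler_wpM2l ?subr_ge0// lerDl expR_ge0.
have := expR_ge1Dx (b - a); rewrite -(ler_pM2r (expR_gt0 a)) -expRD subrK.
lra.
Qed.

(** The product of [(|a - b| / D)^q] and [(expR a + expR b)^q] is bounded by the sum of the squares.
    Dividing by [D] first isolates the factor [D^q]; [D] will be the mesh. *)
Lemma powR_expR_sub_le a b D q : 0 < D -> 0 < q ->
  `|expR a - expR b| `^ q <=
  D `^ q * (D `^ (- (2 * q)) * `|a - b| `^ (2 * q) + (expR a + expR b) `^ (2 * q)).
Proof.
move=> D0 q0; have D0' := ltW D0; have q0' := ltW q0.
set x := `|a - b|; set y := expR a + expR b.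
have y0 : 0 <= y by rewrite addr_ge0 ?expR_ge0.
have x0 : 0 <= x by exact: normr_ge0.
have xD : 0 <= x / D by rewrite divr_ge0.
apply: (@le_trans _ _ ((D * (x / D * y)) `^ q)).
  apply: le_powR => //; rewrite mulrA [D * _]mulrC mulfVK ?gt_eqF//.
  exact: expR_sub_le.
have -> : (D * (x / D * y)) `^ q = D `^ q * ((x / D) `^ q * y `^ q).
  by rewrite (powRM _ D0' (mulr_ge0 xD y0)) (powRM _ xD y0).
apply: ler_wpM2l; first exact: powR_ge0.
have sq z : 0 <= z -> z `^ (2 * q) = (z `^ q) ^+ 2.
  by move=> z0; rewrite mulrC powRrM powR_mulrn// powR_ge0.
have -> : D `^ (- (2 * q)) * x `^ (2 * q) = ((x / D) `^ q) ^+ 2.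
  have Di : 0 <= D^-1 by rewrite invr_ge0.
  rewrite -sq// (powRM _ x0 Di) mulrC; congr (_ * _).
  by rewrite -(powR_inv1 D0') -powRrM mulN1r.
rewrite sq//; move: ((x / D) `^ q) (y `^ q) (powR_ge0 (x / D) q) (powR_ge0 y q) => z t z0 t0.
nra.
Qed.

Lemma continuous_pathD (f g : R -> R) T : continuous_path T f -> continuous_path T g ->
  continuous_path T (fun v => f v + g v).
Proof. by move=> cf cg; exact: (within_continuousD cf cg). Qed.

Lemma continuous_path_cst (k : R) T : continuous_path T (fun=> k).
Proof. by move=> x; exact: cvg_cst. Qed.

Lemma grid_step_le (s t : R) m k : s <= t ->
  grid s t m k.+1 - grid s t m k <= (t - s) / m.+1%:R.
Proof.
move=> st; have [km|mk] := leqP k m; first by rewrite gridS// addrAC subrr add0r.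
have -> : grid s t m k.+1 = grid s t m k.
  by rewrite /grid (minn_idPr mk) (minn_idPr (leqW mk)).
by rewrite subrr divr_ge0// subr_ge0.
Qed.

End elementary.

Section geometric_moments.
Context {d : measure_display} {Omega : measurableType d} {R : realType}.
Variables (P : probability Omega R) (T r p : R) (F : R -> set (set Omega)).
Hypotheses (filF : is_filtration T F) (T0 : 0 <= T) (r0 : 0 <= r) (p1 : 1 < p).
Variables (S : R -> Omega -> R).
Hypotheses (aS : adapted T F S)
  (S0 : {ae P, forall w, forall u : R, 0 <= u <= T -> 0 < S u w})
  (mS : is_martingale P T F (fun u w => expR (- (r * u)) * S u w)).

Lemma process_measurable u : 0 <= u <= T -> measurable_fun [set: Omega] (S u).
Proof. by move=> uT; apply: (filtration_measurable_fun filF uT); exact: aS. Qed.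

Lemma running_max_measurable (f : nat -> Omega -> R) n :
  (forall k, measurable_fun [set: Omega] (f k)) ->
  measurable_fun [set: Omega] (fun w => running_max (fun k => f k w) n).
Proof.
by move=> mf; elim: n => [|n IH]; apply: measurable_maxr.
Qed.

(** A weighted mean of logarithms is at most the logarithm of the maximum, and each price is at most
    [expR (r * T)] times the maximum of the discounted ones. Arbitrary weights let it serve the
    monitoring grid and the Riemann sums alike. *)
Lemma geometric_average_moment (v a : nat -> R) n :
  (forall k, 0 <= v k <= T) -> (forall k, v k <= v k.+1) -> v n = T ->
  (forall k, (k <= n)%N -> 0 <= a k) -> \sum_(k < n.+1) a k = 1 ->
  (\int[P]_w (expR (\sum_(k < n.+1) a k * ln (S (v k) w)) `^ p)%:E <=
   (expR (r * T) `^ p * doob_cst p)%:E * \int[P]_w (S T w `^ p)%:E)%E.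
Proof.
move=> vT vS vn a0 a1; have p1' := p1; have p0 : 0 <= p by lra.
pose f k w := expR (- (r * v k)) * S (v k) w.
have mSv k := process_measurable (vT k).
have mf k : measurable_fun [set: Omega] (f k) by exact: measurable_funM.
have mpow (g : Omega -> R) : measurable_fun [set: Omega] g ->
    measurable_fun [set: Omega] (fun w => g w `^ p).
  by move=> mg; apply: (@measurableT_comp _ _ _ _ _ _ (@powR R ^~ p)).
have doob : (\int[P]_w (running_max (fun k => `|f k w|) n `^ p)%:E <=
    (doob_cst p)%:E * \int[P]_w (`|f n w| `^ p)%:E)%E.
  apply: (@doob_discrete _ _ _ P (fun k => F (v k))) => //.
  - by move=> k; exact: (filtration_sigma filF).
  - by move=> k; exact: (filtration_measurable filF).
  - move=> k; have /andP[? ?] := vT k; have /andP[? ?] := vT k.+1.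
    exact: (filtration_le filF).
  - move=> k _; have /andP[? ?] := vT k; have /andP[? ?] := vT k.+1.
    exact: (martingale_condexp mS).
  - exact: (martingale_integrable mS).
pose mx w := running_max (fun k => `|f k w|) n.
have mmx : measurable_fun [set: Omega] mx.
  by apply: running_max_measurable => k; exact: measurableT_comp.
apply: (@le_trans _ _ (\int[P]_w ((expR (r * T) `^ p)%:E * (mx w `^ p)%:E))%E).
  apply: ae_le_integral_l => //.
  - by move=> w; rewrite lee_fin mulr_ge0 ?powR_ge0.
  - apply: measurable_funeM; apply/measurable_EFinP; exact: mpow.
  apply: filterS S0 => w Sw; rewrite -EFinM lee_fin -powRM ?expR_ge0 ?running_max_ge0//.
  apply: le_powR; [exact: p0|exact: expR_ge0|].
  have Sle k : (k <= n)%N -> S (v k) w <= expR (r * T) * mx w.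
    move=> kn; have Sk : S (v k) w = expR (r * v k) * f k w.
      by rewrite /f mulrA -expRD subrr expR0 mul1r.
    rewrite Sk; apply: ler_pM; first exact: expR_ge0.
    - by rewrite mulr_ge0 ?expR_ge0// ltW// Sw.
    - by rewrite ler_expR ler_wpM2l//; have /andP[] := vT k.
    - exact: le_trans (ler_norm _) (running_max_ge (fun k => `|f k w|) kn).
  have mx0 : 0 < expR (r * T) * mx w by exact: lt_le_trans (Sw _ (vT 0%N)) (Sle _ (leq0n n)).
  rewrite -[leRHS]lnK ?posrE// ler_expR.
  apply: (@le_trans _ _ (\sum_(k < n.+1) a k * ln (expR (r * T) * mx w))).
    apply: ler_sum => k _; have kn : (k <= n)%N by rewrite -ltnS.
    apply: ler_wpM2l; first exact: a0.
    by rewrite ler_ln ?posrE ?Sw// Sle.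
  by rewrite -mulr_suml a1 mul1r.
have mx0 w : (0 <= (mx w `^ p)%:E)%E by exact: powR_ge0.
have mxp : measurable_fun [set: Omega] (fun w => (mx w `^ p)%:E).
  by apply/measurable_EFinP; exact: mpow.
rewrite (ge0_integralZl_EFin P measurableT (fun w _ => mx0 w) mxp (powR_ge0 _ _)).
rewrite EFinM -muleA; apply: lee_wpmul2l; first exact: powR_ge0.
apply: (le_trans doob); apply: lee_wpmul2l; first exact: ltW (doob_cst_gt0 p1).
apply: ae_le_integral_l.
- by move=> w; rewrite lee_fin powR_ge0.
- by move=> w; rewrite lee_fin powR_ge0.
- apply/measurable_EFinP; apply: mpow; apply: process_measurable.
  by rewrite T0 lexx.
apply: filterS S0 => w Sw; rewrite lee_fin; apply: le_powR => //.
have ST : 0 < S T w by apply: Sw; rewrite T0 lexx.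
rewrite /f vn normrM (gtr0_norm ST) ler_piMl ?(ltW ST)//.
by rewrite ger0_norm ?expR_ge0// expR_le1 oppr_le0 mulr_ge0.
Qed.

End geometric_moments.

Section geometric_gap.
Context {d : measure_display} {Omega : measurableType d} {R : realType}.
Variables (P : probability Omega R) (T r q : R) (F : R -> set (set Omega)).
Hypotheses (filF : is_filtration T F) (usF : usual_conditions P T F) (T0 : 0 < T)
  (r0 : 0 <= r) (q1 : 1 < q).
Variables (S A M Q : R -> Omega -> R).
Hypotheses (aS : adapted T F S)
  (S0 : {ae P, forall w, forall u : R, 0 <= u <= T -> 0 < S u w})
  (mS : is_martingale P T F (fun u w => expR (- (r * u)) * S u w))
  (ES : (\int[P]_w (S T w `^ (2 * q))%:E < +oo)%E)
  (dec : semimartingale_decomposition P T F (fun u w => ln (S u w)) A M)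
  (cA : continuous_process P T A) (cM : continuous_process P T M)
  (qQ : is_quadratic_variation P T F M Q)
  (LAQ : ('N[P]_((2 * q)%:E)[(fun w => total_variation 0 T (A ^~ w))]
     + 'N[P]_((2 * q)%:E)[(fun w => (Num.sqrt (Q T w))%:E)] < +oo)%E).

Let p : R := 2 * q.
Let p2 : 2 < p. Proof. by rewrite /p; have h := q1; lra. Qed.
Let p0 : 0 < p. Proof. by have h := p2; lra. Qed.
Let T0' : 0 <= T. Proof. exact: ltW. Qed.

Let ITV : \bar R := (\int[P]_w (total_variation 0 T (A ^~ w) `^ p))%E.
Let IQ : \bar R := (\int[P]_w (Num.sqrt (Q T w) `^ p)%:E)%E.

Let ITV_fin : (ITV < +oo)%E.
Proof.
have : ('N[P]_(p%:E)[(fun w => total_variation 0 T (A ^~ w))] < +oo)%E.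
  by apply: le_lt_trans LAQ; rewrite leeDl// Lnorm_ge0.
have /poweR_Lnorm E : p != 0 by rewrite gt_eqF.
move=> /(poweR_lty p); rewrite E; apply: le_lt_trans.
apply: ge0_le_integralT => w; first exact: poweR_ge0.
by rewrite gee0_abs// total_variation_ge0.
Qed.

Let IQ_fin : (IQ < +oo)%E.
Proof.
have : ('N[P]_(p%:E)[(fun w => (Num.sqrt (Q T w))%:E)] < +oo)%E.
  by apply: le_lt_trans LAQ; rewrite leeDr// Lnorm_ge0.
have /poweR_Lnorm E : p != 0 by rewrite gt_eqF.
move=> /(poweR_lty p); rewrite E; apply: le_lt_trans.
apply: ge0_le_integralT => w; first by rewrite lee_fin powR_ge0.
by rewrite gee0_abs ?lee_fin ?sqrtr_ge0// poweR_EFin.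
Qed.

Let fin_ITV : ITV \is a fin_num.
Proof. by rewrite ge0_fin_numE//; apply: integral_ge0 => w _; exact: poweR_ge0. Qed.

Let fin_IQ : IQ \is a fin_num.
Proof. by rewrite ge0_fin_numE//; apply: integral_ge0 => w _; rewrite lee_fin powR_ge0. Qed.

Let G : set Omega := [set w | [/\ continuous_path T (A ^~ w), continuous_path T (M ^~ w) &
  forall u, 0 <= u <= T -> ln (S u w) = ln (S 0 w) + A u w + M u w]].

Let aeG : {ae P, forall w, G w}.
Proof. by apply: filterS3 cA cM (decomposition_eq dec) => w *; split. Qed.

Let X (w : Omega) (u : R) : R := ln (S u w).

Let cX w : G w -> continuous_path T (X w).
Proof.
move=> [cAw cMw e].
apply: (@eq_continuous_path _ (fun u => (ln (S 0 w) + A u w) + M u w)).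
  by move=> u uT; rewrite /X (e u uT).
apply: continuous_pathD => //; apply: continuous_pathD => //.
exact: continuous_path_cst.
Qed.

Let aA : adapted T F A. Proof. exact: finite_variation_adapted (decomposition_fv dec). Qed.
Let aM : adapted T F M. Proof. exact: local_martingale_adapted (decomposition_lm dec). Qed.

Let A' := restricted G A.
Let M' := restricted G M.

Let cA' : forall w, continuous_path T (A' ^~ w).
Proof. by apply: restricted_continuous => w []. Qed.
Let cM' : forall w, continuous_path T (M' ^~ w).
Proof. by apply: restricted_continuous => w []. Qed.
Let aA' : adapted T F A'. Proof. exact: (restricted_adapted filF usF aeG aA). Qed.
Let aM' : adapted T F M'. Proof. exact: (restricted_adapted filF usF aeG aM). Qed.

Let mpow (g : Omega -> R) s : measurable_fun [set: Omega] g ->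
  measurable_fun [set: Omega] (fun w => g w `^ s).
Proof. by move=> mg; apply: (@measurableT_comp _ _ _ _ _ _ (@powR R ^~ s)). Qed.

Section one_grid.
Variables (N : nat) (t : nat -> R).
Hypotheses (N0 : (0 < N)%N) (gt : is_monitoring_grid T N t).

Let Lf := average_gap T N t.
Let cc : R := 2 / T * mesh N t.

Let cc0 : 0 < cc.
Proof. by rewrite mulr_gt0// ?divr_gt0// (mesh_gt0 N0 gt). Qed.

Let Lf_lim f : continuous_path T f ->
  \sum_(k < N * m.+1) refined_coef T N t m k * (f (refined N t m k.+1) - f (refined N t m k))
    @[m --> \oo] --> Lf f.
Proof. exact: average_gap_lim. Qed.

Let mgap Y : adapted T F Y -> (forall w, continuous_path T (Y ^~ w)) ->
  measurable_fun [set: Omega] (fun w => Lf (Y ^~ w)).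
Proof.
exact: (functional_measurable filF (refined_itv N0 gt) (n := fun m => (N * m.+1)%N) Lf_lim).
Qed.

Let gapE : {ae P, forall w, Lf (X w) = Lf (A' ^~ w) + Lf (M' ^~ w)}.
Proof.
apply: filterS aeG => w Gw; have [cAw cMw e] := Gw.
apply: (average_gapD T0 N0 gt) => //; first exact: cX.
by move=> s sT; rewrite /A' /M' !restrictedT// /X (e s sT).
Qed.

(** Paths of [ln S] are regular only almost surely; the gaps of the restricted versions of [A] and
    [M] are measurable, and their sum agrees with this one off a null set. *)
Lemma average_gap_measurable : measurable_fun [set: Omega] (fun w => Lf (X w)).
Proof.
apply: (ae_eq_measurable filF usF T0' (f := fun w => Lf (A' ^~ w) + Lf (M' ^~ w))).
  by apply: measurable_funD; exact: mgap.
by apply: filterS gapE => w ->.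
Qed.

(** The factor [cc] is divided out on the left, where the integrand is measurable, rather than
    pulled out of the integral of the total variation. *)
Let gapA : (\int[P]_w (`|Lf (A' ^~ w)| `^ p)%:E <= (cc `^ p)%:E * ITV)%E.
Proof.
have E w : (`|Lf (A' ^~ w)| `^ p)%:E = ((cc `^ p)%:E * ((`|Lf (A' ^~ w)| / cc) `^ p)%:E)%E.
  rewrite -EFinM -powRM ?(ltW cc0) ?divr_ge0 ?(ltW cc0)//.
  by rewrite mulrC mulfVK// gt_eqF.
have mg : measurable_fun [set: Omega] (fun w => (`|Lf (A' ^~ w)| / cc) `^ p).
  apply: mpow; apply: measurable_funM => //; apply: measurableT_comp => //.
  exact: mgap.
under eq_integral do rewrite E.
rewrite ge0_integralZl_EFin ?powR_ge0//; [|by move=> w _; rewrite lee_fin powR_ge0|exact/measurable_EFinP].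
apply: lee_wpmul2l; first by rewrite lee_fin powR_ge0.
apply: ae_le_integral_r.
- by move=> w; rewrite lee_fin powR_ge0.
- by move=> w; exact: poweR_ge0.
- exact/measurable_EFinP.
apply: filterS aeG => w Gw; have [cAw _ _] := Gw.
rewrite -poweR_EFin; apply: gt0_ler_poweR; first exact: ltW.
- by rewrite in_itv/= leey andbT lee_fin divr_ge0// ltW.
- by rewrite in_itv/= leey andbT total_variation_ge0.
have -> : A' ^~ w = A ^~ w by apply/funext => u; rewrite /A' restrictedT.
have := average_gap_total_variation T0 N0 gt cAw.
have := total_variation_ge0 (A ^~ w) T0'.
rewrite -/cc -/Lf; case: (total_variation 0 T _) => [V| |]// V0; last by rewrite leey.
by rewrite -EFinM !lee_fin ler_pdivrMr// mulrC.
Qed.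

Let gapM : (\int[P]_w (`|Lf (M' ^~ w)| `^ p)%:E <= (bdg_cst p * cc `^ p)%:E * IQ)%E.
Proof.
have := bdg_local_martingale filF usF T0' (decomposition_lm dec) cM (decomposition_lm0 dec)
  qQ (refined_itv N0 gt) (u := refined N t) (n := fun m => (N * m.+1)%N)
  (hm := fun m => mesh N t / m.+1%:R) (c := refined_coef T N t) (cc := cc) (p := p) (Lf := Lf).
move=> H; apply: le_trans (H _ _ _ _ _ _).
- apply: ae_le_integral_r.
  + by move=> w; rewrite lee_fin powR_ge0.
  + by move=> w; rewrite lee_fin powR_ge0.
  + apply/measurable_EFinP; apply: mpow; apply: measurableT_comp => //; exact: mgap.
  apply: filterS aeG => w Gw; rewrite lee_fin le_eqVlt; apply/orP; left; apply/eqP.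
  by congr (`| Lf _ | `^ p); apply/funext => u; rewrite /M' restrictedT.
- by move=> m k; exact: (refined_le N0 gt).
- by move=> m k; have /andP[] := refined_step N0 gt m k.
- exact: grid_step_cvg0.
- by move=> m k; exact: (refined_coef_le T0 N0 gt).
- exact: p2.
- exact: Lf_lim.
Qed.

Definition gap_cst : R := (2 / T) `^ p * 2 `^ p * (fine ITV + bdg_cst p * fine IQ).

Lemma average_gap_moment :
  (\int[P]_w (`|Lf (X w)| `^ p)%:E <= (mesh N t `^ p * gap_cst)%:E)%E.
Proof.
pose a w := `|Lf (A' ^~ w)| `^ p; pose b w := `|Lf (M' ^~ w)| `^ p.
have ma : measurable_fun [set: Omega] (EFin \o a).
  by apply/measurable_EFinP; apply: mpow; apply: measurableT_comp => //; exact: mgap.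
have mb : measurable_fun [set: Omega] (EFin \o b).
  by apply/measurable_EFinP; apply: mpow; apply: measurableT_comp => //; exact: mgap.
have a0 w : 0 <= a w by exact: powR_ge0.
have b0 w : 0 <= b w by exact: powR_ge0.
have mab : measurable_fun [set: Omega] (fun w => (a w)%:E + (b w)%:E)%E.
  exact: emeasurable_funD ma mb.
have ab0 w : (0 <= (a w)%:E + (b w)%:E)%E.
  by apply: adde_ge0; [exact: a0|exact: b0].
apply: (@le_trans _ _ (\int[P]_w ((2 `^ p)%:E * ((a w)%:E + (b w)%:E)))%E).
  apply: ae_le_integral_l.
  - by move=> w; rewrite lee_fin powR_ge0.
  - by move=> w; rewrite mule_ge0// lee_fin powR_ge0.
  - exact: (measurable_funeM _ mab).
  apply: filterS gapE => w E; rewrite E -EFinD -EFinM lee_fin.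
  apply: le_trans (powRD_le (ltW p0) (normr_ge0 _) (normr_ge0 _)).
  by apply: le_powR; [exact: ltW|exact: normr_ge0|exact: ler_normD].
rewrite ge0_integralZl_EFin ?powR_ge0//.
rewrite (ge0_integralD P measurableT (fun w _ => a0 w : (0 <= (a w)%:E)%E) ma
  (fun w _ => b0 w : (0 <= (b w)%:E)%E) mb).
apply: (@le_trans _ _ ((2 `^ p)%:E * ((cc `^ p)%:E * ITV + (bdg_cst p * cc `^ p)%:E * IQ))%E).
  by apply: lee_wpmul2l; [rewrite lee_fin powR_ge0|exact: leeD].
rewrite -(fineK fin_ITV) -(fineK fin_IQ) -!EFinM lee_fin /gap_cst.
have -> : cc `^ p = (2 / T) `^ p * mesh N t `^ p.
  by rewrite /cc (powRM _ _ (ltW (mesh_gt0 N0 gt)))// divr_ge0.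
by rewrite le_eqVlt; apply/orP; left; apply/eqP; ring.
Qed.

End one_grid.

Let IS : \bar R := ((expR (r * T) `^ p * doob_cst p)%:E * \int[P]_w (S T w `^ p)%:E)%E.

Let IS_fin : IS \is a fin_num.
Proof.
apply: fin_numM; first exact: isT.
rewrite ge0_fin_numE; first exact: ES.
by apply: integral_ge0 => w _; exact: powR_ge0.
Qed.

Let mlnS u : 0 <= u <= T -> measurable_fun [set: Omega] (fun w => ln (S u w)).
Proof.
by move=> uT; apply: measurableT_comp; [exact: measurable_ln|exact: (process_measurable filF aS)].
Qed.

Let p1 : 1 < p. Proof. by have h := p2; lra. Qed.

Lemma geometric_discrete_measurable N t : is_monitoring_grid T N t ->
  measurable_fun [set: Omega] (fun w => geometric_discrete N t (S ^~ w)).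
Proof.
move=> gt; rewrite /geometric_discrete; apply: measurableT_comp; first exact: measurable_expR.
apply: measurable_funM => //.
have E w : \sum_(j < N.+1) weight N t j * ln (S (t j) w) =
    \sum_(j < N.+1) weight N t j * ln (S (t (minn j N)) w).
  by apply: eq_bigr => j _; rewrite (minn_idPl _)// -ltnS.
under eq_fun do rewrite E.
apply: measurable_sum => j; apply: measurable_funM => //; apply: mlnS.
by apply: (monitoring_grid_itv gt); exact: geq_minr.
Qed.

Lemma geometric_discrete_moment N t : (0 < N)%N -> is_monitoring_grid T N t ->
  (\int[P]_w (geometric_discrete N t (S ^~ w) `^ p)%:E <= IS)%E.
Proof.
move=> N0 gt; have W0 : 0 < total_weight N t := lt_trans T0 (total_weight_gt N0 gt).
have := @geometric_average_moment _ _ _ P T r p F filF T0' r0 p1 S aS S0 mS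
  (fun k => t (minn k N)) (fun k => weight N t k / total_weight N t) N.
move=> H; apply: le_trans (H _ _ _ _ _).
- apply: ge0_le_integralT => w; first exact: powR_ge0.
  rewrite lee_fin le_eqVlt; apply/orP; left; apply/eqP; congr (expR _ `^ p).
  rewrite mulr_sumr; apply: eq_bigr => j _.
  by rewrite (minn_idPl _) ?mulrA ?[_^-1 * _]mulrC// -ltnS.
- by move=> k; apply: (monitoring_grid_itv gt); exact: geq_minr.
- move=> k; apply: (monitoring_grid_le gt); last exact: geq_minr.
  by rewrite leq_min geq_minr andbT (leq_trans (geq_minl _ _)).
- by rewrite minnn (grid_last gt).
- by move=> k kN; rewrite divr_ge0 ?(ltW W0)// (weight_ge0 N0 gt).
- by rewrite -mulr_suml mulfV// gt_eqF.
Qed.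

(** The term of index [m.+1] has weight 0, since the grid is constant from there on; it is kept
    because [geometric_average_moment] requires the last date to be [T]. *)
Let Gm (m : nat) (w : Omega) : R :=
  expR (\sum_(k < m.+2) ((grid 0 T m k.+1 - grid 0 T m k) / T) * ln (S (grid 0 T m k) w)).

Let gT m k : 0 <= grid 0 T m k <= T. Proof. exact: grid_itv. Qed.

Let gle m k : grid 0 T m k <= grid 0 T m k.+1. Proof. exact: grid_le. Qed.

Let mGm m : measurable_fun [set: Omega] (Gm m).
Proof.
apply: measurableT_comp; first exact: measurable_expR.
by apply: measurable_sum => k; apply: measurable_funM => //; exact: mlnS.
Qed.

Let Gm_cvg : {ae P, forall w, Gm m w @[m --> \oo] --> geometric_continuous T (S ^~ w)}.
Proof.
apply: filterS aeG => w Gw; have cXw := cX Gw.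
apply: continuous_cvg; first exact: continuous_expR.
have E m : \sum_(k < m.+2) ((grid 0 T m k.+1 - grid 0 T m k) / T) * ln (S (grid 0 T m k) w) =
    T^-1 * \sum_(k < m.+2) X w (grid 0 T m k) * (grid 0 T m k.+1 - grid 0 T m k).
  by rewrite mulr_sumr; apply: eq_bigr => k _; rewrite /X; ring.
under eq_fun do rewrite E.
apply: cvgM; first exact: cvg_cst.
apply: (riemann_sum_cvg (v := grid 0 T) (n := fun m => m.+2) (hm := fun m => (T - 0) / m.+1%:R) T0' cXw).
- by move=> m; exact: grid0.
- by move=> m; rewrite /grid (minn_idPr _)// mulfV ?pnatr_eq0// mulr1 addrC subrK.
- exact: gle.
- exact: gT.
- by move=> m k; exact: grid_step_le.
- exact: grid_step_cvg0.
Qed.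

(** The set [C] where the Riemann averages converge has full measure, hence is measurable by
    completeness. Multiplied by its indicator they converge everywhere, to a function that agrees
    almost surely with the continuous average. *)
Lemma geometric_continuous_measurable :
  measurable_fun [set: Omega] (fun w => geometric_continuous T (S ^~ w)).
Proof.
have [C mC aeC] : exists2 C, measurable C & {ae P, forall w, C w} /\
    forall w, C w -> Gm m w @[m --> \oo] --> geometric_continuous T (S ^~ w).
  exists [set w | Gm m w @[m --> \oo] --> geometric_continuous T (S ^~ w)] => //.
  exact: (ae_measurable filF usF T0').
apply: (ae_eq_measurable filF usF T0' (f := fun w => \1_C w * geometric_continuous T (S ^~ w))).
  apply: (@measurable_fun_cvg _ _ _ _ (fun m w => \1_C w * Gm m w)).
    by move=> m; apply: measurable_funM.
  move=> w _; have [Cw|nCw] := pselect (C w).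
    by rewrite indicE mem_set//; apply: cvgM; [exact: cvg_cst|exact: aeC.2].
  by rewrite indicE memNset//; under eq_fun do rewrite mul0r; rewrite mul0r; exact: cvg_cst.
by apply: filterS aeC.1 => w Cw; rewrite indicE mem_set// mul1r.
Qed.

Lemma geometric_continuous_moment :
  (\int[P]_w (geometric_continuous T (S ^~ w) `^ p)%:E <= IS)%E.
Proof.
apply: (@fatou_le_cvg _ _ _ P (fun m w => Gm m w `^ p)).
- by move=> m; exact: mpow.
- by move=> m w; exact: powR_ge0.
- by move=> w; exact: powR_ge0.
- apply: filterS Gm_cvg => w cw.
  have h := cvg_norm_powR p1 cw; rewrite ger0_norm ?expR_ge0// in h.
  by under eq_fun do rewrite -[Gm _ w]ger0_norm ?expR_ge0//.
move=> m; apply: (@geometric_average_moment _ _ _ P T r p F filF T0' r0 p1 S aS S0 mS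
  (grid 0 T m) (fun k => (grid 0 T m k.+1 - grid 0 T m k) / T) m.+1) => //.
- exact: grid_end.
- by move=> k _; rewrite divr_ge0// subr_ge0.
rewrite -mulr_suml -(big_mkord xpredT (fun k => grid 0 T m k.+1 - grid 0 T m k)).
rewrite telescope_sumr// grid0 /grid (minn_idPr _)//.
by rewrite mulfV ?pnatr_eq0// mulr1 add0r !subr0 mulfV// gt_eqF.
Qed.

Definition geometric_gap_cst : R := gap_cst + 2 `^ p * (fine IS + fine IS).

(** In [powR_expR_sub_le] with [D] the mesh, the factor [D^(-p)] cancels the [D^p] of
    [average_gap_moment], and the exponential terms are bounded by [IS]; the prefactor [D^q] is all
    that remains of the mesh. *)
Lemma geometric_gap_moment N t : (0 < N)%N -> is_monitoring_grid T N t ->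
  (\int[P]_w (`|geometric_discrete N t (S ^~ w) - geometric_continuous T (S ^~ w)| `^ q)%:E
   <= (mesh N t `^ q * geometric_gap_cst)%:E)%E.
Proof.
move=> N0 gt; have D0 := mesh_gt0 N0 gt; set D := mesh N t in D0 *.
pose g w := `|average_gap T N t (X w)| `^ p.
pose a w := geometric_discrete N t (S ^~ w) `^ p.
pose b w := geometric_continuous T (S ^~ w) `^ p.
have mg : measurable_fun [set: Omega] g.
  by apply: mpow; apply: measurableT_comp => //; exact: average_gap_measurable.
have ma : measurable_fun [set: Omega] a.
  by apply: mpow; exact: geometric_discrete_measurable.
have mb : measurable_fun [set: Omega] b.
  by apply: mpow; exact: geometric_continuous_measurable.
have q0 : 0 < q by have h := q1; lra.
apply: (@le_trans _ _ (\int[P]_w ((D `^ q)%:E * ((D `^ (- p))%:E * (g w)%:E +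
    (2 `^ p)%:E * ((a w)%:E + (b w)%:E))))%E).
  apply: ge0_le_integralT => w; first by rewrite lee_fin powR_ge0.
  rewrite -!EFinM lee_fin.
  apply: (le_trans (powR_expR_sub_le _ _ D0 q0)); rewrite -/p.
  apply: ler_wpM2l; first exact: powR_ge0.
  apply: lerD; first by [].
  by apply: powRD_le; rewrite ?expR_ge0// ltW.
have mE (f : Omega -> R) : measurable_fun [set: Omega] f ->
    measurable_fun [set: Omega] (EFin \o f).
  by move=> mf; exact/measurable_EFinP.
have g0 w : 0 <= g w by exact: powR_ge0.
have a0 w : 0 <= a w by exact: powR_ge0.
have b0 w : 0 <= b w by exact: powR_ge0.
have mab : measurable_fun [set: Omega] (fun w => ((a w)%:E + (b w)%:E)%E).
  exact: emeasurable_funD (mE _ ma) (mE _ mb).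
have mgD : measurable_fun [set: Omega] (fun w => ((D `^ (- p))%:E * (g w)%:E)%E).
  exact: (measurable_funeM _ (mE _ mg)).
have mabD : measurable_fun [set: Omega] (fun w => ((2 `^ p)%:E * ((a w)%:E + (b w)%:E))%E).
  exact: (measurable_funeM _ mab).
have g1 w : (0 <= (g w)%:E)%E by exact: g0.
have a1 w : (0 <= (a w)%:E)%E by exact: a0.
have b1 w : (0 <= (b w)%:E)%E by exact: b0.
have gD w : (0 <= (D `^ (- p))%:E * (g w)%:E)%E.
  by apply: mule_ge0; [exact: powR_ge0|exact: g1].
have ab w : (0 <= (a w)%:E + (b w)%:E)%E.
  by apply: adde_ge0; [exact: a1|exact: b1].
have abD w : (0 <= (2 `^ p)%:E * ((a w)%:E + (b w)%:E))%E.
  by apply: mule_ge0; [exact: powR_ge0|exact: ab].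
have msum : measurable_fun [set: Omega]
    (fun w => ((D `^ (- p))%:E * (g w)%:E + (2 `^ p)%:E * ((a w)%:E + (b w)%:E))%E).
  exact: emeasurable_funD mgD mabD.
rewrite (ge0_integralZl_EFin P measurableT (fun w _ => adde_ge0 (gD w) (abD w)) msum) ?powR_ge0//.
rewrite (ge0_integralD P measurableT (fun w _ => gD w) mgD (fun w _ => abD w) mabD).
rewrite (ge0_integralZl_EFin P measurableT (fun w _ => g1 w) (mE _ mg)) ?powR_ge0//.
rewrite (ge0_integralZl_EFin P measurableT (fun w _ => ab w) mab) ?powR_ge0//.
rewrite (ge0_integralD P measurableT (fun w _ => a1 w) (mE _ ma) (fun w _ => b1 w) (mE _ mb)).
apply: (@le_trans _ _ ((D `^ q)%:E * ((D `^ (- p))%:E * (D `^ p * gap_cst)%:E +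
    (2 `^ p)%:E * (IS + IS)))%E).
  apply: lee_wpmul2l; first by rewrite lee_fin powR_ge0.
  apply: leeD; apply: lee_wpmul2l; rewrite ?lee_fin ?powR_ge0//.
    exact: average_gap_moment.
  apply: leeD; first exact: geometric_discrete_moment.
  exact: geometric_continuous_moment.
rewrite -(fineK IS_fin) -!EFinM lee_fin /geometric_gap_cst.
by rewrite mulrA -powRD ?addNr ?powRr0 ?mul1r// eqxx gt_eqF.
Qed.

End geometric_gap.

(** * The supremum over time *)

Section cadlag_supremum.
Context {R : realType}.
Implicit Types (T : R) (f g : R -> R).

Definition sup_abs T f : \bar R := ereal_sup [set `|f u|%:E | u in `[0, T]].

Lemma cadlag_pathB T f g : cadlag_path T f -> cadlag_path T g ->
  cadlag_path T (fun u => f u - g u).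
Proof.
move=> [fr fl] [gr gl]; split => u uT; first by apply: cvgB; [exact: fr|exact: gr].
have [[a fa] [b gb]] := (fl u uT, gl u uT); exists (a - b); exact: cvgB.
Qed.

(** Terms equal to [y] must be allowed besides approach from the right; for [y = T] all terms are of
    that kind. *)
Lemma cadlag_path_cvg T f (x : nat -> R) y : cadlag_path T f -> 0 <= y <= T ->
  (forall m, y <= x m <= T) -> x m @[m --> \oo] --> y ->
  f (x m) @[m --> \oo] --> f y.
Proof.
move=> [fr _] /andP[y0 yT] xy cx.
have [Ty|yltT] := leP T y.
  have E m : x m = y.
    by have /andP[h1 h2] := xy m; apply/eqP; rewrite eq_le h1 (le_trans h2).
  by under eq_fun do rewrite E; exact: cvg_cst.
have fy := fr y; rewrite y0 yltT in fy; have {}fy := fy isT.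
apply/cvgrPdist_lt => e e0; move/cvgrPdist_lt/(_ _ e0) : fy => fy.
have : \forall m \near \oo, y < x m -> `|f y - f (x m)| < e by exact: cx fy.
apply: filterS => m h; have /andP[h1 _] := xy m.
move: h1; rewrite le_eqVlt => /predU1P[<-|/h//].
by rewrite subrr normr0.
Qed.

(** Grid points selected by [first_index] approach a given time from the right, so right-continuity
    bounds the value at each time by the lower limit of the grid maxima. The supremum follows by
    taking the q-th root. *)
Lemma cadlag_sup_powR_le T q f : 0 <= T -> 1 < q -> cadlag_path T f ->
  (sup_abs T f `^ q <=
   limn_einf (fun m => (running_max (fun k => `|f (grid 0 T m k)|) m.+1 `^ q)%:E))%E.
Proof.
move=> T0 q1 cf; set h := (fun m => _); set l := limn_einf h.
have q0 : 0 < q by lra.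
have fl u : 0 <= u <= T -> ((`|f u| `^ q)%:E <= l)%E.
  move=> uT; have /andP[u0 uT'] := uT.
  pose x m := grid 0 T m (first_index u (grid 0 T m) m.+1).
  have ux m : u <= x m <= T.
    have /andP[_ ->] := @grid_itv R 0 T m (first_index u (grid 0 T m) m.+1) T0.
    rewrite andbT /x; have := first_index_le u (grid 0 T m) m.+1.
    rewrite leq_eqVlt => /predU1P[->|]; first by rewrite grid_end.
    exact: first_indexP.
  have cx : x m @[m --> \oo] --> u.
    by have := grid_first_index_cvg T0 u0; rewrite (min_r uT').
  have cfx := cvg_norm_powR q1 (cadlag_path_cvg cf uT ux cx).
  have cE : (`|f (x m)| `^ q)%:E @[m --> \oo] --> (`|f u| `^ q)%:E.
    by apply: cvg_EFin => //; exact: nearW.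
  rewrite -(cvg_limn_einf_sup cE).1 /l !limn_einf_lim; apply: lee_lim.
  - exact: ereal_nondecreasing_is_cvgn (nondecreasing_einfs _).
  - exact: ereal_nondecreasing_is_cvgn (nondecreasing_einfs _).
  apply: nearW => n; apply: le_ereal_inf_tmp => _ [m nm <-].
  apply: (@le_trans _ _ (`|f (x m)| `^ q)%:E); first by apply: ereal_inf_lbound; exists m.
  rewrite lee_fin; apply: le_powR; [exact: ltW|exact: normr_ge0|].
  apply: (@running_max_ge _ (fun k => `|f (grid 0 T m k)|) m.+1).
  exact: first_index_le.
have l0 : (0 <= l)%E by apply: le_trans (fl 0 _); rewrite ?lee_fin ?powR_ge0// lexx.
move: fl l0; case: l => [l| |]// fl l0; last by rewrite leey.
rewrite lee_fin in l0.
have s0 : (0 <= sup_abs T f)%E.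
  apply: le_ereal_sup_tmp; exists (`|f 0|%:E); last by rewrite lee_fin.
  by exists 0 => //=; rewrite in_itv/= lexx.
have : (sup_abs T f <= (l `^ q^-1)%:E)%E.
  apply: ge_ereal_sup => _ [u uT <-]; rewrite /= in_itv/= in uT.
  have := fl u uT; rewrite !lee_fin => flu.
  have -> : `|f u| = (`|f u| `^ q) `^ q^-1 by rewrite -powRrM mulfV ?gt_eqF// powRr1.
  by apply: le_powR => //; rewrite ?invr_ge0 ?(ltW q0) ?powR_ge0.
move=> sl; have : (sup_abs T f `^ q <= (l `^ q^-1)%:E `^ q)%E.
  apply: gt0_ler_poweR => //; first exact: ltW.
  - by rewrite in_itv/= leey andbT.
  - by rewrite in_itv/= leey andbT lee_fin powR_ge0.
by rewrite poweR_EFin -powRrM mulVf ?gt_eqF// powRr1.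
Qed.

End cadlag_supremum.

Section doob_cadlag.
Context {d : measure_display} {Omega : measurableType d} {R : realType}.
Variables (P : probability Omega R) (T : R) (F : R -> set (set Omega)).
Hypotheses (filF : is_filtration T F) (T0 : 0 <= T).
Implicit Types (Z : Omega -> R) (V : R -> Omega -> R).

Lemma is_condexpB (G : set (set Omega)) Z1 Z2 Y1 Y2 :
  sigma_algebra [set: Omega] G -> G `<=` measurable ->
  P.-integrable [set: Omega] (EFin \o Z1) -> P.-integrable [set: Omega] (EFin \o Z2) ->
  is_condexp P G Z1 Y1 -> is_condexp P G Z2 Y2 ->
  is_condexp P G (fun w => Z1 w - Z2 w) (fun w => Y1 w - Y2 w).
Proof.
move=> sG Gm iZ1 iZ2 [iY1 mY1 e1] [iY2 mY2 e2]; split.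
- exact: integrableB_EFin.
- exact: measurable_wrtB.
move=> B GB; have mB := Gm _ GB.
have sub f : P.-integrable [set: Omega] (EFin \o f) -> P.-integrable B (EFin \o f).
  by move=> fi; apply: (integrableS measurableT mB).
under eq_integral do rewrite EFinB.
rewrite (integralB mB (sub _ iY1) (sub _ iY2)).
under [RHS]eq_integral do rewrite EFinB.
by rewrite (integralB mB (sub _ iZ1) (sub _ iZ2)) e1// e2.
Qed.

Lemma is_condexp_tower (G H : set (set Omega)) Z Y X : G `<=` H ->
  is_condexp P G Z Y -> is_condexp P H Z X -> is_condexp P G X Y.
Proof.
move=> GH [iY mY eY] [_ _ eX]; split=> // B GB; rewrite eY// eX//; exact: GH.
Qed.

Lemma is_cadlag_condexp_martingaleB Z1 Z2 V1 V2 :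
  P.-integrable [set: Omega] (EFin \o Z1) -> P.-integrable [set: Omega] (EFin \o Z2) ->
  is_cadlag_condexp_martingale P T F Z1 V1 -> is_cadlag_condexp_martingale P T F Z2 V2 ->
  is_cadlag_condexp_martingale P T F (fun w => Z1 w - Z2 w) (fun u w => V1 u w - V2 u w).
Proof.
move=> iZ1 iZ2 [c1 v1] [c2 v2]; split.
  by apply: filterS2 c1 c2 => w; exact: cadlag_pathB.
move=> u uT; apply: is_condexpB; [exact: (filtration_sigma filF uT)|
  exact: (filtration_measurable filF uT)|by []|by []|exact: v1|exact: v2].
Qed.

(* [Z] need not be F_T-measurable: it is used as an additional last term of the
   discrete martingale along each grid. *)
Lemma doob_cadlag Z V q : 1 < q -> P.-integrable [set: Omega] (EFin \o Z) ->
  is_cadlag_condexp_martingale P T F Z V ->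
  (\int[P]_w (sup_abs T (V ^~ w) `^ q) <=
   (doob_cst q)%:E * \int[P]_w (`|Z w| `^ q)%:E)%E.
Proof.
move=> q1 iZ [cV vV].
pose u m k : R := grid 0 T m k.
have uT m k : 0 <= u m k <= T by exact: grid_itv.
apply: (@fatou_le _ _ _ P (fun m w => running_max (fun k => `|V (u m k) w|) m.+1 `^ q)).
- move=> m; apply: (@measurableT_comp _ _ _ _ _ _ (@powR R ^~ q)) => //.
  apply: running_max_measurable => k.
  apply: measurableT_comp => //.
  exact: integrable_measurable (condexp_integrable (vV _ (uT m k))).
- by move=> m w; exact: powR_ge0.
- by move=> w; exact: poweR_ge0.
- by apply: filterS cV => w cw; exact: cadlag_sup_powR_le.
move=> m; pose f k := if (k <= m.+1)%N then V (u m k) else Z.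
apply: (@le_trans _ _ (\int[P]_w (running_max (fun k => `|f k w|) m.+2 `^ q)%:E)%E).
  apply: ge0_le_integralT => w; rewrite lee_fin ?powR_ge0//.
  apply: le_powR; [by lra|exact: running_max_ge0|].
  apply: running_max_le; first exact: running_max_ge0.
  move=> k km; have -> : `|V (u m k) w| = `|f k w| by rewrite /f km.
  by apply: (@running_max_ge _ (fun k => `|f k w|)); exact: leqW.
have -> : Z = f m.+2 by rewrite /f ltnn.
apply: (@doob_discrete _ _ _ P (fun k => F (u m k))) => //.
- by move=> k; exact: (filtration_sigma filF (uT m k)).
- by move=> k; exact: (filtration_measurable filF (uT m k)).
- move=> k; have /andP[h1 _] := uT m k; have /andP[_ h2] := uT m k.+1.
  by apply: (filtration_le filF) => //; exact: grid_le.
- move=> k; rewrite ltnS => km; rewrite /f km; case: ifPn => km1; last exact: vV.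
  apply: (is_condexp_tower _ (vV _ (uT m k)) (vV _ (uT m k.+1))).
  have /andP[h1 _] := uT m k; have /andP[_ h2] := uT m k.+1.
  by apply: (filtration_le filF) => //; exact: grid_le.
- by rewrite /f ltnn.
Qed.

(** At each time both processes carry the same discount factor, which is at most 1 because
    [r >= 0]. *)
Lemma sup_dist_discounted_le r V1 V2 w : 0 <= r ->
  (sup_dist T (discounted r T V1) (discounted r T V2) w <=
   sup_abs T (fun u => (V1 u w - V2 u w)%R))%E.
Proof.
move=> r0; apply: ge_ereal_sup => _ [u uT <-].
apply: le_trans (ereal_sup_ubound _); last by exists u.
rewrite /= in_itv/= in uT; have /andP[_ uT'] := uT.
rewrite lee_fin /discounted -mulrBr normrM ger0_norm ?expR_ge0//.
rewrite ler_piMl// -[leRHS]expR0 ler_expR oppr_le0 mulr_ge0// subr_ge0//.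
Qed.

End doob_cadlag.

(** * Lipschitz payoffs and conclusion *)

Section lipschitz_payoff.
Context {d : measure_display} {Omega : measurableType d} {R : realType}.
Variables (P : probability Omega R) (T : R) (F : R -> set (set Omega)).
Hypotheses (filF : is_filtration T F) (usF : usual_conditions P T F) (T0 : 0 <= T).
Variables (h : R * R -> R) (Lh q p : R) (Y : Omega -> R).
Hypotheses (q1 : 1 < q) (p1 : 1 < p)
  (mh : measurable_fun ([set x : R | 0 <= x] `*` [set y : R | 0 <= y]) h)
  (Lh0 : 0 < Lh)
  (hL : forall x x' y : R, 0 < x -> 0 < x' -> 0 < y ->
     `|h (x, y) - h (x', y)| <= Lh * `|x - x'|)
  (mY : measurable_fun [set: Omega] Y) (Y0 : {ae P, forall w, 0 < Y w})
  (LY : (fun w => h (1, Y w)) \in Lfun P q%:E).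
Implicit Types G : Omega -> R.

Lemma le_1D_powR (s x : R) : 1 < s -> 0 <= x -> x <= 1 + x `^ s.
Proof.
move=> s1 x0; have [x1|x1] := leP x 1; first by rewrite (le_trans x1)// lerDl powR_ge0.
rewrite -[leLHS]powRr1//; apply: (@le_trans _ _ (x `^ s)); last by rewrite lerDr.
by apply: ler_powR; exact: ltW.
Qed.

(** [h] is measurable on the closed quadrant only, whereas [Y] is positive almost surely only;
    composition is done with [max 0 Y], and completeness transfers the result to [Y]. *)
Lemma payoff_measurable G : measurable_fun [set: Omega] G -> (forall w, 0 < G w) ->
  measurable_fun [set: Omega] (fun w => h (G w, Y w)).
Proof.
move=> mG G0.
apply: (ae_eq_measurable filF usF T0 (f := fun w => h (G w, Num.max 0 (Y w)))).
  apply: (measurable_comp (F := [set x : R | 0 <= x] `*` [set y : R | 0 <= y])) mh _.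
  - have E : [set x : R | 0 <= x] = `[0, +oo[%classic.
      by apply/seteqP; split => x; rewrite /= in_itv/= andbT.
    by rewrite E; apply: measurableX.
  - by move=> _ [w _ <-]; split => /=; [exact: ltW|rewrite le_max lexx].
  - by apply: measurable_fun_pair => //; apply: measurable_maxr.
by apply: filterS Y0 => w Yw; rewrite max_r// ltW.
Qed.

(** The Lipschitz property compares [h (G w, Y w)] with [h (1, Y w)] at the cost [Lh * |G w - 1|];
    the bound [x <= 1 + x^s] then turns the assumed q-th and p-th moments into an integrable
    majorant. *)
Lemma payoff_integrable G : measurable_fun [set: Omega] G -> (forall w, 0 < G w) ->
  (\int[P]_w (G w `^ p)%:E < +oo)%E ->
  P.-integrable [set: Omega] (fun w => (h (G w, Y w))%:E).
Proof.
move=> mG G0 EG; have mZ := payoff_measurable mG G0.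
pose b w := (1 + `|h (1, Y w)| `^ q) + Lh * ((1 + G w `^ p) + 1).
have iG : P.-integrable [set: Omega] (fun w => (G w `^ p)%:E).
  apply: integrable_ge0 => //; last by move=> w; exact: powR_ge0.
  exact: (@measurableT_comp _ _ _ _ _ _ (@powR R ^~ p)).
have icst (k : R) : P.-integrable [set: Omega] (fun w => k%:E).
  by apply: (@integrable_bounded _ _ _ _ `|k|).
have ib : P.-integrable [set: Omega] (EFin \o b).
  have iL : P.-integrable [set: Omega] (fun w => (`|h (1, Y w)| `^ q)%:E).
    exact: (Lfun_integrable (ltW q1) LY).
  apply: integrableD_EFin; first exact: (integrableD_EFin (icst 1) iL).
  apply: integrableZ_EFin; exact: (integrableD_EFin (integrableD_EFin (icst 1) iG) (icst 1)).
apply/integrableP; split; first exact/measurable_EFinP.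
have b0 w : 0 <= b w.
  by rewrite /b; repeat (apply: addr_ge0 || apply: mulr_ge0 || exact: powR_ge0 || exact: ltW).
apply: (@le_lt_trans _ _ (\int[P]_w (b w)%:E)%E).
  apply: ae_le_integral_l => //; first exact: measurable_int ib.
  apply: filterS Y0 => w Yw; rewrite /= lee_fin.
  have E : h (G w, Y w) = h (1, Y w) + (h (G w, Y w) - h (1, Y w)) by rewrite addrC subrK.
  rewrite E; apply: (le_trans (ler_normD _ _)); apply: lerD; first exact: le_1D_powR.
  apply: (le_trans (hL (G0 w) ltr01 Yw)); rewrite ler_pM2l//.
  apply: (le_trans (ler_normB _ _)); rewrite normr1 lerD2r ger0_norm ?(ltW (G0 w))//.
  by apply: le_1D_powR => //; exact: ltW.
have /integrableP[_] := ib; apply: le_lt_trans.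
by apply: ge0_le_integralT => w; rewrite lee_fin// ler_norm.
Qed.

Lemma payoff_gap_moment G1 G2 :
  measurable_fun [set: Omega] G1 -> measurable_fun [set: Omega] G2 ->
  (forall w, 0 < G1 w) -> (forall w, 0 < G2 w) ->
  (\int[P]_w (`|h (G1 w, Y w) - h (G2 w, Y w)| `^ q)%:E
   <= (Lh `^ q)%:E * \int[P]_w (`|G1 w - G2 w| `^ q)%:E)%E.
Proof.
move=> mG1 mG2 G10 G20.
have mG : measurable_fun [set: Omega] (fun w => `|G1 w - G2 w| `^ q).
  apply: (@measurableT_comp _ _ _ _ _ _ (@powR R ^~ q)) => //.
  by apply: measurableT_comp => //; exact: measurable_funB.
have g0 w : (0 <= (`|G1 w - G2 w| `^ q)%:E)%E by rewrite lee_fin powR_ge0.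
rewrite -(ge0_integralZl_EFin P measurableT (fun w _ => g0 w)) ?powR_ge0//; last exact/measurable_EFinP.
apply: ae_le_integral_l.
- by move=> w; rewrite lee_fin powR_ge0.
- by move=> w; rewrite mule_ge0// lee_fin powR_ge0.
- by apply/measurable_EFinP; exact: measurable_funM.
apply: filterS Y0 => w Yw; rewrite -EFinM lee_fin -powRM//; last exact: ltW.
by apply: le_powR => //; [have := q1; lra|exact: hL].
Qed.

End lipschitz_payoff.

Theorem theorem3p4 (R : realType) (d : measure_display)
    (Omega : measurableType d) (P : probability Omega R)
    (T r : R) (F : R -> set (set Omega)) (S : R -> Omega -> R)
    (t : nat -> nat -> R) (q : R) (A M Q : R -> Omega -> R)
    (h : R * R -> R) (Lh : R)
    (VN : nat -> R -> Omega -> R) (Vc : R -> Omega -> R) :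
  0 < T -> 0 <= r ->
  is_filtration T F -> usual_conditions P T F ->
  is_continuous_semimartingale P T F S ->
  {ae P, forall w, forall u : R, 0 <= u <= T -> 0 < S u w} ->
  is_martingale P T F (fun u w => expR (- (r * u)) * S u w) ->
  (forall N, (1 <= N)%N -> is_monitoring_grid T N (t N)) ->
  (fun N => mesh N (t N)) @ \oo --> (0 : R) ->
  1 < q -> ('E_P[fun w => (S T w `^ (2 * q))%R] < +oo)%E ->
  semimartingale_decomposition P T F (fun u w => ln (S u w)) A M ->
  continuous_process P T A -> continuous_process P T M ->
  is_quadratic_variation P T F M Q ->
  ('N[P]_((2 * q)%:E)[(fun w => total_variation 0 T (A ^~ w))]
     + 'N[P]_((2 * q)%:E)[(fun w => (Num.sqrt (Q T w))%:E)] < +oo)%E ->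
  measurable_fun ([set x : R | 0 <= x] `*` [set y : R | 0 <= y]) h -> 0 < Lh ->
  (forall x x' y : R, 0 < x -> 0 < x' -> 0 < y ->
     `|h (x, y) - h (x', y)| <= Lh * `|x - x'|) ->
  (fun w => h (1, S T w)) \in Lfun P q%:E ->
  (forall N, (1 <= N)%N ->
     is_cadlag_condexp_martingale P T F
       (fun w => h (geometric_discrete N (t N) (S ^~ w), S T w)) (VN N)) ->
  is_cadlag_condexp_martingale P T F
    (fun w => h (geometric_continuous T (S ^~ w), S T w)) Vc ->
  exists2 Lambda : R, 0 < Lambda &
    forall N, (1 <= N)%N ->
      (\int[P]_w (sup_dist T (discounted r T (VN N)) (discounted r T Vc) w `^ q)
       <= (Lambda * mesh N (t N) `^ q)%:E)%E.
Proof.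
move=> T0 r0 filF usF [[aS _] _] S0 mS gt _ q1 ES dec cA cM qQ LAQ mh Lh0 hL Lh1 VNP VcP.
have T0' := ltW T0; have TT : 0 <= T <= T by rewrite lexx T0'.
have {}ES : (\int[P]_w (S T w `^ (2 * q))%:E < +oo)%E by move: ES; rewrite unlock.
have mST : measurable_fun [set: Omega] (S T).
  exact: (process_measurable filF aS TT).
have ST0 : {ae P, forall w, 0 < S T w} by apply: filterS S0 => w; exact.
have p1 : 1 < 2 * q by lra.
have IS : ((expR (r * T) `^ (2 * q) * doob_cst (2 * q))%:E *
    \int[P]_w (S T w `^ (2 * q))%:E < +oo)%E.
  rewrite ltey_eq fin_numM// ge0_fin_numE//.
  by apply: integral_ge0 => w _; rewrite lee_fin powR_ge0.
pose GN N w := geometric_discrete N (t N) (S ^~ w).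
pose Gc w := geometric_continuous T (S ^~ w).
have GN0 N w : 0 < GN N w by exact: expR_gt0.
have Gc0 w : 0 < Gc w by exact: expR_gt0.
have mGN N : (1 <= N)%N -> measurable_fun [set: Omega] (GN N).
  by move=> N1; exact: (geometric_discrete_measurable filF aS (gt N N1)).
have mGc : measurable_fun [set: Omega] Gc by exact: (geometric_continuous_measurable filF usF T0 aS dec cA cM).
pose C := doob_cst q * (Lh `^ q * geometric_gap_cst P T r q S A Q).
(* The absolute value and the added 1 give positivity without examining the sign of
   [geometric_gap_cst]; [C] does not involve [N]. *)
exists (`|C| + 1); first by rewrite ltr_pwDr.
move=> N N1.
have iN : P.-integrable [set: Omega] (fun w => (h (GN N w, S T w))%:E).
  apply: (payoff_integrable filF usF T0' q1 p1 mh Lh0 hL mST ST0 Lh1 (mGN N N1) (GN0 N)).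
  apply: le_lt_trans IS.
  exact: (geometric_discrete_moment filF T0 r0 q1 aS S0 mS N1 (gt N N1)).
have ic : P.-integrable [set: Omega] (fun w => (h (Gc w, S T w))%:E).
  apply: (payoff_integrable filF usF T0' q1 p1 mh Lh0 hL mST ST0 Lh1 mGc Gc0).
  apply: le_lt_trans IS.
  exact: (geometric_continuous_moment filF T0 r0 q1 aS S0 mS dec cA cM).
have VP := is_cadlag_condexp_martingaleB filF iN ic (VNP N N1) VcP.
apply: (@le_trans _ _ (\int[P]_w (sup_abs T (fun u => (VN N u w - Vc u w)%R) `^ q))%E).
  apply: ge0_le_integralT => w; first exact: poweR_ge0.
  have sup0 := sup_dist_discounted_le T (VN N) Vc w r0.
  have sd0 : (0 <= sup_dist T (discounted r T (VN N)) (discounted r T Vc) w)%E.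
    apply: le_ereal_sup_tmp; exists (`|discounted r T (VN N) 0 w - discounted r T Vc 0 w|%:E).
      by exists 0 => //=; rewrite in_itv/= lexx.
    by rewrite lee_fin.
  apply: gt0_ler_poweR => //; first by lra.
  - by rewrite in_itv/= leey andbT.
  - by rewrite in_itv/= leey andbT (le_trans sd0).
apply: (le_trans (doob_cadlag filF T0' q1 (integrableB_EFin iN ic) VP)).
apply: (@le_trans _ _ ((doob_cst q)%:E * ((Lh `^ q)%:E *
    (mesh N (t N) `^ q * geometric_gap_cst P T r q S A Q)%:E))%E).
  apply: lee_wpmul2l; first by rewrite lee_fin ltW// doob_cst_gt0.
  apply: (le_trans (payoff_gap_moment q1 Lh0 hL ST0 (mGN N N1) mGc (GN0 N) Gc0)).
  apply: lee_wpmul2l; first by rewrite lee_fin powR_ge0.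
  exact: (geometric_gap_moment filF usF T0 r0 q1 aS S0 mS ES dec cA cM qQ LAQ N1 (gt N N1)).
rewrite -!EFinM lee_fin.
have -> : doob_cst q * (Lh `^ q * (mesh N (t N) `^ q * geometric_gap_cst P T r q S A Q)) =
    C * mesh N (t N) `^ q by rewrite /C; ring.
apply: ler_wpM2r; first exact: powR_ge0.
by rewrite (le_trans (ler_norm _))// lerDl.
Qed.
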